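(* Let $(V,X,(S_i)_{i=1,\dots,N})$ be a conformal iterated function system with self-conformal set $K$, let $(p_1,\dots,p_N)$ be a probability vector (with $p_i>0$), and let $\mu$ be the associated self-conformal measure, i.e. the unique probability measure such that $\mu=\sum_i p_i\,\mu\circ S_i^{-1}$. For $C\subseteq\mathbb R$ and a continuous function $\varphi:\Sigma^{\mathbb N}\to\mathbb R$ define the dynamical self-conformal multifractal zeta-function by $$\zeta_C^{\mathrm{dyn\text{-}con}}(\varphi;z)=\sum_n\frac{z^n}{n}\left(\sum_{|\mathbf i|=n,\ \frac{\log p_{\mathbf i}}{\log\operatorname{diam}K_{\mathbf i}}\in C}\ \sup_{\mathbf u\in[\mathbf i]}\exp\sum_{k=0}^{n-1}\varphi(S^k\mathbf u)\right).$$ Let $\Lambda$ be the scaling map and $\beta:\mathbb R\to\mathbb R$ the function defined by $P(\beta(q)\Lambda+q\Phi)=0$ (see context). (1) Assume that $C\subseteq\mathbb R$ is closed. (1.1) There is a unique real number $\mathfrak f(C)$ such that $$\lim_{r\searrow0}\sigma_{\mathrm{rad}}\big(\zeta^{\mathrm{dyn\text{-}con}}_{B(C,r)}(\mathfrak f(C)\Lambda;\cdot)\big)=1.$$ If $\alpha\in\mathbb R$ and $C=\{\alpha\}$, write $\mathfrak f(\alpha)=\mathfrak f(C)$. (1.2) We have $\mathfrak f(C)=\sup_{\alpha\in C}\beta^*(\alpha)$. (1.3) If the Open Set Condition is satisfied, then $$\mathfrak f(C)=\dim_{\mathrm H}\Big\{x\in K:\ \operatorname*{acc}_{r\searrow0}\frac{\log\mu(B(x,r))}{\log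 r}\subseteq C\Big\}.$$ In particular, if the Open Set Condition is satisfied and $\alpha\in\mathbb R$, then $$\mathfrak f(\alpha)=\dim_{\mathrm H}\Big\{x\in K:\ \lim_{r\searrow0}\frac{\log\mu(B(x,r))}{\log r}=\alpha\Big\}.$$ (2) Assume that $C\subseteq\mathbb R$ is a closed interval with $\overset{\circ}{C}\cap(-\beta'(\mathbb R))\neq\varnothing$. (2.1) There is a unique real number $\mathfrak F(C)$ such that $\sigma_{\mathrm{rad}}\big(\zeta^{\mathrm{dyn\text{-}con}}_{C}(\mathfrak F(C)\Lambda;\cdot)\big)=1$. (2.2) We have $\mathfrak F(C)=\sup_{\alpha\in C}\beta^*(\alpha)$. (2.3) If the Open Set Condition is satisfied, then $$\mathfrak F(C)=\dim_{\mathrm H}\Big\{x\in K:\ \operatorname*{acc}_{r\searrow0}\frac{\log\mu(B(x,r))}{\log r}\subseteq C\Big\}.$$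
   Context: Symbolic notation: $\Sigma^{\mathbb N}=\{1,\dots,N\}^{\mathbb N}$ (product topology); finite strings $\mathbf i=i_1\dots i_n$ have length $|\mathbf i|=n$; $[\mathbf i]\subseteq\Sigma^{\mathbb N}$ is the cylinder of infinite strings beginning with $\mathbf i$; $\mathbf i|n=i_1\dots i_n$ for $\mathbf i\in\Sigma^{\mathbb N}$; $S$ (without index) is the shift $S(i_1i_2\dots)=i_2i_3\dots$. A conformal iterated function system $(V,X,(S_i)_{i=1,\dots,N})$ consists of: an open connected $V\subseteq\mathbb R^d$; a compact $X\subseteq V$ equal to the closure of its interior; contractive $C^{1+\gamma}$ diffeomorphisms $S_i:V\to V$ (with $0<\gamma<1$) with $S_iX\subseteq X$, such that for every $x\in V$ and every $i$ the derivative $(DS_i)(x)$ is a contractive similarity, i.e. there is $r_i(x)\in(0,1)$ with $|(DS_i)(x)u-(DS_i)(x)v|=r_i(x)|u-v|$ for all $u,v\in\mathbb R^d$. The self-conformal set $K$ is the unique non-empty compact $K\subseteq X$ with $K=\bigcup_iS_iK$. For $\mathbf i=i_1\dots i_n$ write $p_{\mathbf i}=p_{i_1}\cdots p_{i_n}$, $S_{\mathbf i}=S_{i_1}\circ\cdots\circ S_{i_n}$, $K_{\mathbf i}=S_{\mathbf i}K$. The projection $\pi:\Sigma^{\mathbb N}\to K$ is defined by $\{\pi(\mathbf i)\}=\bigcap_nK_{\mathbf i|n}$. The scaling map is $\Lambda(\mathbf i)=\log|DS_{i_1}(\pi S\mathbf i)|$, and $\Phi(\mathbf i)=\log p_{i_1}$,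 for $\mathbf i=i_1i_2\dots\in\Sigma^{\mathbb N}$. The Open Set Condition: there is an open, non-empty, bounded $O\subseteq X$ with $S_iO\subseteq O$ for all $i$ and $S_iO\cap S_jO=\varnothing$ for $i\ne j$. The pressure of a continuous $\varphi:\Sigma^{\mathbb N}\to\mathbb R$ is $P(\varphi)=\lim_n\frac1n\log\sum_{|\mathbf i|=n}\sup_{\mathbf u\in[\mathbf i]}\exp\sum_{k=0}^{n-1}\varphi(S^k\mathbf u)$; $\beta(q)$ is the unique real number with $P(\beta(q)\Lambda+q\Phi)=0$. The Legendre transform of $\beta$ is $\beta^*(x)=\inf_{y\in\mathbb R}(xy+\beta(y))\in[-\infty,\infty]$. $\sigma_{\mathrm{rad}}$ denotes the radius of convergence of a power series; $\dim_{\mathrm H}$ is Hausdorff dimension with $\dim_{\mathrm H}\varnothing=-\infty$; $B(x,r)$ is the ball with center $x$ and radius $r$; for $C\subseteq\mathbb R$, $B(C,r)=\{x:\operatorname{dist}(x,C)<r\}$; $\operatorname{acc}_{r\searrow0}f(r)$ is the set of accumulation points of $f(r)$ as $r\searrow0$; $\overset{\circ}{C}$ is the interior of $C$; $\beta'(\mathbb R)$ is the range of the derivative of $\beta$.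
   Formalization: In (1.1) f(C) is real or -∞ (-∞ meaning that the radii tend to +∞ for every exponent); a unique real f(C) is claimed exactly when C meets the closure of -β'(R), since otherwise none exists. If N≥2, K is assumed not to be a single point, so that log diam K_i is defined. *)

(* Defs.v *)
From mathcomp Require Import all_boot all_order all_algebra.
From mathcomp Require Import all_classical all_reals all_analysis.
Import Order.TTheory GRing.Theory Num.Theory.
Import numFieldNormedType.Exports.

Set Implicit Arguments.
Unset Strict Implicit.
Unset Printing Implicit Defensive.

Local Open Scope classical_set_scope.
Local Open Scope ring_scope.

(* The library norm on 'rV_d is the sup norm.  It is used for topology and
   differentiability (which do not depend on the norm); every metric notion below
   (similarities, operator norms, diameters, balls, Hausdorff dimension) uses the
   Euclidean norm. *)
Section Euclidean.
Variables (R : realType) (d : nat).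
Implicit Types (x y u v : 'rV[R]_d) (A : set 'rV[R]_d).

Definition enorm u : R := Num.sqrt (\sum_(j < d) u ord0 j ^+ 2).

Definition eball x (r : R) : set 'rV[R]_d := [set y | enorm (y - x) < r].

Definition opnorm (L : 'rV[R]_d -> 'rV[R]_d) : R :=
  sup [set enorm (L u) | u in [set u | enorm u <= 1]].

(* The added 0 makes the diameter of the empty set 0 instead of -oo. *)
Definition ediam A : \bar R :=
  ereal_sup ([set 0%E] `|`
    [set e | exists x y, [/\ A x, A y & e = (enorm (x - y))%:E]]).

Definition diam A : R := fine (ediam A).

Definition hausdorff_premeasure (s delta : R) A : \bar R :=
  ereal_inf [set (\sum_(0 <= k <oo) (ediam (U k) `^ s))%E
            | U in [set U : nat -> set 'rV[R]_d |
                A `<=` \bigcup_k U k /\ forall k, (ediam (U k) <= delta%:E)%E]].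

Definition hausdorff_measure (s : R) A : \bar R :=
  ereal_sup [set hausdorff_premeasure s delta A | delta in [set t : R | 0 < t]].

Definition hausdorff_dim A : \bar R :=
  if `[< A = set0 >] then -oo%E
  else ereal_inf [set s%:E | s in [set s : R | 0 < s /\ hausdorff_measure s A = 0%E]].

(* Derivatives are locally Hoelder on V; on an open set this is implied by a
   uniform Hoelder bound. *)
Definition C1holder (gamma : R) (V : set 'rV[R]_d) (f : 'rV[R]_d -> 'rV[R]_d) : Prop :=
  (forall x, V x -> differentiable f x) /\
  (forall x0, V x0 -> exists (c : R) (W : set 'rV[R]_d), nbhs x0 W /\
     forall x y, W x -> W y ->
       opnorm (fun u => 'd f x u - 'd f y u) <= c * enorm (x - y) `^ gamma).

(* Diffeomorphism of V onto its open image f @` V, which is a subset of V for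
   the maps of an iterated function system. *)
Definition C1holder_diffeo (gamma : R) (V : set 'rV[R]_d) (f : 'rV[R]_d -> 'rV[R]_d) : Prop :=
  [/\ C1holder gamma V f, open (f @` V) &
      exists g, (forall x, V x -> g (f x) = x) /\ C1holder gamma (f @` V) g].

Definition contractive (V : set 'rV[R]_d) (f : 'rV[R]_d -> 'rV[R]_d) : Prop :=
  exists c : R, c < 1 /\
    forall x y, V x -> V y -> enorm (f x - f y) <= c * enorm (x - y).

(* The maps are total; only their values on the open set V matter. *)
Record conformal_ifs (gamma : R) (V X : set 'rV[R]_d) (N : nat)
    (S : 'I_N -> 'rV[R]_d -> 'rV[R]_d) : Prop := ConformalIfs {
  cifs_open : open V ;
  cifs_connected : connected V ;
  cifs_sub : X `<=` V ;
  cifs_compact : compact X ;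
  cifs_regular : X = closure (interior X) ;
  cifs_self : forall i, S i @` V `<=` V ;
  cifs_contractive : forall i, contractive V (S i) ;
  cifs_diffeo : forall i, C1holder_diffeo gamma V (S i) ;
  cifs_invariant : forall i, S i @` X `<=` X ;
  cifs_conformal : forall i x, V x -> exists r : R, [/\ 0 < r, r < 1 &
    forall u v, enorm ('d (S i) x u - 'd (S i) x v) = r * enorm (u - v)] }.

Definition self_conformal_set (X : set 'rV[R]_d) (N : nat)
    (S : 'I_N -> 'rV[R]_d -> 'rV[R]_d) (K : set 'rV[R]_d) : Prop :=
  [/\ K !=set0, compact K, K `<=` X & K = \bigcup_i (S i @` K)].

Definition open_set_condition (X : set 'rV[R]_d) (N : nat)
    (S : 'I_N -> 'rV[R]_d -> 'rV[R]_d) : Prop :=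
  exists O : set 'rV[R]_d,
    [/\ open O, O !=set0, bounded_set O, O `<=` X &
        (forall i, S i @` O `<=` O) /\
        (forall i j, i <> j -> S i @` O `&` S j @` O = set0)].

(* Borel probability measures on R^d.  As S i is only meaningful on V, the preimage
   of A under S i is the set of the x in V with S i x in A. *)
Definition self_conformal_measure (V : set 'rV[R]_d) (N : nat)
    (S : 'I_N -> 'rV[R]_d -> 'rV[R]_d) (p : 'I_N -> R)
    (mu : probability (g_sigma_algebraType (@open 'rV[R]_d)) R) : Prop :=
  forall A : set (g_sigma_algebraType (@open 'rV[R]_d)), measurable A ->
    mu A = (\sum_(i < N) (p i)%:E * mu (V `&` S i @^-1` A))%E.

Definition local_ratio (mu : probability (g_sigma_algebraType (@open 'rV[R]_d)) R)
    x (r : R) : R :=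
  ln (fine (mu (eball x r))) / ln r.

End Euclidean.

Section Symbolic.
Variables (R : realType) (N : nat).
Implicit Types (u : nat -> 'I_N) (w : seq 'I_N) (phi : (nat -> 'I_N) -> R).

Definition shift u : nat -> 'I_N := fun k => u k.+1.

Definition cylinder w : set (nat -> 'I_N) := [set u | mkseq u (size w) = w].

Definition sup_exp phi w : R :=
  sup [set expR (\sum_(k < size w) phi (iter k shift u)) | u in cylinder w].

(* By subadditivity the limit exists for every continuous phi when 0 < N. *)
Definition pressure phi : R :=
  limn (fun n => n%:R^-1 * ln (\sum_(w : n.-tuple 'I_N) sup_exp phi w)).

Definition pot (p : 'I_N -> R) u : R := ln (p (u 0%N)).

End Symbolic.

Section Conformal.
Variables (R : realType) (d N : nat) (S : 'I_N -> 'rV[R]_d -> 'rV[R]_d).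

Definition Scomp (w : seq 'I_N) (x : 'rV[R]_d) : 'rV[R]_d := foldr S x w.

Definition projection (K : set 'rV[R]_d) (proj : (nat -> 'I_N) -> 'rV[R]_d) : Prop :=
  forall u, [set proj u] = \bigcap_n (Scomp (mkseq u n) @` K).

Definition scaling (proj : (nat -> 'I_N) -> 'rV[R]_d) (u : nat -> 'I_N) : R :=
  ln (opnorm ('d (S (u 0%N)) (proj (shift u)))).

(* log p_w / log diam K_w *)
Definition word_ratio (p : 'I_N -> R) (K : set 'rV[R]_d) (w : seq 'I_N) : R :=
  ln (\prod_(i <- w) p i) / ln (diam (Scomp w @` K)).

(* Coefficients of the power series in z; the coefficient of z^0 is 0 since
   0^-1 = 0. *)
Definition zeta_dyncon (p : 'I_N -> R) (K : set 'rV[R]_d) (C : set R)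
    (phi : (nat -> 'I_N) -> R) : R^nat :=
  fun n => n%:R^-1 *
    \sum_(w : n.-tuple 'I_N | `[< C (word_ratio p K w) >]) sup_exp phi w.

End Conformal.

Section Real.
Variable R : realType.

Definition sigma_rad (a : R^nat) : \bar R :=
  ereal_sup [set `|z|%:E | z in [set z : R | cvgn (pseries a z)]].

Definition rball (C : set R) (r : R) : set R := [set x | (edist_inf C x < r%:E)%E].

Definition legendre (beta : R -> R) (x : R) : \bar R :=
  ereal_inf [set (x * y + beta y)%:E | y in [set: R]].

Definition neg_deriv_range (beta : R -> R) : set R :=
  [set - (derive1 beta q) | q in [set: R]].

(* [zeta C t] is a power series, read as zeta_C(t * Lambda; .).
   [crit_exponent zeta C x] says that x is the critical exponent of C: a real x
   such that the radius of convergence of zeta_{B(C,r)}(x * Lambda; .) tends to 1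
   as r tends to 0, or x = -oo in the degenerate case where no real exponent can
   exist because the radii tend to +oo for every t. *)
Definition crit_exponent (zeta : set R -> R -> R^nat) (C : set R) (x : \bar R) : Prop :=
  match x with
  | t%:E => sigma_rad (zeta (rball C r) t) @[r --> 0^'+] --> 1%E
  | -oo%E => forall t : R, sigma_rad (zeta (rball C r) t) @[r --> 0^'+] --> +oo%E
  | +oo%E => False
  end.

End Real.

(* Main.v *)
(** Write [Phi w = log p_w] and [L w = log diam K_w] for a word [w].  By bounded distortion,
    the vanishing of the pressure says that the sums of [exp (beta q * L w + q * Phi w)] over the
    words of length [n] lie between two positive constants that do not depend on [n].  Hence [beta]
    is convex, and a variance estimate along dyadic blocks shows that it is differentiable: a Gibbs
    measure does not charge two different slopes [Phi / L].  Markov's inequality with finitely many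
    [q] bounds the sum of [exp (t * L w)] over the words of slope near [C] when [t] exceeds the
    supremum of [beta*] on [C]; tilting by a [q] with [- beta' q] near [alpha] shows that the sum over
    the words of slope near [alpha] grows exponentially when [t < beta* alpha].  This determines the
    radii of convergence.

    Under the open set condition a ball meets boundedly many cylinders of its own size.  So a
    point of the level set lies close to infinitely many cylinders of slope near [C], and the
    sums above yield efficient covers.  For the lower bound, Schief's argument provides a word [tau]
    such that a point coded by [w tau] has distance at least [c diam K_w] from all other
    cylinders of the generation of [w], so that balls around it have about the mass [p_w].
    Concatenating long words of slope close to [alpha], each followed by [tau], gives a Moran set
    inside the level set.  It carries a mass whose cylinders have mass at most [diam^s]; given
    sets whose [s]-cost is too small, a greedy choice of letters finds a point of the Moran set
    that they miss. *)
Require Import Defs.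
From mathcomp Require Import all_boot all_order all_algebra.
From mathcomp Require Import all_classical all_reals all_analysis.
From mathcomp Require Import ring lra zify.
Import Order.TTheory GRing.Theory Num.Theory.
Import numFieldNormedType.Exports.

Set Implicit Arguments.
Unset Strict Implicit.
Unset Printing Implicit Defensive.

Local Open Scope classical_set_scope.
Local Open Scope ring_scope.

(** No transfer operator, no Gibbs measure and no measure on the Moran set is built: everything is
    read off finite sums over words, with constants that do not depend on the length. Joining two
    words costs a bounded factor, and an induction must not pay it at every step. This shapes two
    constructions: the variance estimate is stated for a block inside arbitrary contexts, and the
    weights of the Moran blocks are normalised so that the loss at each joint is paid in advance.
    Differentiability of [beta] is what lets the tilting method reach every slope: at a corner the
    tilted sums would not concentrate on the slopes strictly between the one-sided derivatives. No
    spectral theory enters; a corner is excluded by perturbing [q] by [A / n], at which scale the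
    Gibbs sums feel only the one-sided derivative. Balls and cylinders do not match: a cylinder of
    the size of a ball may meet it without coding its centre. For upper bounds this is repaired by
    working at radii where the mass of the ball drops moderately. *)

Section WordSums.
Variables (R : realType) (N : nat).
Implicit Types (f g : seq 'I_N -> R) (w u v : seq 'I_N) (n m : nat).

(** Recursion on the length makes the splitting over concatenations, [wsum_cat], a direct induction;
    [tuple_wsum] links this form to the sums over tuples in the definitions. *)
Fixpoint wsum n f : R :=
  if n is m.+1 then \sum_(i < N) wsum m (fun w => f (i :: w)) else f [::].

Lemma wsum_le n f g :
  (forall w, size w = n -> f w <= g w) -> wsum n f <= wsum n g.
Proof.
elim: n f g => [|n IH] f g h /=; first exact: h.
by apply: ler_sum => i _; apply: IH => w sw; apply: h; rewrite /= sw.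
Qed.

Lemma eq_wsum n f g :
  (forall w, size w = n -> f w = g w) -> wsum n f = wsum n g.
Proof. by move=> h; apply/eqP; rewrite eq_le !wsum_le// => w /h ->. Qed.

Lemma wsum0 n : wsum n (fun=> 0) = 0.
Proof. by elim: n => //= n ->; rewrite big1. Qed.

Lemma wsum_ge0 n f : (forall w, size w = n -> 0 <= f w) -> 0 <= wsum n f.
Proof. by move=> h; rewrite -(wsum0 n); apply: wsum_le. Qed.

Lemma wsumD n f g : wsum n (fun w => f w + g w) = wsum n f + wsum n g.
Proof.
by elim: n f g => //= n IH f g; rewrite -big_split; apply: eq_bigr => i _; rewrite IH.
Qed.

Lemma wsumZ n (a : R) f : wsum n (fun w => a * f w) = a * wsum n f.
Proof.
by elim: n f => //= n IH f; rewrite mulr_sumr; apply: eq_bigr => i _; rewrite IH.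
Qed.

Lemma wsumZr n (a : R) f : wsum n (fun w => f w * a) = wsum n f * a.
Proof. by rewrite mulrC -wsumZ; apply: eq_wsum => w _; rewrite mulrC. Qed.

Lemma wsumB n f g : wsum n (fun w => f w - g w) = wsum n f - wsum n g.
Proof. by rewrite wsumD -(mulN1r (wsum n g)) -wsumZ; congr +%R; apply: eq_wsum => w; rewrite mulN1r. Qed.

Lemma wsum_cat m n f :
  wsum (m + n) f = wsum m (fun u => wsum n (fun v => f (u ++ v))).
Proof. by elim: m f => //= m IH f; apply: eq_bigr => i _; rewrite IH. Qed.

Lemma wsum_sum m (I : finType) (f : seq 'I_N -> I -> R) :
  wsum m (fun u => \sum_i f u i) = \sum_i wsum m (fun u => f u i).
Proof.
elim: m f => //= m IH f; rewrite exchange_big /=.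
by apply: eq_bigr => i _; rewrite (IH (fun u j => f (i :: u) j)).
Qed.

Lemma wsum_exchange m n (f : seq 'I_N -> seq 'I_N -> R) :
  wsum m (fun u => wsum n (fun v => f u v)) = wsum n (fun v => wsum m (fun u => f u v)).
Proof.
elim: m f => //= m IH f.
rewrite (wsum_sum n (fun v i => wsum m (fun u => f (i :: u) v))).
by apply: eq_bigr => i _; rewrite (IH (fun u v => f (i :: u) v)).
Qed.

Lemma wsum_mul m n f g :
  wsum m (fun u => wsum n (fun v => f u * g v)) = wsum m f * wsum n g.
Proof. by rewrite -wsumZr; apply: eq_wsum => u _; rewrite wsumZ. Qed.

Lemma wsum_ge_term n f w : (forall w, 0 <= f w) -> size w = n -> f w <= wsum n f.
Proof.
move=> f0; elim: n f f0 w => [|n IH] f f0 [|i w]//= [] sw.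
rewrite (bigD1 i)//= -[leLHS]addr0 lerD//; first exact: (IH (fun w => f (i :: w))).
by apply: sumr_ge0 => j _; apply: wsum_ge0.
Qed.

Lemma wsum_gt0 n f : (0 < N)%N -> (forall w, 0 < f w) -> 0 < wsum n f.
Proof.
move=> N0 f0; have iN := Ordinal N0.
have /lt_le_trans := f0 (nseq n iN); apply.
by apply: wsum_ge_term; [move=> w; exact/ltW|rewrite size_nseq].
Qed.

Lemma wsum_lt_ex n f g : wsum n f < wsum n g -> exists2 w, size w = n & f w < g w.
Proof.
move=> h; apply: contrapT => nex; move: h; rewrite ltNge => /negP; apply.
by apply: wsum_le => w sw; rewrite leNgt; apply/negP => fg; apply: nex; exists w.
Qed.

Lemma tuple_wsum n f : \sum_(w : n.-tuple 'I_N) f w = wsum n f.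
Proof.
elim: n f => [|n IH] f /=.
  rewrite (big_pred1 [tuple]) //= => t; rewrite /= tuple0; exact/esym/eqP.
under [RHS]eq_bigr => i _ do rewrite -(IH (fun w => f (i :: w))).
rewrite pair_big /=.
rewrite (reindex (fun it : 'I_N * n.-tuple 'I_N => [tuple of it.1 :: it.2])) //=.
exists (fun t : n.+1.-tuple 'I_N => (thead t, [tuple of behead t])).
  by move=> [i t] _ /=; congr pair; apply/val_inj.
by move=> t _; rewrite [RHS]tuple_eta.
Qed.

Lemma tuple_wsum_cond n (P : pred (seq 'I_N)) f :
  \sum_(w : n.-tuple 'I_N | P w) f w = wsum n (fun w => if P w then f w else 0).
Proof. by rewrite big_mkcond -tuple_wsum. Qed.

Lemma uniq_sum_le_wsum n (s : seq (seq 'I_N)) f :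
  (forall w, 0 <= f w) -> uniq s -> all (fun w => size w == n) s ->
  \sum_(w <- s) f w <= wsum n f.
Proof.
move=> f0 us ss; rewrite -tuple_wsum.
have -> : s = [seq tval t | t <- pmap (insub : _ -> option (n.-tuple 'I_N)) s].
  elim: s ss {us} => //= w s IH /andP[sw ss].
  by case: insubP => [t _ tw|]; rewrite ?sw//= -?IH// -tw.
rewrite big_map big_uniq ?pmap_sub_uniq//=.
rewrite [leRHS](bigID (mem (pmap (insub : _ -> option (n.-tuple 'I_N)) s)))/=.
by rewrite lerDl; apply: sumr_ge0.
Qed.

End WordSums.

(** * Elementary growth estimates *)

Section Growth.
Variable R : realType.

Lemma nat_large (x : R) : exists n : nat, x < n%:R.
Proof.
exists (Num.truncn `|x|).+1; apply: le_lt_trans (ler_norm x) _.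
by rewrite truncnS_gt.
Qed.

(** The way exponents are compared throughout: sums over words of length [n] are comparable up to a
    constant, and letting [n] grow removes the constant. *)
Lemma slope_le0 (x C : R) (n0 : nat) :
  (forall n : nat, (n0 <= n)%N -> x * n%:R <= C) -> x <= 0.
Proof.
move=> h; rewrite leNgt; apply/negP => x0.
have [n hn] := nat_large (C / x).
have := h (n + n0)%N (leq_addl _ _); rewrite leNgt => /negP; apply.
rewrite mulrC -ltr_pdivrMr//; apply: lt_le_trans hn _.
by rewrite ler_nat leq_addr.
Qed.

Lemma expR_AMGM (th x y : R) : 0 <= th <= 1 ->
  expR (th * x + (1 - th) * y) <= th * expR x + (1 - th) * expR y.
Proof.
move=> /andP[t0 t1]; set z := th * x + (1 - th) * y.
have key u : expR z * (1 + (u - z)) <= expR u.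
  have -> : expR u = expR z * expR (u - z) by rewrite -expRD; congr expR; lra.
  by rewrite ler_pM2l ?expR_gt0// expR_ge1Dx.
have hx := key x; have hy := key y.
have -> : expR z = th * (expR z * (1 + (x - z))) + (1 - th) * (expR z * (1 + (y - z))).
  by rewrite /z; ring.
by apply: lerD; apply: ler_wpM2l => //; lra.
Qed.

Lemma ln_expR_bounds (x l u : R) : 0 < x ->
  l <= ln x <= u -> expR l <= x <= expR u.
Proof. by move=> x0; rewrite -{3 4}(lnK x0) !ler_expR. Qed.

End Growth.

(** * Absence of phase transitions *)

Section QuasiBernoulli.
Variables (R : realType) (N : nat).
Implicit Types (w u v x y : seq 'I_N).
Variables (m F : seq 'I_N -> R) (k B c : R).
Hypothesis m_gt0 : forall w, 0 < m w.
Hypothesis k_ge1 : 1 <= k.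
Hypothesis m_cat : forall u v,
  k^-1 * (m u * m v) <= m (u ++ v) <= k * (m u * m v).
Hypothesis m_sum : forall n, k^-1 <= wsum n m <= k.
Hypothesis F_cat : forall u v, `|F (u ++ v) - F u - F v| <= c.
Hypothesis F_bound : forall w, `|F w| <= B * (size w)%:R + c.
Hypothesis B_ge0 : 0 <= B.

Let k_gt0 : 0 < k. Proof. by apply: lt_le_trans k_ge1. Qed.
Let c_ge0 : 0 <= c. Proof. by apply: le_trans (F_cat [::] [::]). Qed.
Let kV_gt0 : 0 < k^-1. Proof. by rewrite invr_gt0. Qed.

(** The block [w] is weighed inside an arbitrary context. When two blocks are joined, each is part
    of the context of the other, so the bound passes to the double length without paying the factor
    [k] again. *)
Definition context_moment_le n (Q : R) := forall x y,
  wsum n (fun w => m (x ++ w ++ y) * (F w / n%:R) ^+ 2)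
  <= Q * wsum n (fun w => m (x ++ w ++ y)).

Variables (delta kappa : R) (n0 : nat).
Hypothesis delta_gt0 : 0 < delta.
Hypothesis kappa_gt0 : 0 < kappa.
Hypothesis mass_hi : forall n, (n0 <= n)%N ->
  kappa <= wsum n (fun w => if - delta * n%:R <= F w then m w else 0).
Hypothesis mass_lo : forall n, (n0 <= n)%N ->
  kappa <= wsum n (fun w => if F w <= - (3 * delta) * n%:R then m w else 0).

(** Quotient of the lower bound in [context_gap_ge], which carries [k ^- 3], by the upper bound in
    [context_mass_le], which carries [k ^+ 5]. *)
Let e := delta ^+ 2 * kappa ^+ 2 * k ^- 8.

Let e_gt0 : 0 < e.
Proof. by rewrite /e !mulr_gt0 ?invr_gt0 ?exprn_gt0. Qed.

Let context_mass_le n x y : wsum n (fun u => wsum n (fun v => m (x ++ u ++ v ++ y)))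
  <= k ^+ 5 * (m x * m y).
Proof.
have step u v : m (x ++ u ++ v ++ y) <= k ^+ 3 * (m x * m y) * (m u * m v).
  have /andP[_ h1] := m_cat x (u ++ v ++ y).
  have /andP[_ h2] := m_cat u (v ++ y).
  have /andP[_ h3] := m_cat v y.
  apply: le_trans h1 _.
  have -> : k ^+ 3 * (m x * m y) * (m u * m v) = k * (m x * (k * (m u * (k * (m v * m y))))) by ring.
  by rewrite ler_pM2l// ler_pM2l//; apply: le_trans h2 _; rewrite ler_pM2l// ler_pM2l.
apply: (@le_trans _ _ (wsum n (fun u => wsum n (fun v => k ^+ 3 * (m x * m y) * (m u * m v))))).
  by apply: wsum_le => u _; apply: wsum_le => v _.
under eq_wsum => u _ do rewrite wsumZ.
rewrite wsumZ wsum_mul.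
have -> : k ^+ 5 * (m x * m y) = k ^+ 3 * (m x * m y) * (k * k) by ring.
rewrite ler_pM2l ?mulr_gt0 ?exprn_gt0//.
have /andP[h1 h2] := m_sum n.
by apply: ler_pM => //; apply: wsum_ge0 => w _; exact/ltW.
Qed.

(** Neighbouring blocks are independent up to powers of [k]. With relative mass about [kappa ^+ 2]
    the first has mean above [- delta] and the second below [- 3 delta]; there a quarter of the
    squared difference is at least [delta ^+ 2]. *)
Let context_gap_ge n x y : (n0 <= n)%N -> (0 < n)%N ->
  k ^- 3 * (m x * m y) * (kappa ^+ 2 * delta ^+ 2) <=
  wsum n (fun u => wsum n (fun v => m (x ++ u ++ v ++ y) * ((F u / n%:R - F v / n%:R) ^+ 2 / 4))).
Proof.
move=> n0n n_gt0; have nR : 0 < n%:R :> R by rewrite ltr0n.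
have step u v : k ^- 3 * (m x * m y) * (m u * m v) <= m (x ++ u ++ v ++ y).
  have /andP[h1 _] := m_cat x (u ++ v ++ y).
  have /andP[h2 _] := m_cat u (v ++ y).
  have /andP[h3 _] := m_cat v y.
  apply: le_trans _ h1.
  have -> : k ^- 3 * (m x * m y) * (m u * m v) = k^-1 * (m x * (k^-1 * (m u * (k^-1 * (m v * m y))))).
    rewrite -exprVn; ring.
  by rewrite ler_pM2l// ler_pM2l//; apply: le_trans _ h2; rewrite ler_pM2l// ler_pM2l.
pose a u := if - delta * n%:R <= F u then m u else 0.
pose b v := if F v <= - (3 * delta) * n%:R then m v else 0.
have a0 u : 0 <= a u by rewrite /a; case: ifP => // _; exact/ltW.
have b0 u : 0 <= b u by rewrite /b; case: ifP => // _; exact/ltW.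
apply: (@le_trans _ _ (wsum n (fun u => wsum n (fun v => k ^- 3 * (m x * m y) * delta ^+ 2 * (a u * b v))))).
  under eq_wsum => u _ do rewrite wsumZ.
  rewrite wsumZ wsum_mul.
  have -> : k ^- 3 * (m x * m y) * (kappa ^+ 2 * delta ^+ 2) =
    k ^- 3 * (m x * m y) * delta ^+ 2 * (kappa * kappa) by ring.
  rewrite ler_wpM2l//; first by rewrite !mulr_ge0 ?invr_ge0 ?exprn_ge0 ?ltW.
  by apply: ler_pM; [exact: ltW|exact: ltW|exact: mass_hi|exact: mass_lo].
apply: wsum_le => u _; apply: wsum_le => v _.
have rhs0 : 0 <= m (x ++ u ++ v ++ y) * ((F u / n%:R - F v / n%:R) ^+ 2 / 4).
  by rewrite mulr_ge0 ?divr_ge0 ?sqr_ge0 ?ltW.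
rewrite /a /b; case: ifPn => ha; last by rewrite mul0r mulr0.
case: ifPn => hb; last by rewrite !mulr0.
rewrite mulrAC ler_pM ?sqr_ge0 ?step//.
  by rewrite !mulr_ge0 ?invr_ge0 ?exprn_ge0 ?ltW.
have h1 : - delta <= F u / n%:R by rewrite ler_pdivlMr.
have h2 : F v / n%:R <= - (3 * delta) by rewrite ler_pdivrMr.
rewrite ler_pdivlMr//; set p := F u / _ in h1 *; set q := F v / _ in h2 *.
have h3 : 2 * delta <= p - q by lra.
have -> : delta ^+ 2 * 4 = (2 * delta) ^+ 2 by ring.
by rewrite lerXn2r// ?nnegrE ?mulr_ge0//; [exact: ltW|apply: le_trans h3; rewrite mulr_ge0// ltW].
Qed.

(* Parallelogram identity: the second moment of the mean of two adjacent blocks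
   drops by a quarter of the second moment of their difference. *)
Let context_moment_step n Q : (n0 <= n)%N -> (0 < n)%N -> 2 * (c * (B + c)) <= e * n%:R ->
  context_moment_le n Q -> context_moment_le (n + n) (Q - e / 2).
Proof.
move=> n0n n_gt0 nbig hQ x y; have nR : 1 <= n%:R :> R by rewrite ler1n.
have nR0 : 0 < n%:R :> R by rewrite ltr0n.
pose G u v := m (x ++ u ++ v ++ y).
pose f u := F u / n%:R.
have G0 u v : 0 < G u v by exact: m_gt0.
rewrite !wsum_cat.
under [X in _ <= _ * X]eq_wsum => u _ do under eq_wsum => v _ do rewrite -catA -/(G u v).
apply: (@le_trans _ _ (wsum n (fun u => wsum n (fun v =>
   (2^-1 * (G u v * f u ^+ 2) + 2^-1 * (G u v * f v ^+ 2)) +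
   (e / 2 * G u v - (G u v * ((f u - f v) ^+ 2 / 4))))))).
  apply: wsum_le => u su; apply: wsum_le => v sv; rewrite -catA -/(G u v).
  have -> : 2^-1 * (G u v * f u ^+ 2) + 2^-1 * (G u v * f v ^+ 2) +
    (e / 2 * G u v - (G u v * ((f u - f v) ^+ 2 / 4))) =
    G u v * (((f u + f v) / 2) ^+ 2 + e / 2) by field.
  rewrite ler_pM2l//.
  set a := F (u ++ v) / (n + n)%:R; set b := (f u + f v) / 2.
  have ab : `|a - b| <= c / (2 * n%:R).
    have -> : a - b = (F (u ++ v) - F u - F v) / (2 * n%:R).
      rewrite /a /b /f natrD; field; lra.
    rewrite normrM (ger0_norm (_ : 0 <= (2 * n%:R)^-1)) ?invr_ge0 ?mulr_ge0//.
    by rewrite ler_pM2r ?invr_gt0 ?mulr_gt0.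
  have fB w : size w = n -> `|f w| <= B + c.
    move=> sw; rewrite /f normrM normfV (ger0_norm (ltW nR0)) ler_pdivrMr//.
    apply: le_trans (F_bound w) _; rewrite sw mulrDl lerD2l.
    by rewrite ler_peMr.
  have bB : `|b| <= B + c.
    rewrite /b normrM (ger0_norm (_ : 0 <= 2^-1))// ler_pdivrMr//.
    apply: le_trans (ler_normD _ _) _; have := fB u su; have := fB v sv; lra.
  have aB : `|a| <= B + c.
    rewrite /a normrM normfV (ger0_norm (ler0n _ (n + n))) ler_pdivrMr ?ltr0n ?addn_gt0 ?n_gt0//.
    apply: le_trans (F_bound _) _; rewrite size_cat su sv mulrDl lerD2l.
    by rewrite ler_peMr// ler1n addn_gt0 n_gt0.
  have : `|a ^+ 2 - b ^+ 2| <= c / (2 * n%:R) * (2 * (B + c)).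
    rewrite subr_sqr normrM ler_pM//.
    by apply: le_trans (ler_normD _ _) _; lra.
  move/(le_trans (ler_norm _)).
  have -> : c / (2 * n%:R) * (2 * (B + c)) = (c * (B + c)) / n%:R by field; lra.
  (* Half of the gain [e] pays for [F] being additive only up to [c]; this is where [n] must be
     large. *)
  suff : c * (B + c) / n%:R <= e / 2 by lra.
  by rewrite ler_pdivrMr//; lra.
under eq_wsum => u _ do rewrite wsumD wsumD wsumB !wsumZ.
rewrite wsumD wsumD wsumB !wsumZ.
set T := wsum n (fun u => wsum n (G u)).
have T1 : wsum n (fun u => wsum n (fun v => G u v * f u ^+ 2)) <= Q * T.
  rewrite /T (wsum_exchange n n (fun u v => G u v * f u ^+ 2)) (wsum_exchange n n G).
  by rewrite -wsumZ; apply: wsum_le => v _; exact: (hQ x (v ++ y)).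
have T2 : wsum n (fun u => wsum n (fun v => G u v * f v ^+ 2)) <= Q * T.
  rewrite /T -wsumZ; apply: wsum_le => u _.
  have := hQ (x ++ u) y.
  by under eq_wsum => w _ do rewrite -catA; under [X in _ <= _ * X]eq_wsum => w _ do rewrite -catA.
have T3 : T <= k ^+ 5 * (m x * m y) := context_mass_le n x y.
have T4 := context_gap_ge x y n0n n_gt0.
have T5 : e * T <= wsum n (fun u => wsum n (fun v => G u v * ((f u - f v) ^+ 2 / 4))).
  apply: le_trans _ T4; apply: (@le_trans _ _ (e * (k ^+ 5 * (m x * m y)))).
    by rewrite ler_pM2l.
  rewrite /e le_eqVlt; apply/orP; left; apply/eqP; field; rewrite ?expf_neq0// lt0r_neq0//; exact: k_gt0.
by lra.
Qed.

(** Each doubling of the length lowers the bound on the second moment by [e / 2], starting from the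
    trivial [(B + c) ^+ 2]; a bound for a nonnegative quantity cannot fall below 0. *)
Lemma no_two_phases : False.
Proof.
have [n1 hn1] := nat_large (2 * (c * (B + c)) / e).
pose n := maxn 1 (maxn n0 n1).
have n_gt0 : (0 < n)%N by rewrite /n leq_max.
have nn0 : (n0 <= n)%N by rewrite /n !leq_max leqnn orbT.
have nn1 : 2 * (c * (B + c)) <= e * n%:R.
  rewrite [leRHS]mulrC -ler_pdivrMr//; apply: le_trans (ltW hn1) _.
  by rewrite ler_nat /n !leq_max leqnn !orbT.
have base : context_moment_le n ((B + c) ^+ 2).
  move=> x y; rewrite -wsumZ; apply: wsum_le => w sw; rewrite mulrC ler_pM2r//.
  rewrite -ler_sqrt ?exprn_even_ge0// !sqrtr_sqr.
  have nR0 : 0 < n%:R :> R by rewrite ltr0n.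
  rewrite normrM normfV (ger0_norm (ltW nR0)) (ger0_norm (addr_ge0 B_ge0 c_ge0)) ler_pdivrMr//.
  apply: le_trans (F_bound w) _; rewrite sw mulrDl lerD2l.
  by rewrite ler_peMr// ler1n.
have iter_step j : context_moment_le (2 ^ j * n) ((B + c) ^+ 2 - j%:R * (e / 2)).
  elim: j => [|j IH]; first by rewrite mul1n mul0r subr0.
  rewrite expnS -mulnA mul2n -addnn.
  have le_n : (n <= 2 ^ j * n)%N by rewrite leq_pmull// expn_gt0.
  have -> : (B + c) ^+ 2 - j.+1%:R * (e / 2) = (B + c) ^+ 2 - j%:R * (e / 2) - e / 2.
    by rewrite -natr1; ring.
  apply: context_moment_step IH.
  - exact: leq_trans le_n.
  - exact: leq_trans le_n.
  - by apply: le_trans nn1 _; rewrite ler_pM2l// ler_nat.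
suff he : e / 2 <= 0 by have := e_gt0; lra.
apply: (@slope_le0 _ _ ((B + c) ^+ 2) 0) => j _.
rewrite mulrC -subr_ge0.
have := iter_step j [::] [::]; set S := wsum _ (fun w => m ([::] ++ w ++ [::])).
have S0 : 0 < S.
  apply: lt_le_trans (_ : k^-1 <= _); first exact: kV_gt0.
  have /andP[h _] := m_sum (2 ^ j * n)%N.
  by rewrite /S; under eq_wsum => w _ do rewrite cats0.
move=> h; have : 0 <= ((B + c) ^+ 2 - j%:R * (e / 2)) * S.
  by apply: le_trans h; apply: wsum_ge0 => w _; rewrite mulr_ge0 ?sqr_ge0// ltW.
by rewrite pmulr_lge0.
Qed.

End QuasiBernoulli.

(** * The function [beta] *)

Section GibbsSystem.
Variables (R : realType) (N : nat).
Implicit Types (w u v : seq 'I_N).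

(* Symbolic data of the theorem: [Phi w = log p_w], [L w] is [log diam K_w] up to a
   bounded error, and the last field says that the pressure at [(beta q, q)]
   vanishes, in the quantitative form given by bounded distortion. *)
Record gibbs_system (Phi L : seq 'I_N -> R) (a b c : R) (beta : R -> R) : Prop :=
  GibbsSystem {
  gs_a : 0 < a ;
  gs_b : 0 <= b ;
  gs_c : 0 <= c ;
  gs_Phi_cat : forall u v, Phi (u ++ v) = Phi u + Phi v ;
  gs_Phi_bound : forall w, `|Phi w| <= b * (size w)%:R ;
  gs_L_cat : forall u v, `|L (u ++ v) - L u - L v| <= c ;
  gs_L_ub : forall w, L w <= - a * (size w)%:R + c ;
  gs_L_lb : forall w, - b * (size w)%:R - c <= L w ;
  gs_sum : forall q n,
    expR (- (c * (1 + `|q| + `|beta q|))) <=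
    wsum n (fun w => expR (beta q * L w + q * Phi w)) <=
    expR (c * (1 + `|q| + `|beta q|)) }.

(** The reflection in [q] turns left derivatives into right ones, so that only right derivatives
    need to be studied. *)
Lemma gibbs_systemN Phi L a b c beta : gibbs_system Phi L a b c beta ->
  gibbs_system (fun w => - Phi w) L a b c (fun q => beta (- q)).
Proof.
case=> a0 b0 c0 h1 h2 h3 h4 h5 h6; split=> //.
- by move=> u v; rewrite h1 opprD.
- by move=> w; rewrite normrN.
- move=> q n; rewrite -(normrN q).
  by under eq_wsum => w _ do rewrite mulrN -mulNr; exact: h6.
Qed.

Definition right_derivative (f : R -> R) (q d : R) := forall e : R, 0 < e ->
  exists2 r : R, 0 < r &
    forall s : R, 0 < s < r -> `|f (q + s) - f q - d * s| <= e * s.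

Section Fixed.
Variables (Phi L : seq 'I_N -> R) (a b c : R) (beta : R -> R).
Hypothesis gs : gibbs_system Phi L a b c beta.

Let a0 := gs_a gs.
Let b0 := gs_b gs.
Let c0 := gs_c gs.

Definition gibbs q w := expR (beta q * L w + q * Phi w).

Lemma gibbs_gt0 q w : 0 < gibbs q w. Proof. exact: expR_gt0. Qed.

Lemma gs_L_abs w : `|L w| <= b * (size w)%:R + c.
Proof.
rewrite ler_norml; apply/andP; split; first by have := gs_L_lb gs w; lra.
apply: le_trans (gs_L_ub gs w) _.
have : 0 <= a * (size w)%:R by rewrite mulr_ge0// ltW.
have : 0 <= b * (size w)%:R by rewrite mulr_ge0.
lra.
Qed.

Lemma gibbs_sum_le q n : wsum n (gibbs q) <= expR (c * (1 + `|q| + `|beta q|)).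
Proof. by have /andP[] := gs_sum gs q n. Qed.

Lemma gibbs_sum_ge q n : expR (- (c * (1 + `|q| + `|beta q|))) <= wsum n (gibbs q).
Proof. by have /andP[] := gs_sum gs q n. Qed.

(** Passing from [q] to [q'] multiplies every weight of length [n] by at most a constant times [expR
    (n * (b * |q' - q| - a * (beta q' - beta q)))]. Both Gibbs sums are bounded away from 0 and
    infinity, so this exponent is not negative. *)
Let beta_lip_half (q q' : R) : a * (beta q' - beta q) <= b * `|q' - q|.
Proof.
set D := beta q' - beta q; set s := q' - q.
have [D0|D0] := leP D 0.
  by apply: (@le_trans _ _ 0); [rewrite mulr_ge0_le0// ltW|rewrite mulr_ge0].
rewrite -subr_le0.
apply: (@slope_le0 _ _ (D * c + c * (1 + `|q| + `|beta q|) + c * (1 + `|q'| + `|beta q'|)) 0) => n _.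
have h1 := gibbs_sum_ge q' n.
have : wsum n (gibbs q') <= expR (D * (- a * n%:R + c) + `|s| * (b * n%:R)) * wsum n (gibbs q).
  rewrite -wsumZ; apply: wsum_le => w sw; rewrite /gibbs -expRD ler_expR.
  have e1 : D * L w <= D * (- a * n%:R + c) by rewrite ler_pM2l// -sw; exact: gs_L_ub gs w.
  have e2 : s * Phi w <= `|s| * (b * n%:R).
    apply: le_trans (ler_norm _) _; rewrite normrM ler_wpM2l// -sw; exact: gs_Phi_bound gs w.
  rewrite /D /s in e1 e2 *; lra.
move/(le_trans h1) => h2.
have := le_trans h2 (ler_wpM2l (expR_ge0 _) (gibbs_sum_le q n)).
rewrite -expRD ler_expR; lra.
Qed.

Lemma beta_lipschitz (q q' : R) : `|beta q' - beta q| <= b / a * `|q' - q|.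
Proof.
have h1 := beta_lip_half q q'; have h2 := beta_lip_half q' q.
rewrite distrC in h2.
rewrite mulrAC ler_pdivlMr//.
have [h|h] := ger0P (beta q' - beta q); lra.
Qed.

(** Hoelder's inequality in its arithmetic-geometric form, which loses only a constant as the sums
    are bounded. A positive convexity defect [D] would make the Gibbs sums at the intermediate point
    decay exponentially. *)
Lemma beta_convex (th x y : R) : 0 <= th <= 1 ->
  beta (th * x + (1 - th) * y) <= th * beta x + (1 - th) * beta y.
Proof.
move=> th01; set q := th * x + _.
set D := beta q - (th * beta x + (1 - th) * beta y).
rewrite -subr_le0 -/D leNgt; apply/negP => D0.
set C := th * expR (c * (1 + `|x| + `|beta x|)) + (1 - th) * expR (c * (1 + `|y| + `|beta y|)).
have C0 : 0 < C.
  have e1 := expR_gt0 (c * (1 + `|x| + `|beta x|)).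
  have e2 := expR_gt0 (c * (1 + `|y| + `|beta y|)).
  rewrite /C; case/andP: th01 => t0 t1; have [->|tn0] := eqVneq th 0; first lra.
  apply: ltr_wpDr; first by apply: mulr_ge0; [lra|exact: ltW].
  by rewrite mulr_gt0// lt_neqAle eq_sym tn0.
suff : a * D <= 0 by rewrite pmulr_rle0// leNgt D0.
apply: (@slope_le0 _ _ (D * c + ln C + c * (1 + `|q| + `|beta q|)) 0) => n _.
have : wsum n (gibbs q) <= expR (D * (- a * n%:R + c)) * C.
  apply: (@le_trans _ _ (expR (D * (- a * n%:R + c)) * (th * wsum n (gibbs x) + (1 - th) * wsum n (gibbs y)))).
    rewrite -!wsumZ -wsumD -wsumZ; apply: wsum_le => w sw.
    apply: (@le_trans _ _ (expR (D * (- a * n%:R + c)) *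
       expR (th * (beta x * L w + x * Phi w) + (1 - th) * (beta y * L w + y * Phi w)))).
      rewrite -expRD ler_expR.
      have e1 : D * L w <= D * (- a * n%:R + c) by rewrite ler_pM2l// -sw; exact: gs_L_ub gs w.
      rewrite /D /q in e1 *; lra.
    by rewrite ler_pM2l ?expR_gt0//; exact: expR_AMGM.
  rewrite ler_pM2l ?expR_gt0// /C; case/andP: th01 => t0 t1.
  by apply: lerD; apply: ler_wpM2l; rewrite ?subr_ge0//; exact: gibbs_sum_le.
move/(le_trans (gibbs_sum_ge q n)).
rewrite -{1}(lnK (C0 : C \is Num.pos)) -expRD ler_expR; lra.
Qed.

(* With [q + s], [s = A / n], in place of [q] the Gibbs sums stay bounded by a
   constant independent of [A]. *)
Let tilted_sum (q d : R) :
  right_derivative beta q d ->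
  exists2 K : R, 1 <= K & forall A : R, 0 < A -> exists n0, forall n, (n0 <= n)%N ->
    K^-1 <= wsum n (fun w => gibbs q w * expR (A / n%:R * (Phi w + d * L w))) <= K.
Proof.
move=> hd.
pose c' := c * (1 + (`|q| + 1) + (`|beta q| + b / a)) + 1.
have ba0 : 0 <= b / a by rewrite divr_ge0// ltW.
have c'1 : 1 <= c' by rewrite /c' lerDr mulr_ge0// !addr_ge0.
exists (expR c'); first by rewrite -expR0 ler_expR; lra.
move=> A A0.
(* With this precision the error of the linear approximation at [s = A / n], multiplied by
   [|L w| <= (b + c + 1) n], is at most 1. *)
have e0 : 0 < (A * (b + c + 1))^-1 by rewrite invr_gt0 mulr_gt0// ltr_wpDl// addr_ge0.
have [r r0 hr] := hd _ e0.
have [n1 hn1] := nat_large (A / r); have [n2 hn2] := nat_large A.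
exists (maxn 1 (maxn n1 n2)) => n; rewrite !geq_max => /and3P[n0 n1n n2n].
have nR0 : 0 < n%:R :> R by rewrite ltr0n.
have nR1 : 1 <= n%:R :> R by rewrite ler1n.
set s := A / n%:R.
have s0 : 0 < s by rewrite divr_gt0.
have sr : s < r.
  rewrite ltr_pdivrMr// mulrC -ltr_pdivrMr//; apply: lt_le_trans hn1 _.
  by rewrite ler_nat.
have s1 : s <= 1.
  by rewrite ler_pdivrMr// mul1r; apply: le_trans (ltW hn2) _; rewrite ler_nat.
have hs : `|beta (q + s) - beta q - d * s| <= (A * (b + c + 1))^-1 * s.
  by apply: hr; rewrite s0.
have key w : size w = n ->
  `|(beta (q + s) - beta q - d * s) * L w| <= 1.
  move=> sw; rewrite normrM.
  apply: (@le_trans _ _ ((A * (b + c + 1))^-1 * s * ((b + c + 1) * n%:R))).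
    apply: ler_pM => //; apply: le_trans (gs_L_abs w) _; rewrite sw.
    have : c <= c * n%:R by rewrite ler_peMr.
    lra.
  rewrite /s le_eqVlt; apply/orP; left; apply/eqP; field.
  by rewrite !lt0r_neq0//= ltr_wpDl// addr_ge0.
have c'_ge : c * (1 + `|q + s| + `|beta (q + s)|) + 1 <= c'.
  rewrite /c' lerD2r ler_wpM2l//; apply: lerD; first apply: lerD => //.
    by apply: le_trans (ler_normD _ _) _; rewrite lerD2l gtr0_norm.
  have := beta_lipschitz q (q + s).
  rewrite (_ : q + s - q = s); last by ring.
  rewrite (gtr0_norm s0) => h.
  have : b / a * s <= b / a by rewrite ler_piMr.
  have := ler_normB (beta (q + s)) (beta (q + s) - beta q).
  rewrite (_ : beta (q + s) - (beta (q + s) - beta q) = beta q); last by ring.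
  have := ler_normD (beta (q + s) - beta q) (beta q).
  rewrite subrK; lra.
have h1 := gibbs_sum_ge (q + s) n; have h2 := gibbs_sum_le (q + s) n.
apply/andP; split.
  rewrite -expRN; apply: (@le_trans _ _ (expR (-1) * wsum n (gibbs (q + s)))).
    apply: le_trans _ (ler_wpM2l (expR_ge0 _) h1); rewrite -expRD ler_expR; lra.
  rewrite -wsumZ; apply: wsum_le => w sw; rewrite /gibbs -!expRD ler_expR.
  have := key w sw; rewrite ler_norml => /andP[_]; rewrite -/s; lra.
apply: (@le_trans _ _ (expR 1 * wsum n (gibbs (q + s)))).
  rewrite -wsumZ; apply: wsum_le => w sw; rewrite /gibbs -!expRD ler_expR.
  have := key w sw; rewrite ler_norml => /andP[+ _]; rewrite -/s; lra.
apply: le_trans (ler_wpM2l (expR_ge0 _) h2) _; rewrite -expRD ler_expR; lra.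
Qed.

(** A Paley-Zygmund argument. The tilted mass lies between [K^-1] and [K] for the parameters [A] and
    [2 A]. Words below [- delta n] contribute little to it once [A] is large, large values of the
    tilt are controlled by its square, and so a definite Gibbs mass remains above [- delta n]. As
    [K] does not depend on [A], [kappa] does not depend on [delta]. *)
Lemma right_derivative_mass (q d : R) :
  right_derivative beta q d ->
  exists2 kappa : R, 0 < kappa & forall delta : R, 0 < delta ->
    exists n0, forall n, (n0 <= n)%N ->
    kappa <= wsum n (fun w => if - delta * n%:R <= Phi w + d * L w then gibbs q w else 0).
Proof.
move=> hd; have [K K1 hK] := tilted_sum hd.
have K0 : 0 < K by lra.
pose T := 4 * K ^+ 2.
have T0 : 0 < T by rewrite mulr_gt0// exprn_gt0.
have T1 : 1 < T by have := exprn_ege1 2 K1; rewrite /T; lra.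
pose C := expR (c * (1 + `|q| + `|beta q|)).
have C0 : 0 < C := expR_gt0 _.
exists (K^-1 / (4 * T)); first by rewrite divr_gt0 ?invr_gt0 ?mulr_gt0.
move=> delta delta0.
have KC0 : 0 < 4 * K * C by rewrite !mulr_gt0.
pose A := (`|ln (4 * K * C)| + 1) / delta.
have A0 : 0 < A by rewrite divr_gt0// ltr_wpDl.
have [n1 hn1] := hK A A0.
have A20 : 0 < 2 * A by rewrite mulr_gt0.
have [n2 hn2] := hK (2 * A) A20.
exists (maxn 1 (maxn n1 n2)) => n; rewrite !geq_max => /and3P[n0 n1n n2n].
have nR0 : 0 < n%:R :> R by rewrite ltr0n.
have /andP[lo _] := hn1 n n1n; have /andP[_ hi] := hn2 n n2n.
set S := wsum n _.
have : wsum n (fun w => gibbs q w * expR (A / n%:R * (Phi w + d * L w))) <=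
  expR (- (A * delta)) * wsum n (gibbs q) + (T * S +
  T^-1 * wsum n (fun w => gibbs q w * expR (2 * A / n%:R * (Phi w + d * L w)))).
  rewrite -!wsumZ -!wsumD; apply: wsum_le => w sw.
  have g0 := gibbs_gt0 q w.
  set y := A / n%:R * _.
  have -> : 2 * A / n%:R * (Phi w + d * L w) = y + y by rewrite /y; ring.
  rewrite expRD; have y0 := expR_gt0 y.
  have t0 : 0 <= T^-1 * (gibbs q w * (expR y * expR y)).
    by rewrite !mulr_ge0 ?invr_ge0 ?expR_ge0 ?ltW.
  case: ifPn => hy.
    have : 0 <= expR (- (A * delta)) * gibbs q w by rewrite mulr_ge0 ?expR_ge0 ?ltW.
    suff : gibbs q w * expR y <= T * gibbs q w + T^-1 * (gibbs q w * (expR y * expR y)) by lra.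
    have -> : T * gibbs q w + T^-1 * (gibbs q w * (expR y * expR y)) =
       gibbs q w * (T + T^-1 * (expR y * expR y)) by ring.
    rewrite ler_pM2l//.
    have : 0 <= T^-1 * (T - expR y) ^+ 2 by rewrite mulr_ge0 ?sqr_ge0// invr_ge0 ltW.
    rewrite (_ : T^-1 * (T - expR y) ^+ 2 = T + T^-1 * (expR y * expR y) - 2 * expR y); last first.
      by field; rewrite lt0r_neq0.
    lra.
  suff : gibbs q w * expR y <= expR (- (A * delta)) * gibbs q w by lra.
  rewrite mulrC ler_pM2r// ler_expR /y mulrAC -mulrN -mulrA ler_pM2l//.
  by rewrite -ltNge in hy; rewrite ler_pdivrMr//; lra.
have e1 : expR (- (A * delta)) * wsum n (gibbs q) <= K^-1 / 4.
  apply: (@le_trans _ _ (expR (- (A * delta)) * C)).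
    by rewrite ler_pM2l ?expR_gt0//; exact: gibbs_sum_le.
  have -> : K^-1 / 4 = expR (- ln (4 * K * C)) * C.
    by rewrite expRN lnK//; field; rewrite !lt0r_neq0.
  rewrite ler_pM2r// ler_expR lerN2 /A mulrVK ?unitfE ?lt0r_neq0//.
  by have := ler_norm (ln (4 * K * C)); lra.
have e2 : T^-1 * wsum n (fun w => gibbs q w * expR (2 * A / n%:R * (Phi w + d * L w))) <= K^-1 / 4.
  have -> : K^-1 / 4 = T^-1 * K by rewrite /T; field; rewrite lt0r_neq0.
  by rewrite ler_pM2l ?invr_gt0.
move=> e3; rewrite ler_pdivrMr ?mulr_gt0//.
have K'0 : 0 < K^-1 by rewrite invr_gt0.
lra.
Qed.

End Fixed.

End GibbsSystem.

(** * One-sided derivatives of convex functions *)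

Section ConvexDerivative.
Variable R : realType.

(** Difference quotients of a convex function increase with the step, and the Lipschitz bound keeps
    them bounded below; the derivative is their infimum. *)
Lemma convex_right_derivative (f : R -> R) (M : R) :
  (forall x y, `|f y - f x| <= M * `|y - x|) ->
  (forall th x y : R, 0 <= th <= 1 ->
     f (th * x + (1 - th) * y) <= th * f x + (1 - th) * f y) ->
  forall q, exists d, right_derivative f q d.
Proof.
move=> flip fconv q.
pose h (s : R) := (f (q + s) - f q) / s.
have hmon (s t : R) : 0 < s -> s <= t -> h s <= h t.
  move=> s0 st; have t0 : 0 < t by apply: lt_le_trans st.
  have := fconv (s / t) (q + t) q.
  have -> : s / t * (q + t) + (1 - s / t) * q = q + s by field; rewrite lt0r_neq0.
  have -> : 0 <= s / t <= 1 by apply/andP; split; [apply: divr_ge0; exact: ltW|rewrite ler_pdivrMr// mul1r].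
  move=> /(_ isT) hc.
  rewrite /h ler_pdivrMr// mulrAC -mulrA; lra.
have hlb (s : R) : 0 < s -> - M <= h s.
  move=> s0; rewrite /h ler_pdivlMr//.
  have := flip q (q + s); rewrite (_ : q + s - q = s); last by ring.
  rewrite (gtr0_norm s0) ler_norml => /andP[]; lra.
pose A := [set h s | s in [set s : R | 0 < s]].
have A0 : has_inf A.
  split; first by exists (h 1); exists 1 => /=.
  by exists (- M) => _ [s /= s0 <-]; exact: hlb.
exists (inf A) => e e0.
have [_ [s1 /= s10 <-] h1] := inf_adherent e0 A0.
exists s1 => // s /andP[s0 ss1].
have h2 : inf A <= h s by apply: ge_inf; [exact: A0.2|exists s].
have h3 : h s <= h s1 by apply: hmon => //; exact: ltW.
have -> : f (q + s) - f q - inf A * s = (h s - inf A) * s.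
  by rewrite /h; field; rewrite lt0r_neq0.
rewrite normrM (gtr0_norm s0) ler_pM2r// ger0_norm ?subr_ge0//; lra.
Qed.

End ConvexDerivative.

(** * Differentiability of the pressure function and slopes of words *)

Section Thermodynamics.
Variables (R : realType) (N : nat).
Implicit Types (w u v : seq 'I_N).
Variables (Phi L : seq 'I_N -> R) (a b c : R) (beta : R -> R).
Hypothesis gs : gibbs_system Phi L a b c beta.

Let a0 := gs_a gs.
Let b0 := gs_b gs.
Let c0 := gs_c gs.
Let g := gibbs Phi L beta.

Definition has_slope (f : R -> R) (q d : R) := forall e : R, 0 < e ->
  exists2 r : R, 0 < r &
    forall s : R, `|s| < r -> `|f (q + s) - f q - d * s| <= e * `|s|.

(** [d] and [d'] are the right and the left derivative; the inequality is convexity at the midpoint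
    of [q - s] and [q + s]. *)
Lemma beta_one_sided (q : R) : exists d d', [/\ right_derivative beta q d,
  right_derivative (fun x => beta (- x)) (- q) (- d') & d' <= d].
Proof.
have [d hd] := convex_right_derivative (beta_lipschitz gs) (beta_convex gs) q.
have [d' hd'] := convex_right_derivative (beta_lipschitz (gibbs_systemN gs))
  (beta_convex (gibbs_systemN gs)) (- q).
exists d, (- d'); rewrite opprK; split=> //.
rewrite leNgt; apply/negP => dd'.
have e0 : 0 < (- d' - d) / 4 by lra.
have [r r0 hr] := hd _ e0; have [r' r'0 hr'] := hd' _ e0.
pose s := Num.min r r' / 2.
have m0 : 0 < Num.min r r' by rewrite lt_min r0.
have mr : Num.min r r' <= r by rewrite ge_min lexx.
have mr' : Num.min r r' <= r' by rewrite ge_min lexx orbT.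
have s0 : 0 < s by rewrite /s; lra.
have /hr : 0 < s < r by rewrite /s; lra.
have /hr' : 0 < s < r' by rewrite /s; lra.
have := @beta_convex R N Phi L a b c beta gs 2^-1 (q + s) (q - s).
have -> : 2^-1 * (q + s) + (1 - 2^-1) * (q - s) = q by field.
have half01 : ((0 : R) <= 2^-1) && ((2^-1 : R) <= 1) by rewrite invr_ge0 ler0n invf_le1 ?ler1n ?ltr0n.
rewrite !opprK opprD opprK => /(_ half01) hc /(le_trans (ler_norm _)) h1 /(le_trans (ler_norm _)) h2.
have : 0 < (- d' - d) / 4 * s by rewrite mulr_gt0.
lra.
Qed.

Lemma gibbs_cat (q : R) u v :
  expR (- (c * `|beta q|)) * (g q u * g q v) <= g q (u ++ v)
  <= expR (c * `|beta q|) * (g q u * g q v).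
Proof.
rewrite /g /gibbs -!expRD !ler_expR (gs_Phi_cat gs).
have : `|beta q * (L (u ++ v) - L u - L v)| <= c * `|beta q|.
  by rewrite normrM mulrC ler_wpM2r//; exact: gs_L_cat gs u v.
rewrite ler_norml => /andP[]; lra.
Qed.

(* If the one-sided slopes [d' < d] differed, with positive probability the
   quantity [Phi + d L] would be both nearly maximal and much smaller, which the
   dyadic variance argument excludes. *)
Lemma beta_has_slope (q : R) : exists d, has_slope beta q d.
Proof.
have [d [d' [hd hd' dd']]] := beta_one_sided q.
have [dE|dne] := eqVneq d' d.
  exists d => e e0; have [r r0 hr] := hd _ e0; have [r' r'0 hr'] := hd' _ e0.
  exists (Num.min r r'); first by rewrite lt_min r0.
  move=> s; rewrite lt_min => /andP[sr sr'].
  case: (ltgtP s 0) => s0; last by rewrite s0 !addr0 mulr0 subr0 subrr !normr0 mulr0.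
    have /hr' : 0 < - s < r' by rewrite -(ltr0_norm s0) sr' ltr0_norm//; lra.
    by rewrite opprD !opprK dE (ltr0_norm s0) mulrNN.
  by have := hr s; rewrite (gtr0_norm s0) s0 -{1}(gtr0_norm s0) sr; exact.
exfalso.
have dd : 0 < d - d' by rewrite subr_gt0 lt_neqAle dne.
have [k1 k10 hk1] := right_derivative_mass gs hd.
have [k2 k20 hk2] := right_derivative_mass (gibbs_systemN gs) hd'.
(* For long words [L w <= - (a / 2) n], so [(d - d') * L w] is at most [- 4 delta n]; it turns the
   bound [delta n] for [Phi + d' L] into [- 3 delta n] for [Phi + d L]. *)
pose delta := (d - d') * a / 8.
have delta0 : 0 < delta by rewrite /delta !mulr_gt0.
have [n1 hn1] := hk1 _ delta0; have [n2 hn2] := hk2 _ delta0.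
have [n3 hn3] := nat_large (2 * c / a).
pose K := expR (c * (1 + `|q| + `|beta q|)).
have K1 : 1 <= K by rewrite -expR0 ler_expR mulr_ge0// !addr_ge0.
have KV : expR (- (c * `|beta q|)) >= K^-1.
  rewrite -expRN ler_expR lerN2 ler_wpM2l// lerDr addr_ge0//.
have KK : expR (c * `|beta q|) <= K by rewrite ler_expR ler_wpM2l// lerDr addr_ge0.
pose F w := Phi w + d * L w.
have bd0 : 0 <= b * (1 + `|d|) by rewrite mulr_ge0// addr_ge0.
apply: (@no_two_phases R N (g q) F K (b * (1 + `|d|)) (`|d| * c) _ K1 _ _ _ _ bd0
  delta (Num.min k1 k2) (maxn n1 (maxn n2 n3)) delta0).
- by move=> w; exact: gibbs_gt0.
- move=> u v; have /andP[h1 h2] := gibbs_cat q u v.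
  have gg : 0 <= g q u * g q v by rewrite mulr_ge0 ?expR_ge0.
  by apply/andP; split; [apply: le_trans h1|apply: le_trans h2 _]; apply: ler_wpM2r.
- by move=> n; rewrite -expRN; exact: gs_sum gs q n.
- move=> u v; rewrite /F (gs_Phi_cat gs).
  have -> : Phi u + Phi v + d * L (u ++ v) - (Phi u + d * L u) - (Phi v + d * L v) =
    d * (L (u ++ v) - L u - L v) by ring.
  by rewrite normrM ler_wpM2l//; exact: gs_L_cat gs u v.
- move=> w; rewrite /F; apply: le_trans (ler_normD _ _) _; rewrite normrM.
  have h1 := gs_Phi_bound gs w.
  have := ler_wpM2l (normr_ge0 d) (gs_L_abs gs w); lra.
- by rewrite lt_min k10.
- move=> n; rewrite !geq_max => /and3P[h1 h2 h3].
  by apply: le_trans (hn1 n h1); rewrite ge_min lexx.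
- move=> n; rewrite !geq_max => /and3P[h1 h2 h3].
  apply: (@le_trans _ _ k2); first by rewrite ge_min lexx orbT.
  apply: le_trans (hn2 n h2) _; apply: wsum_le => w sw; case: ifPn => hw; last first.
    by case: ifP => // _; exact: expR_ge0.
  rewrite ifT; first by rewrite /g /gibbs opprK mulrNN.
  have n3n : 2 * c <= a * n%:R.
    rewrite [leRHS]mulrC -ler_pdivrMr//; apply: le_trans (ltW hn3) _.
    by rewrite ler_nat.
  have L1 : L w <= - (a / 2) * n%:R by have := gs_L_ub gs w; rewrite sw; lra.
  have L2 : (d - d') * L w <= (d - d') * (- (a / 2) * n%:R) by rewrite ler_pM2l.
  rewrite /F /delta in hw *; lra.
Qed.

Definition word_slope w := Phi w / L w.

Lemma L_neg_large : exists n0, forall w, (n0 <= size w)%N -> L w <= - (a / 2) * (size w)%:R.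
Proof.
have [n hn] := nat_large (2 * c / a); exists n => w nw.
suff : 2 * c <= a * (size w)%:R by have := gs_L_ub gs w; lra.
rewrite [leRHS]mulrC -ler_pdivrMr//; apply: le_trans (ltW hn) _.
by rewrite ler_nat.
Qed.

Lemma expR_eventually_le (C x e : R) : 0 < x -> 0 < e ->
  exists n0 : nat, forall n, (n0 <= n)%N -> expR (C - x * n%:R) <= e.
Proof.
move=> x0 e0; have [n0 h] := nat_large ((C - ln e) / x); exists n0 => n n0n.
rewrite -[leRHS](lnK (e0 : e \is Num.pos)) ler_expR.
rewrite ltr_pdivrMr// in h.
have : n0%:R * x <= n%:R * x by rewrite ler_pM2r// ler_nat.
lra.
Qed.

(** Chernoff's bound: on the event, the weight at [q + s] exceeds the weight at [q] by an
    exponential factor, the error of the linear approximation being at most half of the gain. *)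
Let tail_bound (q d eta e r s : R) n : 0 < eta -> e * (b + c) <= eta / 2 -> 0 < e ->
  (forall s : R, `|s| < r -> `|beta (q + s) - beta q - d * s| <= e * `|s|) ->
  `|s| < r -> (0 < n)%N ->
  wsum n (fun w => if `|s| * (eta * n%:R) < s * (Phi w + d * L w) then g q w else 0) <=
  expR (c * (1 + `|q + s| + `|beta (q + s)|) - `|s| * (eta / 2) * n%:R).
Proof.
move=> eta0 he e0 hr sr n0; have nR : 1 <= n%:R :> R by rewrite ler1n.
apply: (@le_trans _ _ (expR (- (`|s| * (eta / 2) * n%:R)) * wsum n (g (q + s)))); last first.
  rewrite [leRHS]expRD [leRHS]mulrC ler_pM2l ?expR_gt0//; exact: (gibbs_sum_le gs).
rewrite -wsumZ; apply: wsum_le => w sw; case: ifPn => hw; last first.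
  by rewrite mulr_ge0// expR_ge0.
rewrite /g /gibbs -expRD ler_expR.
have h1 : `|(beta (q + s) - beta q - d * s) * L w| <= `|s| * (eta / 2) * n%:R.
  rewrite normrM; apply: (@le_trans _ _ (e * `|s| * ((b + c) * n%:R))).
    apply: ler_pM => //; first exact: hr.
    apply: le_trans (gs_L_abs gs w) _; rewrite sw mulrDl lerD2l.
    by rewrite ler_peMr.
  have -> : e * `|s| * ((b + c) * n%:R) = `|s| * (e * (b + c)) * n%:R by ring.
  by rewrite ler_wpM2r ?ler0n// ler_wpM2l.
move: h1; rewrite ler_norml => /andP[h1 _]; lra.
Qed.

(** A weak law of large numbers: the two tails, obtained from a small positive and a small negative
    tilt, are negligible against the lower bound [k] of the Gibbs sum. *)
Lemma slope_concentration (q alpha eta : R) : has_slope beta q (- alpha) -> 0 < eta ->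
  exists2 kappa : R, 0 < kappa & exists n0, forall n, (n0 <= n)%N ->
    kappa <= wsum n (fun w => if `|Phi w - alpha * L w| <= eta * n%:R then g q w else 0).
Proof.
move=> hs eta0; have bc : 0 < b + c + 1 by rewrite ltr_wpDl// addr_ge0.
pose e := eta / 2 / (b + c + 1).
have e0 : 0 < e by rewrite /e !divr_gt0.
have he : e * (b + c) <= eta / 2.
  rewrite /e mulrAC ler_pdivrMr// ler_wpM2l//; lra.
have [r r0 hr] := hs e e0.
pose s := r / 2; have s0 : 0 < s by rewrite /s; lra.
have sr : `|s| < r by rewrite gtr0_norm// /s; lra.
have sr' : `|- s| < r by rewrite normrN.
pose k := expR (- (c * (1 + `|q| + `|beta q|))).
have k0 : 0 < k by exact: expR_gt0.
have se0 : 0 < `|s| * (eta / 2) by rewrite gtr0_norm// mulr_gt0//; lra.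
have k40 : 0 < k / 4 by lra.
have [n1 h1] := expR_eventually_le (c * (1 + `|q + s| + `|beta (q + s)|)) se0 k40.
have [n2 h2] := expR_eventually_le (c * (1 + `|q - s| + `|beta (q - s)|)) se0 k40.
exists (k / 2); first by lra.
exists (maxn 1 (maxn n1 n2)) => n; rewrite !geq_max => /and3P[n0 n1n n2n].
have t1 := le_trans (tail_bound eta0 he e0 hr sr n0) (h1 n n1n).
have := tail_bound eta0 he e0 hr sr' n0; rewrite normrN => t2.
have {}t2 := le_trans t2 (h2 n n2n).
have := gibbs_sum_ge gs q n; rewrite -/k.
set S := wsum n _ in t1; set S' := wsum n _ in t2; set G := wsum n (gibbs _ _ _ _).
have : G <= S + S' + wsum n (fun w => if `|Phi w - alpha * L w| <= eta * n%:R then g q w else 0).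
  rewrite -!wsumD; apply: wsum_le => w sw.
  have g0 : 0 <= g q w by rewrite expR_ge0.
  have i0 (B : bool) : 0 <= if B then g q w else 0 by case: B.
  rewrite -[gibbs _ _ _ _ _]/(g q w).
  have [c3|] := boolP (_ <= eta * n%:R).
    set B1 := _ < _; set B2 := _ < _; have := i0 B1; have := i0 B2; lra.
  rewrite -ltNge ltr_normr addr0 (gtr0_norm s0) => /orP[c3|c3].
    rewrite [X in X + _]ifT; last by rewrite ltr_pM2l// mulNr.
    by rewrite lerDl.
  rewrite [X in _ + X]ifT; last by rewrite mulNr -mulrN ltr_pM2l// mulNr.
  by rewrite lerDr.
lra.
Qed.

(** Where [Phi] is close to [alpha L], the weight [expR (t * L w)] is the Gibbs weight at [q] times
    about [expR (- (beta q + q * alpha - t) * L w)], which is exponentially large; such words carry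
    a fixed Gibbs mass. *)
Lemma core_lower_at (q alpha t r : R) : has_slope beta q (- alpha) ->
  t < beta q + q * alpha -> 0 < r ->
  exists rho : R, [/\ 0 < rho & exists n0, forall n, (n0 <= n)%N ->
    expR (rho * n%:R) <=
    wsum n (fun w => if `|word_slope w - alpha| < r then expR (t * L w) else 0)].
Proof.
move=> hs tlt r0; pose delta := beta q + q * alpha - t.
have delta0 : 0 < delta by rewrite subr_gt0.
have q10 : 0 < 1 + `|q| by rewrite ltr_pwDl.
(* The first bound puts the slope within [r] of [alpha]; the second keeps the cost [|q| eta n] below
   half of the gain. *)
pose eta := Num.min (r * a / 4) (delta * a / 8 / (1 + `|q|)).
have eta0 : 0 < eta by rewrite lt_min !divr_gt0 ?mulr_gt0.
have [k k0 [n1 h1]] := slope_concentration hs eta0.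
have [n2 h2] := L_neg_large.
have rho0 : 0 < delta * a / 16 by rewrite divr_gt0// mulr_gt0.
have rho20 : 0 < delta * a / 8 by rewrite divr_gt0// mulr_gt0.
have [n3 h3] := expR_eventually_le 0 rho20 k0.
exists (delta * a / 16); split=> //.
exists (maxn 1 (maxn n1 (maxn n2 n3))) => n; rewrite !geq_max => /and4P[n0 n1n n2n n3n].
have nR : 0 < n%:R :> R by rewrite ltr0n.
apply: (@le_trans _ _ (expR (delta * a / 4 * n%:R) * k)).
  apply: le_trans _ (ler_wpM2l (expR_ge0 _) (h3 n n3n)); rewrite -expRD ler_expR.
  have : 0 <= delta * a / 16 * n%:R by rewrite mulr_ge0 ?ltW.
  lra.
apply: le_trans (ler_wpM2l (expR_ge0 _) (h1 n n1n)) _.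
rewrite -wsumZ; apply: wsum_le => w sw; case: ifPn => hw; last first.
  by rewrite mulr0; case: ifP => // _; exact: expR_ge0.
have Lw : L w <= - (a / 2) * n%:R by rewrite -sw; apply: h2; rewrite sw.
have an0 : 0 < a / 2 * n%:R by rewrite mulr_gt0// divr_gt0.
have Lw0 : L w < 0 by lra.
have etar : eta <= r * a / 4 by rewrite ge_min lexx.
have etaq : eta * (1 + `|q|) <= delta * a / 8.
  by rewrite -ler_pdivlMr// ge_min lexx orbT.
rewrite ifT; last first.
  rewrite /word_slope.
  have -> : Phi w / L w - alpha = (Phi w - alpha * L w) / L w by field; rewrite lt_eqF.
  rewrite normrM normfV ltr_pdivrMr ?normr_gt0 ?lt_eqF// (ltr0_norm Lw0).
  apply: le_lt_trans hw _.
  have : r * (a / 2 * n%:R) <= r * - L w by rewrite ler_pM2l//; lra.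
  have : eta * n%:R <= r * a / 4 * n%:R by rewrite ler_pM2r.
  have : 0 < r * a * n%:R by rewrite !mulr_gt0.
  lra.
rewrite /g /gibbs -expRD ler_expR.
have e1 : q * (Phi w - alpha * L w) <= `|q| * (eta * n%:R).
  by apply: le_trans (ler_norm _) _; rewrite normrM ler_wpM2l.
have e2 : `|q| * (eta * n%:R) <= delta * a / 8 * n%:R.
  rewrite mulrA ler_pM2r//; apply: le_trans etaq; rewrite mulrC ler_pM2l//; lra.
have e3 : delta * (a / 2 * n%:R) <= delta * - L w by rewrite ler_pM2l//; lra.
have e4 : 0 <= delta * a * n%:R by rewrite !mulr_ge0// ltW.
have -> : t = beta q + q * alpha - delta by rewrite /delta; ring.
lra.
Qed.

(** Concentration yields words of every large length with [Phi] close to [alpha L]. The single term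
    of such a word in the bounded Gibbs sum at [y] is about [expR ((alpha * y + beta y) * L w)], and
    [L w] tends to minus infinity. *)
Lemma slope_star_ge0 (q alpha : R) : has_slope beta q (- alpha) ->
  forall y, 0 <= alpha * y + beta y.
Proof.
move=> hs y; rewrite leNgt; apply/negP => x0; set x := _ + _ in x0.
have y10 : 0 < 1 + `|y| by rewrite ltr_pwDl.
pose eta := - x * a / 4 / (1 + `|y|).
have eta0 : 0 < eta by rewrite divr_gt0// divr_gt0// mulr_gt0// oppr_gt0.
have [k k0 [n1 h1]] := slope_concentration hs eta0.
have [n2 h2] := L_neg_large.
suff : - x * a / 4 <= 0 by rewrite pmulr_lle0// pmulr_lle0//; lra.
apply: (@slope_le0 _ _ (c * (1 + `|y| + `|beta y|)) (maxn n1 n2)) => n.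
rewrite geq_max => /andP[n1n n2n].
have [w sw] : exists2 w, size w = n & (0 : R) < if `|Phi w - alpha * L w| <= eta * n%:R then g q w else 0.
  by apply: (@wsum_lt_ex _ _ _ (fun=> 0)); rewrite wsum0; apply: lt_le_trans (h1 n n1n).
case: ifPn => [hw _|]; last by rewrite ltxx.
have := gibbs_sum_le gs y n.
have := @wsum_ge_term R N n (gibbs Phi L beta y) w (fun w => expR_ge0 _) sw.
move=> /le_trans h /h; rewrite /gibbs ler_expR.
have e1 : `|y| * eta <= - x * a / 4.
  rewrite /eta mulrC mulrAC ler_pdivrMr//; apply: ler_wpM2l; last lra.
  by rewrite divr_ge0// mulr_ge0 ?ltW// oppr_gt0.
have e2 : - (`|y| * (eta * n%:R)) <= y * (Phi w - alpha * L w).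
  rewrite lerNl; apply: le_trans (ler_norm _) _; rewrite normrN normrM ler_wpM2l//.
have e3 : `|y| * eta * n%:R <= - x * a / 4 * n%:R by rewrite ler_wpM2r// ler0n.
have Lw : L w <= - (a / 2) * n%:R by rewrite -sw; apply: h2; rewrite sw.
have e4 : - x * L w <= - x * (- (a / 2) * n%:R) by rewrite ler_pM2l ?oppr_gt0.
rewrite /x in e1 e2 e3 e4 *; lra.
Qed.

Lemma beta_continuous : continuous beta.
Proof.
move=> x; apply/cvgrPdist_le => e e0.
have ba0 : 0 <= b / a by rewrite divr_ge0// ltW.
have k0 : 0 < e / (b / a + 1) by rewrite divr_gt0// ltr_wpDl.
near=> y.
have h : `|x - y| <= e / (b / a + 1).
  by near: y; apply: (@cvgr_dist_le _ _ _ _ _ id x).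
apply: le_trans (beta_lipschitz gs y x) _.
apply: (@le_trans _ _ ((b / a + 1) * `|x - y|)); first by rewrite ler_wpM2r//; lra.
by rewrite mulrC -ler_pdivlMr// ltr_wpDl.
Unshelve. all: end_near. Qed.

(* Minimising [q alpha + beta q + e q^2 / 2] gives a slope [alpha'] close to [alpha]
   with [beta* alpha' >= beta* alpha], also when [alpha] is an unattained end point. *)
Lemma slope_approx (alpha t r : R) : (forall y, t <= alpha * y + beta y) -> 0 < r ->
  exists q alpha', [/\ has_slope beta q (- alpha'), `|alpha' - alpha| < r &
    t <= beta q + q * alpha'].
Proof.
move=> ht r0.
(* Comparing the minimiser with [0] gives [e q ^+ 2 <= M0], hence [(e q) ^+ 2 <= e M0 = r ^+ 2 / 2].
   Outside [[- M, M]] the quadratic term, added to the lower bound [t], exceeds [h 0]. *)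
pose M0 := 2 * (beta 0 - t) + 1.
have M00 : 0 < M0 by have := ht 0; rewrite mulr0 add0r /M0; lra.
pose e := r ^+ 2 / M0 / 2.
have e0 : 0 < e by rewrite !divr_gt0// exprn_gt0.
pose h q := alpha * q + beta q + e / 2 * q ^+ 2.
pose M := M0 / e + 1.
have Me : M0 <= e * M ^+ 2.
  have M1 : 1 <= M by rewrite /M lerDr divr_ge0// ltW.
  apply: (@le_trans _ _ (e * M)).
    by rewrite mulrC -ler_pdivrMr// /M; lra.
  by rewrite ler_pM2l// expr2 ler_peMr//; lra.
have M0' : 0 < M by rewrite ltr_wpDl// divr_ge0// ltW.
have hc : continuous h.
  move=> x; apply: cvgD; first apply: cvgD.
  - by apply: cvgMr; exact: cvg_id.
  - exact: beta_continuous.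
  - by apply: cvgMr; exact: exprn_continuous.
have [] := @EVT_min R h (- M) M; first by lra.
  exact: continuous_subspaceT.
move=> q; rewrite in_itv /= => /andP[qM1 qM2] hq.
have hmin y : h q <= h y.
  have [yM|yM] := boolP (y \in `[- M, M]); first exact: hq.
  have h0 : h q <= h 0 by apply: hq; rewrite in_itv /=; apply/andP; split; lra.
  apply: le_trans h0 _; rewrite /h.
  have := ht y.
  have : M ^+ 2 <= y ^+ 2.
    rewrite -(ger0_norm (ltW M0')) -[leRHS]real_normK ?num_real//.
    rewrite lerXn2r ?nnegrE// (ger0_norm (ltW M0')).
    rewrite leNgt ltr_norml; apply/negP => /andP[y1 y2].
    by move: yM; rewrite in_itv /= !ltW.
  move=> yy; have : e * M ^+ 2 <= e * y ^+ 2 by rewrite ler_pM2l.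
  rewrite /M0 in Me; rewrite expr0n /=; lra.
have [d hd] := beta_has_slope q.
(* First-order condition at the minimiser: otherwise a small step [s'] against the sign of [x] would
   lower [h]. *)
have dE : d = - (alpha + e * q).
  apply/eqP; rewrite -subr_eq0; set x := d - _; apply/negP => /negP x0.
  have x4 : 0 < `|x| / 4 by rewrite divr_gt0// normr_gt0.
  have [r1 r10 hr1] := hd _ x4.
  pose s := Num.min (r1 / 2) (`|x| / (4 * e)).
  have s0 : 0 < s.
    rewrite /s lt_min; apply/andP; split; first lra.
    by apply: divr_gt0; [rewrite normr_gt0|exact: mulr_gt0].
  have sr : s < r1 by rewrite gt_min; apply/orP; left; lra.
  have se : e * s <= `|x| / 4.
    apply: (@le_trans _ _ (e * (`|x| / (4 * e)))); first by rewrite ler_pM2l// ge_min lexx orbT.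
    by rewrite le_eqVlt; apply/orP; left; apply/eqP; field; rewrite lt0r_neq0.
  pose s' := - Num.sg x * s.
  have s'E : `|s'| = s by rewrite normrM normrN normr_sg x0 mul1r gtr0_norm.
  have := hr1 s'; rewrite s'E => /(_ sr) /(le_trans (ler_norm _)) h1.
  have := hmin (q + s'); rewrite /h => h2.
  have xs : x * s' = - `|x| * s by rewrite /s' [in RHS]normrEsg; ring.
  have s2 : s' ^+ 2 = s ^+ 2 by rewrite -(real_normK (num_real s')) s'E.
  have p1 : e * s * s <= `|x| / 4 * s by rewrite ler_pM2r.
  have p2 : 0 < `|x| * s by rewrite mulr_gt0 ?normr_gt0.
  have xE : d = x - (alpha + e * q) by rewrite /x; ring.
  rewrite xE in h1; rewrite (_ : (q + s') ^+ 2 = q ^+ 2 + 2 * (q * s') + s' ^+ 2) in h2; last by ring.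
  rewrite s2 in h2; lra.
exists q, (alpha + e * q); split; first by rewrite -dE.
- rewrite addrC addKr -(gtr0_norm r0).
  have h0 := hmin 0; rewrite /h expr0n /= in h0.
  have hq2 : e * q ^+ 2 <= M0 by have := ht q; rewrite /M0; lra.
  have : (e * q) ^+ 2 < r ^+ 2.
    rewrite exprMn expr2 -mulrA; apply: (@le_lt_trans _ _ (e * M0)); first by rewrite ler_pM2l.
    rewrite /e (_ : r ^+ 2 / M0 / 2 * M0 = r ^+ 2 / 2); last by field; rewrite lt0r_neq0.
    by have := exprn_gt0 2 r0; lra.
  move=> h2; rewrite ltNge; apply/negP => h3; move: h2; rewrite ltNge => /negP; apply.
  rewrite -(real_normK (num_real r)) -[leRHS](real_normK (num_real (e * q))).
  by apply: lerXn2r; rewrite ?nnegrE.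
- have := ht q; have : 0 <= e * q ^+ 2 by rewrite mulr_ge0 ?sqr_ge0// ltW.
  lra.
Qed.

Lemma core_lower (alpha t t' r : R) : (forall y, t' <= alpha * y + beta y) ->
  t < t' -> 0 < r ->
  exists rho : R, [/\ 0 < rho & exists n0, forall n, (n0 <= n)%N ->
    expR (rho * n%:R) <=
    wsum n (fun w => if `|word_slope w - alpha| < r then expR (t * L w) else 0)].
Proof.
move=> ht tt' r0; have r20 : 0 < r / 2 by lra.
have [q [al' [hs hal hq]]] := slope_approx ht r20.
have [rho [rho0 [n0 h]]] := core_lower_at hs (lt_le_trans tt' hq) r20.
exists rho; split=> //; exists n0 => n n0n; apply: le_trans (h n n0n) _.
apply: wsum_le => w sw; case: ifPn => c1; last by case: ifP => // _; exact: expR_ge0.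
rewrite ifT//.
have := ler_distD al' (word_slope w) alpha; lra.
Qed.

Lemma word_slope_bound : exists n0, forall w, (n0 <= size w)%N -> `|word_slope w| <= 2 * b / a.
Proof.
have [n0 h] := L_neg_large; exists (maxn 1 n0) => w; rewrite geq_max => /andP[s0 /h h1].
have an0 : 0 < a / 2 * (size w)%:R by rewrite mulr_gt0 ?ltr0n// divr_gt0.
have Lw0 : L w < 0 by lra.
rewrite /word_slope normrM normfV (ltr0_norm Lw0) ler_pdivrMr ?oppr_gt0//.
apply: le_trans (gs_Phi_bound gs w) _.
have ba0 : 0 <= 2 * b / a by rewrite divr_ge0 ?mulr_ge0// ltW.
have : 2 * b / a * (a / 2 * (size w)%:R) <= 2 * b / a * - L w by rewrite ler_wpM2l//; lra.
apply: le_trans; rewrite le_eqVlt; apply/orP; left; apply/eqP; field; rewrite lt0r_neq0//; exact: a0.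
Qed.

(** A [y] with [alpha * y + beta y < t] also serves the slopes near [alpha]. Slopes of long words
    are bounded, so by compactness finitely many [y] suffice, and every word is charged to one of
    finitely many Gibbs sums with an exponential gain. *)
Lemma core_upper (C : set R) (t : R) : closed C ->
  (forall alpha, C alpha -> exists y, alpha * y + beta y < t) ->
  exists r rho K : R, [/\ 0 < r, 0 < rho, 0 < K & exists n0, forall n, (n0 <= n)%N ->
    wsum n (fun w => if `[< exists2 alpha, C alpha & `|word_slope w - alpha| < r >]
                     then expR (t * L w) else 0) <= K * expR (- rho * n%:R)].
Proof.
move=> Cc hC; have [n1 h1] := word_slope_bound; have [n2 h2] := L_neg_large.
pose M := 2 * b / a + 1.
pose C' := `[- M, M]%classic `&` C.
have C'c : compact C' by apply: compact_closedI => //; exact: segment_compact.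
pose D := [set z : R * R | 0 < z.2].
pose U (z : R * R) := [set alpha | alpha * z.1 + beta z.1 + z.2 < t].
have [s sD hs] : finite_subset_cover D U C'.
  rewrite compact_cover in C'c; apply: C'c.
    move=> z _.
    have -> : U z = (fun alpha => alpha * z.1 + beta z.1 + z.2) @^-1` [set x | x < t] by [].
    apply: open_comp; last exact: open_lt.
      move=> x _; apply: cvgD; last exact: cvg_cst.
      by apply: cvgD; [apply: cvgMl; exact: cvg_id|exact: cvg_cst].
  move=> alpha [_ /hC[y hy]]; exists (y, (t - (alpha * y + beta y)) / 2) => /=.
    by rewrite /D /=; lra.
  by rewrite /U /=; lra.
have [l lD hl] : exists2 l : seq (R * R), forall z, z \in l -> 0 < z.2 &
    forall alpha, C' alpha -> exists2 z, z \in l & alpha * z.1 + beta z.1 + z.2 < t.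
  exists (finmap.enum_fset s); first by move=> z /sD; rewrite inE.
  by move=> alpha /hs[z /= zs hz]; exists z.
(* Even [e * (1 + |y|)] stays below every slack: this absorbs the distance, at most [e / 2], between
   the slope of a word and [alpha], and leaves a gain of [e / 2]. *)
have [e e0 he] : exists2 e : R, 0 < e & forall z, z \in l -> e <= z.2 /\ e * (1 + `|z.1|) <= z.2.
  elim: l lD {hl} => [|z l IH] lD; first by exists 1.
  have [|e e0 he] := IH; first by move=> z' z'l; apply: lD; rewrite inE z'l orbT.
  have z20 : 0 < z.2 by apply: lD; rewrite inE eqxx.
  have z10 : 0 < 1 + `|z.1| by rewrite ltr_pwDl.
  pose x := z.2 / (1 + `|z.1|); have x0 : 0 < x by rewrite divr_gt0.
  exists (Num.min e x); first by rewrite lt_min e0.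
  move=> z'; rewrite inE => /orP[/eqP ->|/he[l1 l2]].
    have l1 : Num.min e x <= x by rewrite ge_min lexx orbT.
    have l2 : Num.min e x * (1 + `|z.1|) <= z.2 by rewrite -ler_pdivlMr.
    split=> //; apply: le_trans l2; rewrite ler_peMr// ?lerDl// ltW// lt_min e0//.
  have l3 : Num.min e x <= e by rewrite ge_min lexx.
  split; first exact: le_trans l1.
  by apply: le_trans l2; rewrite ler_wpM2r// addr_ge0.
pose r := Num.min 1 (e / 2); have r0 : 0 < r by rewrite lt_min ltr01 divr_gt0.
pose K := \sum_(z <- l) expR (c * (1 + `|z.1| + `|beta z.1|)) + 1.
exists r, (e / 2 * (a / 2)), K; split => //.
- by rewrite mulr_gt0// divr_gt0.
- by rewrite /K ltr_wpDl// sumr_ge0// => z _; exact: expR_ge0.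
exists (maxn 1 (maxn n1 n2)) => n; rewrite !geq_max => /and3P[n0 n1n n2n].
have nR0 : 0 < n%:R :> R by rewrite ltr0n.
apply: (@le_trans _ _ (wsum n (fun w => \sum_(z <- l)
    g z.1 w * expR (- (e / 2 * (a / 2)) * n%:R)))); last first.
  rewrite (_ : wsum n _ = \sum_(z <- l) wsum n (g z.1) * expR (- (e / 2 * (a / 2)) * n%:R)).
    rewrite -mulr_suml ler_pM2r ?expR_gt0// /K.
    apply: ler_wpDr => //; apply: ler_sum => z _; exact: gibbs_sum_le gs _ _.
  elim: l {K lD hl he} => [|z l' IH].
    by rewrite big_nil -[RHS](@wsum0 R N n); apply: eq_wsum => w _; rewrite big_nil.
  rewrite big_cons -IH -wsumZr -wsumD; apply: eq_wsum => w _; by rewrite big_cons.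
apply: wsum_le => w sw; case: asboolP => [[alpha Ca war]|_]; last first.
  by rewrite sumr_ge0// => z _; rewrite mulr_ge0 ?expR_ge0.
have Lw : L w <= - (a / 2) * n%:R by rewrite -sw; apply: h2; rewrite sw.
have an0 : 0 < a / 2 * n%:R by rewrite mulr_gt0// divr_gt0.
have Lw0 : L w < 0 by lra.
have wb : `|word_slope w| <= 2 * b / a by apply: h1; rewrite sw.
have [z zs hz] : exists2 z, z \in l & alpha * z.1 + beta z.1 + z.2 < t.
  apply: hl; split=> //; rewrite /= in_itv /= -ler_norml.
    have : r <= 1 by rewrite ge_min lexx.
    have := ler_normB (word_slope w) (word_slope w - alpha).
    by rewrite subKr /M; lra.
have [he1 he2] := he z zs.
rewrite (big_rem z)//=; apply: (@le_trans _ _ (g z.1 w * expR (- (e / 2 * (a / 2)) * n%:R))); last first.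
  by rewrite lerDl sumr_ge0// => y _; rewrite mulr_ge0 ?expR_ge0.
rewrite /g /gibbs -expRD ler_expR.
have PE : Phi w = word_slope w * L w by rewrite /word_slope mulfVK// lt_eqF.
have e1 : `|z.1 * (word_slope w - alpha)| <= `|z.1| * (e / 2).
  rewrite normrM ler_wpM2l//; apply: le_trans (ltW war) _; by rewrite ge_min lexx orbT.
have e2 : (alpha * z.1 + beta z.1 + e * (1 + `|z.1|) - t) * - L w <= 0.
  by rewrite mulr_le0_ge0//; lra.
have e3 : z.1 * (word_slope w - alpha) * - L w <= `|z.1| * (e / 2) * - L w.
  rewrite ler_wpM2r//; first lra; by apply: le_trans e1; exact: ler_norm.
have e4 : e * (a / 2 * n%:R) <= e * - L w by rewrite ler_pM2l//; lra.
have e5 : 0 <= e * `|z.1| * - L w by rewrite !mulr_ge0//; lra.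
have e6 : 0 <= e * (a / 2 * n%:R) by rewrite mulr_ge0 ?ltW.
rewrite PE; lra.
Qed.

Lemma has_slope_derive1 (q d : R) : has_slope beta q d -> derive1 beta q = d.
Proof.
move=> hs; rewrite /derive1; apply: cvg_lim => //; apply/cvgrPdist_le => e e0.
have [r r0 hr] := hs e e0; near=> h.
have h0 : h != 0 by near: h; exact: nbhs_dnbhs_neq.
have hr' : `|h| < r.
  near: h; apply: (@nbhs_dnbhs _ (0 : R)); apply/nbhs_normP; exists r => //= y.
  by rewrite /ball_ /= sub0r normrN.
have := hr h hr'; rewrite (addrC q h) => h1.
rewrite -(ler_pM2r (_ : 0 < `|h|)) ?normr_gt0// -normrM.
rewrite /GRing.scale /= (_ : _ * h = - (beta (h + q) - beta q - d * h)); last by field.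
by rewrite normrN.
Unshelve. all: end_near. Qed.

Lemma neg_deriv_rangeP (alpha : R) :
  neg_deriv_range beta alpha <-> exists q, has_slope beta q (- alpha).
Proof.
split=> [[q _ <-]|[q hq]].
  by exists q; have [d hd] := beta_has_slope q; rewrite opprK (has_slope_derive1 hd).
by exists q => //; rewrite (has_slope_derive1 hq) opprK.
Qed.

(** For fixed [y] the expression is continuous in [alpha], so the bound of [slope_star_ge0] passes
    to limits. *)
Lemma closure_star_ge0 (alpha : R) : closure (neg_deriv_range beta) alpha ->
  forall y, 0 <= alpha * y + beta y.
Proof.
move=> cl y; rewrite leNgt; apply/negP => lt0.
have y10 : 0 < 1 + `|y| by rewrite ltr_pwDl.
have e0 : 0 < - (alpha * y + beta y) / (1 + `|y|) by rewrite divr_gt0// oppr_gt0.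
have [x [/neg_deriv_rangeP[q hq] bx]] := cl _ (nbhsx_ballx alpha _ e0).
have := slope_star_ge0 hq y; rewrite leNgt => /negP; apply.
have : (x - alpha) * y <= `|alpha - x| * `|y|.
  by rewrite distrC -normrM ler_norm.
have : `|alpha - x| * (1 + `|y|) < - (alpha * y + beta y) by rewrite -ltr_pdivlMr.
have := normr_ge0 (alpha - x); lra.
Qed.

End Thermodynamics.

(** * Critical exponents *)

Section RadiusOfConvergence.
Variable R : realType.

Lemma near_right0P (P : R -> Prop) : (\forall x \near 0^'+, P x) <->
  exists2 r : R, 0 < r & forall x, 0 < x < r -> P x.
Proof.
split=> [|[r r0 h]].
  rewrite /at_right => /(@nbhs_normP R R 0) [r /= r0 h]; exists r => // x /andP[x0 xr].
  by apply: h => //=; rewrite /ball_ /= sub0r normrN gtr0_norm.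
near=> x; apply: h; apply/andP; split; near: x.
- exact: nbhs_right_gt.
- exact: nbhs_right_lt.
Unshelve. all: end_near. Qed.

Lemma cvg_right0_1P (s : R -> \bar R) : s r @[r --> 0^'+] --> 1%E <->
  forall e : R, 0 < e -> exists2 r : R, 0 < r & forall x, 0 < x < r ->
    ((1 - e)%:E <= s x <= (1 + e)%:E)%E.
Proof.
split=> [/fine_cvgP[fin /cvgrPdist_le h] e e0|h].
  have := h e e0 => {}h.
  have /near_right0P[r r0 hr] : \forall x \near 0^'+, s x \is a fin_num /\ `|1 - fine (s x)| <= e.
    by near=> x; split; near: x.
  exists r => // x /hr[fx]; rewrite -(fineK fx) !lee_fin ler_norml /= => /andP[h1 h2].
  by apply/andP; split; lra.
apply/fine_cvgP; split.
  apply/near_right0P; have [r r0 hr] := h 1 ltr01; exists r => // x /hr /andP[h1 h2].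
  by rewrite fin_numE; apply/andP; split; apply/eqP => sx; rewrite sx in h1 h2.
apply/cvgrPdist_le => e e0; apply/near_right0P; have [r r0 hr] := h e e0.
exists r => // x /hr /=.
case: (s x) => [y| |] /andP[] //=; rewrite !lee_fin ler_norml => h1 h2.
by apply/andP; split; lra.
Unshelve. all: end_near. Qed.

Lemma cvg_right0_pinftyP (s : R -> \bar R) : s r @[r --> 0^'+] --> +oo%E <->
  forall M : R, exists2 r : R, 0 < r & forall x, 0 < x < r -> (M%:E <= s x)%E.
Proof.
split=> [/cvgeyPge h M|h]; first by have /near_right0P := h M.
by apply/cvgeyPge => M; apply/near_right0P.
Qed.

Lemma sigma_rad_ge0 (u : R^nat) : (0 <= sigma_rad u)%E.
Proof.
apply: ereal_sup_ubound; exists 0; last by rewrite normr0.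
rewrite /pseries; apply/cvg_ex; exists (u 0%N).
apply: (@cvg_near_cst _ _ _ _ _ _); near=> n.
rewrite /series /=; have n0 : (0 < n)%N by near: n; exact: nbhs_infty_gt.
rewrite -(prednK n0) big_nat_recl// expr0 mulr1 big1_seq ?addr0// => i _.
by rewrite exprS mul0r mulr0.
Unshelve. all: end_near. Qed.

(** Comparison with a geometric series; the terms below [n0] are absorbed into the constant [K']. *)
Lemma sigma_rad_ge (u : R^nat) (K rho : R) : (forall n, 0 <= u n) ->
  (exists n0, forall n, (n0 <= n)%N -> u n <= K * expR (rho * n%:R)) ->
  ((expR (- rho))%:E <= sigma_rad u)%E.
Proof.
move=> u0 [n0 hu].
pose K' : R := `|K| + \sum_(i < n0) u i * expR (- rho * i%:R).
have hK n : u n <= K' * expR (rho * n%:R).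
  have s0 : 0 <= \sum_(i < n0) u i * expR (- rho * i%:R).
    by apply: sumr_ge0 => i _; rewrite mulr_ge0 ?expR_ge0.
  have [n0n|nn0] := leqP n0 n.
    apply: le_trans (hu n n0n) _; rewrite ler_pM2r ?expR_gt0// /K'.
    by have := ler_norm K; lra.
  rewrite -ler_pdivrMr ?expR_gt0// -expRN -mulNr /K' (bigD1 (Ordinal nn0))//= addrCA lerDl.
  by rewrite addr_ge0// sumr_ge0// => i _; rewrite mulr_ge0 ?expR_ge0.
have cv z : 0 < z < expR (- rho) -> (z%:E <= sigma_rad u)%E.
  move=> /andP[z0 z1]; apply: ereal_sup_ubound; exists z; last by rewrite gtr0_norm.
  rewrite /= /pseries.
  apply: (@series_le_cvg _ _ (geometric K' (z * expR rho))).
  - by move=> n; rewrite mulr_ge0// exprn_ge0// ltW.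
  - move=> n; rewrite /geometric /=; apply: mulr_ge0.
      by rewrite /K' addr_ge0// sumr_ge0// => i _; rewrite mulr_ge0 ?expR_ge0.
    by apply: exprn_ge0; apply: mulr_ge0; [exact: ltW|exact: expR_ge0].
  - move=> n; rewrite /geometric /= exprMn -expRM_natr (mulrC (z ^+ n)) mulrA.
    by rewrite ler_wpM2r// exprn_ge0// ltW.
  apply: is_cvg_geometric_series; rewrite gtr0_norm ?mulr_gt0 ?expR_gt0//.
  by rewrite -ltr_pdivlMr ?expR_gt0// mul1r -expRN.
have := sigma_rad_ge0 u; case: (sigma_rad u) cv => [r| |] //=; last by move=> *; rewrite leey.
move=> cv; rewrite !lee_fin => r0; rewrite leNgt; apply/negP => rl.
have e0 := expR_gt0 (- rho).
have := cv ((r + expR (- rho)) / 2); rewrite lee_fin.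
have -> : 0 < (r + expR (- rho)) / 2 < expR (- rho) by apply/andP; split; lra.
by move=> /(_ isT); lra.
Qed.

Lemma sigma_rad_le (u : R^nat) (k rho : R) : 0 < k ->
  (exists n0, forall n, (n0 <= n)%N -> k * expR (rho * n%:R) <= u n) ->
  (sigma_rad u <= (expR (- rho))%:E)%E.
Proof.
move=> k0 [n0 hu]; apply: ge_ereal_sup => _ [z cz <-]; rewrite lee_fin.
rewrite leNgt; apply/negP => hz.
have := cvg_series_cvg_0 cz => /cvgrPdist_lt /(_ k k0) [n1 _ hn1].
pose n := maxn n0 n1.
have := hn1 n (leq_maxr _ _); rewrite sub0r normrN ltNge => /negP; apply.
have h := hu n (leq_maxl _ _).
rewrite normrM normrX; apply: (@le_trans _ _ (u n * `|z| ^+ n)); last first.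
  by rewrite ler_wpM2r ?exprn_ge0// ler_norm.
apply: (@le_trans _ _ (k * expR (rho * n%:R) * `|z| ^+ n)); last first.
  by rewrite ler_wpM2r ?exprn_ge0.
rewrite -mulrA -[leLHS]mulr1 ler_pM2l// expRM_natr -exprMn exprn_ege1//.
by rewrite mulrC -ler_pdivrMr ?expR_gt0// mul1r -expRN ltW.
Qed.

Lemma rballP (C : set R) (r x : R) : rball C r x <-> exists2 y, C y & `|x - y| < r.
Proof.
rewrite /rball /edist_inf; split=> /=.
  by move=> /ereal_inf_lt[_ [y Cy <-]] /edist_lt_ball h; exists y.
move=> [y Cy xy]; pose e := (`|x - y| + r) / 2.
have e0 : 0 < e by have := normr_ge0 (x - y); rewrite /e; lra.
apply: (@le_lt_trans _ _ e%:E); last by rewrite lte_fin /e; lra.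
apply: le_trans (edist_fin e0 (_ : ball (x, y).1 e (x, y).2)).
  by apply: ereal_inf_lbound; exists y.
by rewrite /ball /= /e; lra.
Qed.

End RadiusOfConvergence.

Section CriticalExponent.
Variables (R : realType) (N : nat).
Implicit Types (w u v : seq 'I_N).
Variables (Phi L : seq 'I_N -> R) (a b c : R) (beta : R -> R).
Hypothesis gs : gibbs_system Phi L a b c beta.

Let a0 := gs_a gs.
Let b0 := gs_b gs.
Let c0 := gs_c gs.

Definition slope_sum (D : set R) (t : R) n :=
  wsum n (fun w => if `[< D (word_slope Phi L w) >] then expR (t * L w) else 0).

Variables (ze : set R -> R -> R^nat).
Hypothesis ze_bounds : forall D t n,
  expR (- (c * `|t|)) * (n%:R^-1 * slope_sum D t n) <= ze D t n
  <= expR (c * `|t|) * (n%:R^-1 * slope_sum D t n).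

Lemma slope_sum_ge0 D t n : 0 <= slope_sum D t n.
Proof. by apply: wsum_ge0 => w _; case: ifP => // _; exact: expR_ge0. Qed.

Lemma ze_ge0 D t n : 0 <= ze D t n.
Proof.
have /andP[h _] := ze_bounds D t n; apply: le_trans h.
by rewrite !mulr_ge0 ?expR_ge0 ?invr_ge0 ?slope_sum_ge0.
Qed.

Lemma slope_sum_subset D D' t n : D `<=` D' -> slope_sum D t n <= slope_sum D' t n.
Proof.
move=> DD; apply: wsum_le => w _; case: asboolP => [/DD h|_]; first by rewrite asboolT.
by case: ifP => // _; exact: expR_ge0.
Qed.

(** As [L] lies between [- b n - c] and [- a n + c], moving the exponent by [s] moves the
    exponential growth rate by an amount between [a s] and [b s]: the radius reacts continuously,
    and also strictly, to [t]. *)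
Lemma slope_sum_shift_le D (t s : R) n : 0 <= s ->
  slope_sum D t n <= expR (s * (b * n%:R + c)) * slope_sum D (t + s) n.
Proof.
move=> s0; rewrite -wsumZ; apply: wsum_le => w sw; case: ifP => _; last by rewrite mulr0.
rewrite -expRD ler_expR.
have : s * (- b * n%:R - c) <= s * L w by rewrite ler_wpM2l// -sw; exact: gs_L_lb gs w.
lra.
Qed.

Lemma slope_sum_shift_ge D (t s : R) n : 0 <= s ->
  slope_sum D (t + s) n <= expR (s * (- a * n%:R + c)) * slope_sum D t n.
Proof.
move=> s0; rewrite -wsumZ; apply: wsum_le => w sw; case: ifP => _; last by rewrite mulr0.
rewrite -expRD ler_expR.
have : s * L w <= s * (- a * n%:R + c) by rewrite ler_wpM2l// -sw; exact: gs_L_ub gs w.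
lra.
Qed.

Lemma sigma_rad_ze_ge D (t K rho : R) :
  (exists n0, forall n, (n0 <= n)%N -> slope_sum D t n <= K * expR (rho * n%:R)) ->
  ((expR (- rho))%:E <= sigma_rad (ze D t))%E.
Proof.
move=> [n0 h]; apply: (@sigma_rad_ge _ _ (expR (c * `|t|) * K)); first exact: ze_ge0.
exists (maxn 1 n0) => n; rewrite geq_max => /andP[n1 nn0].
have /andP[_ h1] := ze_bounds D t n; apply: le_trans h1 _.
rewrite -mulrA ler_pM2l ?expR_gt0//; apply: le_trans _ (h n nn0).
by rewrite ler_piMl ?slope_sum_ge0// invf_le1 ?ler1n ?ltr0n.
Qed.

(** The factor [1 / n] of the zeta coefficients is paid for by [e * n <= expR (e * n)]; afterwards
    [e] tends to 0. *)
Lemma sigma_rad_ze_le D (t k rho : R) : 0 < k ->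
  (exists n0, forall n, (n0 <= n)%N -> k * expR (rho * n%:R) <= slope_sum D t n) ->
  (sigma_rad (ze D t) <= (expR (- rho))%:E)%E.
Proof.
move=> k0 [n0 h].
have step (e : R) : 0 < e -> (sigma_rad (ze D t) <= (expR (- (rho - e)))%:E)%E.
  move=> e0; apply: (@sigma_rad_le _ _ (expR (- (c * `|t|)) * (k * e))).
    by rewrite !mulr_gt0 ?expR_gt0.
  exists (maxn 1 n0) => n; rewrite geq_max => /andP[n1 nn0].
  have nR : 0 < n%:R :> R by rewrite ltr0n.
  have /andP[h1 _] := ze_bounds D t n; apply: le_trans _ h1.
  rewrite -mulrA ler_pM2l ?expR_gt0// ler_pdivlMl//.
  apply: le_trans _ (h n nn0).
  have -> : rho * n%:R = (rho - e) * n%:R + e * n%:R by ring.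
  rewrite expRD; set y := expR ((rho - e) * _).
  have y0 : 0 < y by exact: expR_gt0.
  have : e * n%:R <= expR (e * n%:R) by have := expR_ge1Dx (e * n%:R); lra.
  move=> h2; have := ler_wpM2l (ltW (mulr_gt0 k0 y0)) h2; lra.
have := sigma_rad_ge0 (ze D t); case E : (sigma_rad (ze D t)) => [r| |] //; last first.
  by move=> _; have := step 1 ltr01; rewrite E.
rewrite !lee_fin => r0; rewrite leNgt; apply/negP => lt.
have lnr : - rho < ln r by rewrite -ltr_expR lnK// posrE; exact: lt_trans (expR_gt0 _) lt.
have rpos : 0 < r by exact: lt_trans (expR_gt0 _) lt.
have /step : 0 < (ln r + rho) / 2 by lra.
rewrite E lee_fin -[leLHS](lnK (rpos : r \is Num.pos)) ler_expR; lra.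
Qed.

Let legendre_le (alpha y : R) : (legendre beta alpha <= (alpha * y + beta y)%:E)%E.
Proof. by apply: ereal_inf_lbound; exists y. Qed.

Let legendre_ltP (alpha t : R) : (legendre beta alpha < t%:E)%E ->
  exists y, alpha * y + beta y < t.
Proof. by move=> /ereal_inf_lt[_ [y _ <-]]; rewrite lte_fin => h; exists y. Qed.

Let legendre_gtP (alpha t : R) : (t%:E < legendre beta alpha)%E ->
  exists2 t', t < t' & forall y, t' <= alpha * y + beta y.
Proof.
move=> lt; have := legendre_le alpha 0; case E : (legendre beta alpha) lt => [l| |]//.
rewrite lte_fin => tl _; exists l => // y.
by have := legendre_le alpha y; rewrite E lee_fin.
Qed.

Definition sup_star (C : set R) := ereal_sup [set legendre beta alpha | alpha in C].

Lemma sup_star_neq_pinfty C : sup_star C != +oo%E.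
Proof.
suff : (sup_star C <= (beta 0)%:E)%E by case: (sup_star C).
apply: ge_ereal_sup => _ [alpha _ <-]; have := legendre_le alpha 0.
by rewrite mulr0 add0r.
Qed.

Lemma sup_star_ltP C (t : R) : (sup_star C < t%:E)%E ->
  forall alpha, C alpha -> exists y, alpha * y + beta y < t.
Proof.
move=> lt alpha Ca; apply: legendre_ltP; apply: le_lt_trans lt.
by apply: ereal_sup_ubound; exists alpha.
Qed.

Lemma sup_star_gtP C (t : R) : (t%:E < sup_star C)%E ->
  exists2 alpha, C alpha & exists2 t', t < t' & forall y, t' <= alpha * y + beta y.
Proof.
move=> /ereal_sup_gt[_ [alpha Ca <-]] /legendre_gtP h; by exists alpha.
Qed.

Definition near_set (C : set R) (r : R) : set R := [set x | exists2 y, C y & `|x - y| < r].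

(** With [s = 0] the radius exceeds 1 for every exponent above the supremum. With small [s] and [t]
    just above the supremum, the radius at the supremum is at least [expR (- (b * s))]. *)
Lemma sigma_rad_above C (t s : R) : closed C -> (sup_star C < t%:E)%E -> 0 <= s ->
  exists r rho : R, [/\ 0 < r, 0 < rho & forall D, D `<=` near_set C r ->
    ((expR (rho - b * s))%:E <= sigma_rad (ze D (t - s)))%E].
Proof.
move=> Cc lt s0.
have [r [rho [K [r0 rho0 K0 [n0 h]]]]] := core_upper gs Cc (sup_star_ltP lt).
exists r, rho; split=> // D DC; rewrite -[rho - _]opprK.
apply: (@sigma_rad_ze_ge _ _ (expR (s * c) * K)); exists n0 => n n0n.
apply: le_trans (slope_sum_shift_le D (t - s) n s0) _; rewrite subrK.
have h1 : slope_sum D t n <= K * expR (- rho * n%:R).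
  by apply: le_trans (slope_sum_subset t n DC) (h n n0n).
apply: le_trans (ler_wpM2l (expR_ge0 _) h1) _.
rewrite mulrCA -mulrA [leRHS]mulrCA ler_pM2l// -!expRD ler_expR; lra.
Qed.

Lemma sigma_rad_below D (alpha t t' s r : R) : (forall y, t' <= alpha * y + beta y) ->
  t < t' -> 0 <= s -> 0 < r -> (forall x, `|x - alpha| < r -> D x) ->
  (sigma_rad (ze D (t - s)) <= (expR (- (a * s)))%:E)%E /\
  (sigma_rad (ze D (t + s)) <= (expR (b * s))%:E)%E.
Proof.
move=> ht tt' s0 r0 hD.
have [rho [rho0 [n0 h]]] := core_lower gs ht tt' r0.
have hn n : (n0 <= n)%N -> 1 <= slope_sum D t n.
  move=> n0n; apply: (@le_trans _ _ (expR (rho * n%:R))).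
    by rewrite -expR0 ler_expR mulr_ge0// ltW.
  apply: le_trans (h n n0n) _; apply: wsum_le => w _; case: ifPn => [/hD ?|_].
    by rewrite asboolT.
  by case: ifP => // _; exact: expR_ge0.
split.
  apply: (@sigma_rad_ze_le _ _ (expR (- (s * c)))); first exact: expR_gt0.
  exists n0 => n n0n.
  have := slope_sum_shift_ge D (t - s) n s0; rewrite subrK => h1.
  have {h1} := le_trans (hn n n0n) h1.
  rewrite mulrC -ler_pdivrMr ?expR_gt0// mul1r -expRN => h1.
  by apply: le_trans h1; rewrite -expRD ler_expR; lra.
rewrite -[b * s]opprK.
apply: (@sigma_rad_ze_le _ _ (expR (- (s * c)))); first exact: expR_gt0.
exists n0 => n n0n.
have {}h := le_trans (hn n n0n) (slope_sum_shift_le D t n s0).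
rewrite mulrC -ler_pdivrMr ?expR_gt0// mul1r -expRN in h.
by apply: le_trans h; rewrite -expRD ler_expR; lra.
Qed.

(** At exponent 0 the sums count words, and a count below 1 is 0. *)
Lemma no_words_near C : closed C -> sup_star C = -oo%E -> exists2 r : R, 0 < r &
  exists n0, forall w, (n0 <= size w)%N -> ~ near_set C r (word_slope Phi L w).
Proof.
move=> Cc CE.
have [|r [rho [K [r0 rho0 K0 [n0 h]]]]] := @core_upper R N Phi L a b c beta gs C 0 Cc.
  by apply: sup_star_ltP; rewrite CE ltNyr.
have h20 : 0 < (2^-1 : R) by rewrite invr_gt0.
have [n1 h1] := expR_eventually_le (ln K) rho0 h20.
exists r => //; exists (maxn n0 n1) => w; rewrite geq_max => /andP[wn0 wn1] hw.
have := h _ wn0; have := h1 _ wn1; rewrite expRD lnK// -mulNr.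
have := @wsum_ge_term R N (size w) (fun w => if `[< near_set C r (word_slope Phi L w) >]
   then expR (0 * L w) else 0) w; rewrite asboolT// mul0r expR0 => /(_ _ erefl) h2.
have {}h2 := h2 (fun w => _).
have {}h2 : 1 <= wsum (size w) (fun w => if `[< near_set C r (word_slope Phi L w) >]
   then expR (0 * L w) else 0) by apply: h2 => v; case: ifP => // _; exact: expR_ge0.
move=> h3 h4; have := le_trans h2 h4; lra.
Qed.

Lemma sigma_rad_no_words D (t : R) (n0 : nat) :
  (forall w, (n0 <= size w)%N -> ~ D (word_slope Phi L w)) -> sigma_rad (ze D t) = +oo%E.
Proof.
move=> h; apply: eq_infty => M.
apply: (@le_trans _ _ (expR (- (- `|M|)))%:E).
  by rewrite lee_fin opprK; have := expR_ge1Dx `|M|; have := ler_norm M; lra.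
apply: (@sigma_rad_ze_ge _ _ 1); exists n0 => n n0n.
rewrite (_ : slope_sum D t n = 0); first by rewrite mul1r expR_ge0.
rewrite -(@wsum0 R N n); apply: eq_wsum => w sw; rewrite asboolF//.
by apply: h; rewrite sw.
Qed.

Let small_shift (e : R) : 0 < e -> exists2 s : R, 0 < s & expR (b * s) <= 1 + e /\ 1 - e <= expR (- (b * s)).
Proof.
move=> e0; have b1 : 0 < b + 1 by rewrite ltr_wpDl.
have l0 : 0 < ln (1 + e) by rewrite ln_gt0//; lra.
pose s := Num.min e (ln (1 + e)) / (b + 1).
have s0 : 0 < s by rewrite divr_gt0// lt_min e0.
have bs : b * s <= Num.min e (ln (1 + e)).
  rewrite /s mulrA ler_pdivrMr// mulrC ler_wpM2l//; last lra.
  by rewrite ltW// lt_min e0.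
exists s => //; split.
  have e1 : 0 < 1 + e by lra.
  rewrite -[leRHS](lnK (e1 : 1 + e \is Num.pos)) ler_expR; apply: le_trans bs _.
  by rewrite ge_min lexx orbT.
have : b * s <= e by apply: le_trans bs _; rewrite ge_min lexx.
have := expR_ge1Dx (- (b * s)); lra.
Qed.

Lemma rball_near_set (C : set R) (r r' : R) : r <= r' -> rball C r `<=` near_set C r'.
Proof.
by move=> rr x /rballP[y Cy xy]; exists y => //; exact: lt_le_trans rr.
Qed.

Lemma crit_exponent_real C (t : R) : closed C -> sup_star C = t%:E ->
  sigma_rad (ze (rball C r) t) @[r --> 0^'+] --> 1%E.
Proof.
move=> Cc CE; apply/cvg_right0_1P => e /small_shift[s s0 [se1 se2]].
have [|r [rho [r0 rho0 h]]] := @sigma_rad_above C (t + s) s Cc _ (ltW s0).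
  by rewrite CE lte_fin; lra.
exists r => // x /andP[x0 xr]; apply/andP; split.
  apply: (@le_trans _ _ (expR (rho - b * s))%:E).
    by rewrite lee_fin; apply: le_trans se2 _; rewrite ler_expR; lra.
  by have := h (rball C x); rewrite addrK; apply; apply: rball_near_set; exact: ltW.
have [|al Cal [t' tt' ht']] := @sup_star_gtP C (t - s).
  by rewrite CE lte_fin; lra.
have [|_] := @sigma_rad_below (rball C x) al (t - s) t' s x ht' tt' (ltW s0) x0.
  by move=> y yx; apply/rballP; exists al.
by rewrite subrK => /le_trans; apply; rewrite lee_fin.
Qed.

Lemma crit_exponent_ninfty C (t : R) : closed C -> sup_star C = -oo%E ->
  sigma_rad (ze (rball C r) t) @[r --> 0^'+] --> +oo%E.
Proof.
move=> Cc CE; apply/cvg_right0_pinftyP => M.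
have [r r0 [n0 h]] := no_words_near Cc CE; exists r => // x /andP[x0 xr].
rewrite (@sigma_rad_no_words _ _ n0) ?leey// => w /h nw.
by move=> /(rball_near_set (ltW xr)).
Qed.

Lemma crit_exponent_above C (t : R) : closed C -> (sup_star C < t%:E)%E ->
  ~ (sigma_rad (ze (rball C r) t) @[r --> 0^'+] --> 1%E).
Proof.
move=> Cc lt /cvg_right0_1P h.
have [r [rho [r0 rho0 hr]]] := @sigma_rad_above C t 0 Cc lt (lexx _).
have [r' r'0 hr'] := h (rho / 2) (divr_gt0 rho0 (ltr0Sn _ 1)).
pose x := Num.min r r' / 2.
have m0 : 0 < Num.min r r' by rewrite lt_min r0.
have mr : Num.min r r' <= r by rewrite ge_min lexx.
have mr' : Num.min r r' <= r' by rewrite ge_min lexx orbT.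
have /hr' /andP[_ h1] : 0 < x < r' by apply/andP; rewrite /x; split; lra.
have := hr (rball C x) (rball_near_set _); rewrite subr0 => h2.
have {}h2 : ((expR (rho - b * 0))%:E <= sigma_rad (ze (rball C x) t))%E.
  by apply: h2; rewrite /x; lra.
have := le_trans h2 h1; rewrite lee_fin mulr0 subr0.
have := expR_ge1Dx rho; lra.
Qed.

Lemma crit_exponent_below C (t : R) : (t%:E < sup_star C)%E ->
  exists2 e : R, 0 < e & forall r, 0 < r -> (sigma_rad (ze (rball C r) t) <= (1 - e)%:E)%E.
Proof.
move=> /sup_star_gtP[al Cal [t' tt' ht']].
pose s := (t' - t) / 2; have s0 : 0 < s by rewrite /s; lra.
exists (1 - expR (- (a * s))).
  by rewrite subr_gt0 -expR0 ltr_expR oppr_lt0 mulr_gt0.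
move=> r r0; rewrite opprB addrC subrK.
have [||h _] := @sigma_rad_below (rball C r) al (t + s) t' s r ht' _ (ltW s0) r0.
- by rewrite /s; lra.
- by move=> y yr; apply/rballP; exists al.
by rewrite addrK in h.
Qed.

Lemma crit_exponentP C f : closed C -> crit_exponent ze C f <-> f = sup_star C.
Proof.
move=> Cc; split; last first.
  move=> ->; have := sup_star_neq_pinfty C; case E : (sup_star C) => [t| |]//= _.
    exact: crit_exponent_real.
  by move=> t; exact: crit_exponent_ninfty.
case: f => [t| |]//= h.
  apply/eqP; rewrite eq_le; apply/andP; split; rewrite leNgt; apply/negP => lt.
    exact: (crit_exponent_above Cc lt).
  have [e e0 he] := crit_exponent_below lt.
  have /cvg_right0_1P /(_ (e / 2) (divr_gt0 e0 (ltr0Sn _ 1)))[r r0 hr] := h.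
  have /hr /andP[h1 _] : 0 < r / 2 < r by apply/andP; split; lra.
  have := le_trans h1 (he (r / 2) (divr_gt0 r0 (ltr0Sn _ 1))); rewrite lee_fin; lra.
have := sup_star_neq_pinfty C; case E : (sup_star C) => [t| |]//= _.
exfalso; have /cvg_right0_pinftyP /(_ 2)[r r0 hr] := h (t - 1).
have [|e e0 he] := @crit_exponent_below C (t - 1); first by rewrite E lte_fin; lra.
have /hr h1 : 0 < r / 2 < r by apply/andP; split; lra.
have := le_trans h1 (he (r / 2) (divr_gt0 r0 (ltr0Sn _ 1))); rewrite lee_fin; lra.
Qed.

Lemma sup_star_closure C : C `&` closure (neg_deriv_range beta) !=set0 ->
  exists t : R, sup_star C = t%:E.
Proof.
move=> [alpha [Ca cla]]; have h := closure_star_ge0 gs cla.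
have : (0%:E <= sup_star C)%E.
  apply: (@le_trans _ _ (legendre beta alpha)); last by apply: ereal_sup_ubound; exists alpha.
  by apply: le_ereal_inf_tmp => _ [y _ <-]; rewrite lee_fin.
by have := sup_star_neq_pinfty C; case: (sup_star C) => [t| |]// _ _; exists t.
Qed.

(* A point of [C] and an interior point in the range of [- beta'] are joined by a
   segment along which [beta*] is concave and which lies in the interior of [C]. *)
Let interior_approx (C : set R) (t : R) : is_interval C ->
  interior C `&` neg_deriv_range beta !=set0 -> (t%:E < sup_star C)%E ->
  exists alpha t' r : R, [/\ t < t', forall y, t' <= alpha * y + beta y, 0 < r &
    forall x, `|x - alpha| < r -> C x].
Proof.
move=> Ci [al0 [/nbhs_normP[r r0 hr] /(neg_deriv_rangeP gs)[q hq]]].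
move=> /sup_star_gtP[al Cal [t' tt' ht']].
have h0 := slope_star_ge0 gs hq.
pose M := 1 + `|t'|.
have M0 : 0 < M by rewrite ltr_pwDl.
(* So small that [(1 - th) * t'] still exceeds [t]; the end [al0] of the segment contributes at
   least 0 by [slope_star_ge0]. *)
pose th := Num.min (2^-1) ((t' - t) / (2 * M)).
have th0 : 0 < th by rewrite lt_min invr_gt0 ltr0n divr_gt0 ?subr_gt0 ?mulr_gt0.
have th1 : th <= 2^-1 by rewrite ge_min lexx.
have thM : th * (2 * M) <= t' - t by rewrite -ler_pdivlMr ?mulr_gt0// ge_min lexx orbT.
exists ((1 - th) * al + th * al0), ((1 - th) * t'), (th * r); split.
- have : t' <= `|t'| by exact: ler_norm.
  rewrite /M in thM; have : th * t' <= th * `|t'| by rewrite ler_pM2l// ler_norm.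
  lra.
- move=> y; have e1 : (1 - th) * t' <= (1 - th) * (al * y + beta y).
    by rewrite ler_wpM2l//; lra.
  have := mulr_ge0 (ltW th0) (h0 y); lra.
- by rewrite mulr_gt0.
- move=> x hx; pose z := (x - (1 - th) * al) / th.
  have Cz : C z.
    apply: hr; rewrite /ball_ /= -(ltr_pM2l th0) -{1}(gtr0_norm th0) -normrM.
    rewrite (_ : th * (al0 - z) = - (x - ((1 - th) * al + th * al0))) ?normrN//.
    by rewrite /z; field; rewrite lt0r_neq0.
  have xE : x = (1 - th) * al + th * z by rewrite /z; field; rewrite lt0r_neq0.
  have [zal|alz] := leP z al.
    apply: (Ci z al) => //; rewrite xE; apply/andP; split.
      have : (1 - th) * z <= (1 - th) * al by rewrite ler_wpM2l//; lra.
      lra.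
    have : th * z <= th * al by rewrite ler_pM2l.
    lra.
  apply: (Ci al z) => //; rewrite xE; apply/andP; split.
    have : th * al <= th * z by rewrite ler_pM2l// ltW.
    lra.
  have : (1 - th) * al <= (1 - th) * z by rewrite ler_wpM2l//; lra.
  lra.
Qed.

(** [C] itself replaces its neighbourhoods. The upper bound on the sums holds for every subset of a
    neighbourhood; for the lower bound, [interior_approx] supplies a slope of which a whole
    neighbourhood lies in [C]. *)
Lemma sigma_rad_interval (C : set R) (t : R) : closed C -> is_interval C ->
  interior C `&` neg_deriv_range beta !=set0 ->
  sigma_rad (ze C t) = 1%E <-> t%:E = sup_star C.
Proof.
move=> Cc Ci CI.
have subC r : 0 < r -> C `<=` near_set C r.
  by move=> r0 x Cx; exists x => //; rewrite subrr normr0.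
split=> [h|CE].
  apply/eqP; rewrite eq_le; apply/andP; split; rewrite leNgt; apply/negP => lt.
    have [r [rho [r0 rho0 hr]]] := @sigma_rad_above C t 0 Cc lt (lexx _).
    have := hr C (subC r r0); rewrite !subr0 h lee_fin mulr0 subr0.
    have := expR_ge1Dx rho; lra.
  have [al [t' [r [tt' ht' r0 hr]]]] := interior_approx Ci CI lt.
  pose s := (t' - t) / 2; have s0 : 0 < s by rewrite /s; lra.
  have tst : t + s < t' by rewrite /s; lra.
  have [h1 _] := @sigma_rad_below C al (t + s) t' s r ht' tst (ltW s0) r0 hr.
  rewrite addrK h lee_fin -expR0 ler_expR in h1.
  have : 0 < a * s by rewrite mulr_gt0.
  lra.
have bd e : 0 < e -> ((1 - e)%:E <= sigma_rad (ze C t) <= (1 + e)%:E)%E.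
  move=> /small_shift[s s0 [se1 se2]]; apply/andP; split.
    have [|r [rho [r0 rho0 h]]] := @sigma_rad_above C (t + s) s Cc _ (ltW s0).
      by rewrite -CE lte_fin; lra.
    apply: (@le_trans _ _ (expR (rho - b * s))%:E).
      by rewrite lee_fin; apply: le_trans se2 _; rewrite ler_expR; lra.
    by have := h C (subC r r0); rewrite addrK.
  have lt : ((t - s)%:E < sup_star C)%E by rewrite -CE lte_fin; lra.
  have [al [t' [r [tt' ht' r0 hr]]]] := interior_approx Ci CI lt.
  have [_] := @sigma_rad_below C al (t - s) t' s r ht' tt' (ltW s0) r0 hr.
  by rewrite subrK => /le_trans; apply; rewrite lee_fin.
case E : (sigma_rad (ze C t)) bd => [x| |] bd; last 2 first.
- by have /andP[] := bd 1 ltr01.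
- by have /andP[] := bd 1 ltr01.
congr EFin; apply/eqP; rewrite eq_le; apply/andP; split; rewrite leNgt; apply/negP => lt.
  have /bd : 0 < (x - 1) / 2 by lra.
  by rewrite !lee_fin => /andP[]; lra.
have /bd : 0 < (1 - x) / 2 by lra.
by rewrite !lee_fin => /andP[]; lra.
Qed.

End CriticalExponent.

(** * Quasi-additive sequences *)

Section QuasiAdditive.
Variable R : realType.

(** Expanding [a (m * n)] in both orders shows that [a m / m] and [a n / n] differ by at most
    [c * (1 / m + 1 / n)]; then [m] tends to infinity. *)
Lemma quasi_additive_limit0 (a : nat -> R) (c : R) :
  (forall m n, `|a (m + n)%N - a m - a n| <= c) ->
  limn (fun n => n%:R^-1 * a n) = 0 -> forall n, `|a n| <= c.
Proof.
move=> qa lim0.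
have c0 : 0 <= c by apply: le_trans (qa 0%N 0%N).
have mult m n : `|a (m.+1 * n)%N - m.+1%:R * a n| <= m%:R * c.
  elim: m => [|m IH]; first by rewrite !mul1n mul1r subrr normr0 mul0r.
  rewrite mulSn; have := qa n (m.+1 * n)%N.
  have -> : a (n + m.+1 * n)%N - m.+2%:R * a n =
    (a (n + m.+1 * n)%N - a n - a (m.+1 * n)%N) + (a (m.+1 * n)%N - m.+1%:R * a n).
    by rewrite -natr1; ring.
  move=> h; apply: le_trans (ler_normD _ _) _.
  by rewrite (_ : m.+1%:R * c = c + m%:R * c) ?lerD// -natr1; ring.
have close m n : (0 < m)%N -> (0 < n)%N ->
    `|m%:R^-1 * a m - n%:R^-1 * a n| <= c * (m%:R^-1 + n%:R^-1).
  case: m => // m; case: n => // n _ _.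
  have h1 := mult m n.+1; have h2 := mult n m.+1; rewrite mulnC in h2.
  have m0 : 0 < m.+1%:R :> R by rewrite ltr0n. have n0 : 0 < n.+1%:R :> R by rewrite ltr0n.
  have -> : m.+1%:R^-1 * a m.+1 - n.+1%:R^-1 * a n.+1 =
     ((a (m.+1 * n.+1)%N - m.+1%:R * a n.+1) - (a (m.+1 * n.+1)%N - n.+1%:R * a m.+1))
       / (m.+1%:R * n.+1%:R).
    by set M : R := m.+1%:R in m0 *; set N : R := n.+1%:R in n0 *; field; rewrite !gt_eqF.
  rewrite normrM normfV (ger0_norm (ltW (mulr_gt0 m0 n0))) ler_pdivrMr ?mulr_gt0//.
  apply: le_trans (ler_normB _ _) _.
  have -> : c * (m.+1%:R^-1 + n.+1%:R^-1) * (m.+1%:R * n.+1%:R) = c * (m.+1%:R + n.+1%:R).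
    by set M : R := m.+1%:R in m0 *; set N : R := n.+1%:R in n0 *; field; rewrite !gt_eqF.
  apply: le_trans (lerD h1 h2) _; rewrite -mulrDl mulrC ler_wpM2l//.
  by rewrite lerD// ler_nat.
have small (e : R) : 0 < e -> exists n0, forall n, (n0 <= n)%N -> (0 < n)%N /\ c * n%:R^-1 <= e.
  move=> e0; have [n0 hn0] := nat_large (c / e); exists (maxn 1 n0) => n.
  rewrite geq_max => /andP[n1 nn0]; split=> //.
  rewrite ler_pdivrMr ?ltr0n// mulrC -ler_pdivrMr//; apply: le_trans (ltW hn0) _.
  by rewrite ler_nat.
(* [limn] takes a default value on divergent sequences, so convergence is established before the
   hypothesis on the limit is used. *)
have cv : cvgn (fun n => n%:R^-1 * a n).
  apply/cauchy_cvgP; apply: cauchy_exP => e e0.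
  have e20 : 0 < e / 3 by rewrite divr_gt0.
  have [n0 hn0] := small _ e20.
  exists (n0%:R^-1 * a n0); exists n0.+1 => // n /= n0n.
  have [n1 cn] := hn0 n (ltnW n0n); have [n01 cn0] := hn0 n0 (leqnn _).
  rewrite /ball /=; apply: le_lt_trans (close _ _ n01 n1) _; rewrite mulrDr; lra.
have lim' : (fun n => n%:R^-1 * a n) @ \oo --> (0 : R) by rewrite -lim0.
move=> n; case: n => [|n]; first by have := qa 0%N 0%N; rewrite addn0 subrr sub0r normrN.
have n0 : 0 < n.+1%:R :> R by rewrite ltr0n.
rewrite -(ler_pM2l (_ : 0 < n.+1%:R^-1)) ?invr_gt0// -{1}(ger0_norm (ltW n0)) -normfV -normrM.
apply/ler_addgt0Pr => e e0.
have e20 : 0 < e / 2 by rewrite divr_gt0.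
have [n1 hn1] := small _ e20.
have /cvgrPdist_le /(_ _ e20) [n2 _ hn2] := lim'.
have [m1 cm] := hn1 (maxn n1 n2) (leq_maxl _ _).
have := hn2 (maxn n1 n2) (leq_maxr _ _); rewrite sub0r normrN => h1.
have := close n.+1 _ isT m1; rewrite mulrDr => h2.
have := ler_normD (n.+1%:R^-1 * a n.+1 - (maxn n1 n2)%:R^-1 * a (maxn n1 n2))
  ((maxn n1 n2)%:R^-1 * a (maxn n1 n2)).
rewrite subrK [n.+1%:R^-1 * c]mulrC.
move: h1 h2 cm; set p := _^-1 * a (maxn _ _); set q := n.+1%:R^-1 * a _; set r := c / _.
by set s := c / n.+1%:R; lra.
Qed.

Lemma sup_between (A : set R) (l u : R) : A !=set0 ->
  (forall x, A x -> l <= x <= u) -> l <= sup A <= u.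
Proof.
move=> [x Ax] h; apply/andP; split.
  have /andP[lx _] := h x Ax; apply: le_trans lx _; apply: sup_upper_bound => //.
  by split; [exists x|exists u => y /h /andP[]].
by apply: ge_sup; [exists x|move=> y /h /andP[]].
Qed.

End QuasiAdditive.

(** * Conformal geometry *)

Section EuclideanNorm.
Variables (R : realType) (d : nat).
Implicit Types (u v x y z : 'rV[R]_d) (A : set 'rV[R]_d).

Definition dot u v : R := \sum_j u ord0 j * v ord0 j.

Lemma enorm_sq u : enorm u ^+ 2 = dot u u.
Proof.
rewrite /enorm sqr_sqrtr; first by apply: eq_bigr => j _; rewrite expr2.
by apply: sumr_ge0 => j _; rewrite sqr_ge0.
Qed.

Lemma enorm_ge0 u : 0 <= enorm u. Proof. exact: sqrtr_ge0. Qed.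

Lemma dotC u v : dot u v = dot v u.
Proof. by apply: eq_bigr => j _; rewrite mulrC. Qed.

Lemma dotDl u v w : dot (u + v) w = dot u w + dot v w.
Proof. by rewrite /dot -big_split; apply: eq_bigr => j _; rewrite mxE mulrDl. Qed.

Lemma dotZl a u w : dot (a *: u) w = a * dot u w.
Proof. by rewrite /dot mulr_sumr; apply: eq_bigr => j _; rewrite mxE mulrA. Qed.

Lemma dotBl u v w : dot (u - v) w = dot u w - dot v w.
Proof. by rewrite dotDl -scaleN1r dotZl mulN1r. Qed.

Lemma enorm0 : enorm (0 : 'rV[R]_d) = 0.
Proof.
by rewrite /enorm big1 ?sqrtr0// => j _; rewrite mxE expr0n.
Qed.

Lemma enormZ a u : enorm (a *: u) = `|a| * enorm u.
Proof.
rewrite /enorm -sqrtr_sqr -sqrtrM ?sqr_ge0//; congr Num.sqrt.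
by rewrite mulr_sumr; apply: eq_bigr => j _; rewrite mxE exprMn.
Qed.

Lemma enormN u : enorm (- u) = enorm u.
Proof. by rewrite -scaleN1r enormZ normrN normr1 mul1r. Qed.

Lemma enormB x y : enorm (x - y) = enorm (y - x).
Proof. by rewrite -enormN opprB. Qed.

Lemma coord_le_enorm u j : `|u ord0 j| <= enorm u.
Proof.
rewrite -sqrtr_sqr /enorm ler_sqrt; last by apply: sumr_ge0 => i _; rewrite sqr_ge0.
by rewrite (bigD1 j)//= lerDl sumr_ge0// => i _; rewrite sqr_ge0.
Qed.

Lemma enorm_eq0 u : enorm u = 0 -> u = 0.
Proof.
move=> u0; apply/rowP => j; rewrite mxE; apply/eqP.
by rewrite -normr_le0 -u0 coord_le_enorm.
Qed.

Lemma enorm_gt0 u : u != 0 -> 0 < enorm u.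
Proof.
move=> u0; rewrite lt_neqAle enorm_ge0 andbT eq_sym.
by apply: contraNneq u0 => /enorm_eq0 ->.
Qed.

(** Cauchy-Schwarz, by expanding the squared norm of [enorm v ^+ 2 *: u - dot u v *: v]. *)
Lemma dot_le u v : `|dot u v| <= enorm u * enorm v.
Proof.
have [v0|v0] := eqVneq (enorm v) 0.
  rewrite v0 mulr0 (enorm_eq0 v0) /dot big1 ?normr0// => j _.
  by rewrite mxE mulr0.
have vv : 0 < enorm v ^+ 2 by rewrite exprn_even_gt0.
have := sqr_ge0 (enorm (enorm v ^+ 2 *: u - dot u v *: v)).
rewrite (enorm_sq (_ - _)) dotBl !dotZl ![dot _ (_ - _)]dotC !dotBl !dotZl -!enorm_sq (dotC v u).
set V := enorm v; set U := enorm u; set D := dot u v => h.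
have : 0 <= V ^+ 2 * ((U * V) ^+ 2 - D ^+ 2) by lra.
rewrite pmulr_rge0// subr_ge0 => h2.
rewrite leNgt; apply/negP => h3; move: h2; rewrite leNgt => /negP; apply.
have UV : 0 <= U * V by rewrite mulr_ge0 ?enorm_ge0.
by rewrite -(real_normK (num_real D)) ltrXn2r.
Qed.

Lemma ler_enormD u v : enorm (u + v) <= enorm u + enorm v.
Proof.
have h : enorm (u + v) ^+ 2 <= (enorm u + enorm v) ^+ 2.
  rewrite enorm_sq dotDl ![dot _ (_ + _)]dotC !dotDl -!enorm_sq (dotC v u).
  by have := le_trans (ler_norm _) (dot_le u v); lra.
by rewrite -(@ler_pXn2r _ 2)// nnegrE ?addr_ge0 ?enorm_ge0.
Qed.

Lemma enorm_dist y x z : enorm (x - z) <= enorm (x - y) + enorm (y - z).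
Proof. by apply: le_trans (ler_enormD _ _); rewrite addrA subrK. Qed.

Lemma enorm_sub_le u v : `|enorm u - enorm v| <= enorm (u - v).
Proof.
have h1 := ler_enormD (u - v) v; have h2 := ler_enormD (v - u) u.
rewrite !subrK in h1 h2; have h3 := enormB u v.
by rewrite ler_norml; apply/andP; split; lra.
Qed.

Lemma norm_le_enorm u : `|u| <= enorm u.
Proof.
rewrite [`|u|]mx_normrE; apply: bigmax_le => [|[i j] _ /=]; first exact: enorm_ge0.
by rewrite ord1; exact: coord_le_enorm.
Qed.

Lemma enorm_le_norm u : enorm u <= d%:R * `|u|.
Proof.
have cj j : `|u ord0 j| <= `|u|.
  by rewrite [`|u|]mx_normrE; exact: (le_bigmax _ (fun ij => `|u ij.1 ij.2|) (ord0, j)).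
rewrite -(@ler_pXn2r _ 2) ?nnegrE ?enorm_ge0 ?mulr_ge0// enorm_sq.
apply: (@le_trans _ _ (\sum_(j < d) `|u| ^+ 2)).
  apply: ler_sum => j _; rewrite -expr2 -real_normK ?num_real//.
  by rewrite ler_pXn2r ?nnegrE.
rewrite sumr_const card_ord exprMn -[X in X <= _]mulr_natl ler_wpM2r ?sqr_ge0//.
by rewrite -natrX ler_nat; case: d => // n; rewrite expnS expn1 leq_pmull.
Qed.

Lemma nbhs_eballP x A : nbhs x A <-> exists2 r : R, 0 < r & eball x r `<=` A.
Proof.
split=> [/nbhs_normP[r /= r0 h]|[r r0 h]].
  exists r => // y; rewrite /eball /= => yx; apply: h; rewrite /ball_ /=.
  by rewrite distrC; apply: le_lt_trans yx; exact: norm_le_enorm.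
apply: (proj2 (nbhs_normP x A)); have d0 : 0 < d%:R + 1 :> R by rewrite ltr_wpDl.
exists (r / (d%:R + 1)) => /=; first by rewrite divr_gt0.
move=> y; rewrite /ball_ /= => yx; apply: h; rewrite /eball /=.
apply: le_lt_trans (enorm_le_norm _) _; rewrite distrC.
apply: (@le_lt_trans _ _ ((d%:R + 1) * `|x - y|)); first by rewrite ler_wpM2r//; lra.
by rewrite mulrC -ltr_pdivlMr.
Qed.

Lemma open_eballP A : open A <-> forall x, A x -> exists2 r : R, 0 < r & eball x r `<=` A.
Proof. by rewrite openE; split=> h x /h /nbhs_eballP. Qed.

Lemma eball_center x (r : R) : 0 < r -> eball x r x.
Proof. by move=> r0; rewrite /eball /= subrr enorm0. Qed.

Lemma eball_open x (r : R) : open (eball x r).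
Proof.
apply/open_eballP => y; rewrite /eball /= => yr.
exists (r - enorm (y - x)); first by rewrite subr_gt0.
by move=> z /=; have := enorm_dist y z x; lra.
Qed.

Lemma enorm_continuous : continuous (@enorm R d).
Proof.
move=> x B /= /nbhs_normP[e /= e0 hB]; apply/nbhs_eballP; exists e => // y xy.
by apply: hB; rewrite /ball_ /= distrC; exact: le_lt_trans (enorm_sub_le _ _) xy.
Qed.

(* The differential, sealed: unification must never unfold it. *)
Fact jac_exists : {j : ('rV[R]_d -> 'rV[R]_d) -> 'rV[R]_d -> 'rV[R]_d -> 'rV[R]_d |
  forall f x u, j f x u = 'd f x u}.
Proof. by exists (fun f x u => 'd f x u). Qed.

Definition jac := sval jac_exists.

Lemma jacE f x u : jac f x u = 'd f x u.
Proof. exact: (svalP jac_exists). Qed.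

Lemma jac_fun f x : jac f x = (fun u => 'd f x u).
Proof. by apply/funext => u; rewrite jacE. Qed.

Lemma jacZ f x (a : R) u : jac f x (a *: u) = a *: jac f x u.
Proof. by rewrite !jacE linearZ. Qed.

Lemma differentiable_eps (f : 'rV[R]_d -> 'rV[R]_d) x (e : R) :
  differentiable f x -> 0 < e -> exists2 r : R, 0 < r & forall y, enorm (y - x) < r ->
    enorm (f y - f x - jac f x (y - x)) <= e * enorm (y - x).
Proof.
move=> df e0; rewrite jac_fun; have d0 : 0 < d%:R + 1 :> R by rewrite ltr_wpDl.
have e'0 : 0 < e / (d%:R + 1) by rewrite divr_gt0.
have [_ /eqaddoP /(_ _ e'0) /nbhs_eballP[r r0 h]] := (diff_locallyP x f).1 df.
exists r => // y yx; have /= := h (y - x).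
rewrite /eball /= subr0 => /(_ yx); rewrite !fctE subrK opprD addrA => h1.
apply: le_trans (enorm_le_norm _) _.
apply: (@le_trans _ _ ((d%:R + 1) * `|f y - f x - 'd f x (y - x)|)).
  by rewrite ler_wpM2r//; lra.
apply: (@le_trans _ _ ((d%:R + 1) * (e / (d%:R + 1) * `|y - x|))); first by rewrite ler_pM2l.
rewrite mulrA [(d%:R + 1) * _]mulrC mulrVK ?unitfE ?gt_eqF// ler_pM2l//.
exact: norm_le_enorm.
Qed.

Lemma slope_is_derive (h : R -> R) (s l : R) : (forall e : R, 0 < e -> exists2 r : R, 0 < r &
    forall t : R, `|t| < r -> `|h (s + t) - h s - l * t| <= e * `|t|) ->
  is_derive s (1 : R) h l.
Proof.
move=> hs.
have cv : (fun t : R => t^-1 *: ((h \o shift s) (t *: (1 : R)) - h s)) @ 0^' --> l.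
  apply/cvgrPdist_le => e e0; have [r r0 hr] := hs e e0; near=> t.
  have t0 : t != 0 by near: t; exact: nbhs_dnbhs_neq.
  have tr : `|t| < r.
    near: t; apply: (@nbhs_dnbhs _ (0 : R)); apply/nbhs_normP; exists r => //= y.
    by rewrite /ball_ /= sub0r normrN.
  have := hr t tr; rewrite (addrC s t) /= => h1.
  rewrite -(ler_pM2r (_ : 0 < `|t|)) ?normr_gt0// -normrM.
  rewrite /GRing.scale /= mulr1 (_ : _ * t = - (h (t + s) - h s - l * t)); last by field.
  by rewrite normrN.
apply: DeriveDef; first by apply/cvg_ex; exists l.
by rewrite /derive; apply: cvg_lim.
Unshelve. all: end_near. Qed.

(* Reduced to one variable by taking the inner product with the error vector. *)
Lemma mean_value (f A : 'rV[R]_d -> 'rV[R]_d) x v (M : R) :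
  (forall (a : R) u, A (a *: u) = a *: A u) ->
  (forall s : R, 0 <= s <= 1 -> differentiable f (x + s *: v)) ->
  (forall s : R, 0 <= s <= 1 -> enorm (jac f (x + s *: v) v - A v) <= M) ->
  enorm (f (x + v) - f x - A v) <= M.
Proof.
move=> Alin df dM; set e := f (x + v) - f x - A v.
have [->|e0] := eqVneq e 0.
  rewrite enorm0; apply: le_trans (dM 0 _); first exact: enorm_ge0.
  by rewrite lexx ler01.
pose h s := dot (f (x + s *: v) - s *: A v) e.
pose dh s := dot (jac f (x + s *: v) v - A v) e.
have e1 := enorm_gt0 e0.
have hd (s : R) : 0 <= s <= 1 -> is_derive s (1 : R) h (dh s).
  move=> s01; apply: slope_is_derive => eps eps0.
  have K0 : 0 < (enorm v + 1) * (enorm e + 1) by rewrite mulr_gt0// ltr_wpDl ?enorm_ge0.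
  have [r r0 hr] := differentiable_eps (df s s01) (divr_gt0 eps0 K0).
  have v1 : 0 < enorm v + 1 by rewrite ltr_wpDl ?enorm_ge0.
  exists (r / (enorm v + 1)); first by rewrite divr_gt0.
  move=> t; rewrite ltr_pdivlMr// => tr.
  have tv : `|t| * enorm v < r by apply: le_lt_trans tr; rewrite ler_wpM2l//; lra.
  rewrite /h /dh; set z := x + s *: v.
  have zt : x + (s + t) *: v = z + t *: v by rewrite scalerDl addrA.
  have := hr (z + t *: v); rewrite addrAC subrr add0r enormZ => /(_ tv) h1.
  rewrite zt -dotBl (mulrC _ t) -dotZl -dotBl.
  rewrite (_ : _ - t *: _ = f (z + t *: v) - f z - jac f z (t *: v)); last first.
    have vec (a b c y : 'rV[R]_d) :
      a - (s + t) *: b - (c - s *: b) - t *: (y - b) = a - c - t *: y.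
      by apply/rowP => j; rewrite !mxE; ring.
    rewrite vec; congr (_ - _); exact/esym/jacZ.
  apply: le_trans (dot_le _ _) _.
  apply: le_trans (ler_wpM2r (enorm_ge0 _) h1) _.
  have ev1 : 0 < enorm e + 1 by lra.
  set k := eps / _; have k0 : 0 < k by rewrite divr_gt0.
  apply: (@le_trans _ _ (k * (`|t| * (enorm v + 1)) * (enorm e + 1))).
    apply: ler_pM; [|exact: enorm_ge0| |lra].
      by apply: mulr_ge0; [exact: ltW|rewrite mulr_ge0 ?enorm_ge0].
    by rewrite ler_pM2l// ler_wpM2l//; lra.
  by rewrite le_eqVlt; apply/orP; left; apply/eqP; rewrite /k; field; rewrite !gt_eqF.
have [||s s01 hs] := @MVT R h dh 0 1 ltr01.
- by move=> s; rewrite in_itv /= => /andP[s0 s1]; apply: hd; rewrite !ltW.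
- apply: derivable_within_continuous => s; rewrite in_itv /= => /hd hs; exact: ex_derive.
have : h 1 - h 0 = enorm e ^+ 2.
  by rewrite /h scale1r scale0r scale0r addr0 subr0 -dotBl scale1r enorm_sq addrAC.
rewrite hs subr0 mulr1 => h2.
rewrite in_itv /= in s01; have {}s01 : 0 <= s <= 1 by case/andP: s01 => *; rewrite !ltW.
have h3 : enorm e ^+ 2 <= M * enorm e.
  rewrite -h2; apply: le_trans (ler_norm _) _; apply: le_trans (dot_le _ _) _.
  by rewrite ler_wpM2r ?enorm_ge0//; exact: dM.
by move: h3; rewrite expr2 ler_pM2r.
Qed.

(** [opnorm] is a real supremum, which says nothing about an unbounded set; the a priori bound [B]
    excludes that case. *)
Lemma opnorm_le (A : 'rV[R]_d -> 'rV[R]_d) (B M : R) :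
  (forall (a : R) u, A (a *: u) = a *: A u) -> (forall u, enorm (A u) <= B * enorm u) ->
  0 <= B -> opnorm A <= M -> forall u, enorm (A u) <= M * enorm u.
Proof.
move=> AZ AB B0 hM u; have [->|u0] := eqVneq u 0.
  by rewrite -(scale0r (0 : 'rV[R]_d)) AZ !scale0r enorm0 mulr0.
have e0 := enorm_gt0 u0; pose v := (enorm u)^-1 *: u.
have v1 : enorm v = 1 by rewrite enormZ ger0_norm ?invr_ge0 ?ltW// mulVf// gt_eqF.
have uE : u = enorm u *: v by rewrite scalerA mulfV ?scale1r// gt_eqF.
have h : enorm (A v) <= M.
  apply: le_trans hM; apply: sup_upper_bound; last by exists v => //=; rewrite v1.
  split; first by exists (enorm (A v)), v => //=; rewrite v1.
  exists B => _ [w /= w1 <-]; apply: le_trans (AB w) _.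
  by rewrite ler_piMr.
by rewrite {1}uE AZ enormZ ger0_norm ?enorm_ge0// mulrC ler_pM2r.
Qed.

End EuclideanNorm.

Section CompactUniform.
Variables (R : realType) (T : topologicalType).

(** Passage from local to global constants. A single integer [k] encodes both how small a radius and
    how large a constant may be, so that one compactness argument serves all the uniform
    estimates. *)
Lemma compact_uniform (X : set T) (P : nat -> T -> Prop) : compact X ->
  (forall k k' x, (k <= k')%N -> P k x -> P k' x) ->
  (forall x, X x -> exists k, \forall y \near x, P k y) ->
  exists k, forall x, X x -> P k x.
Proof.
move=> /compact_near_coveringP cX mono loc.
have [|k _ hk] := cX nat (\oo) P _ _.
  move=> x /loc[k hk]; exists ([set y | P k y], [set n | (k <= n)%N]).
    by split=> //=; exists k.
  by move=> [y n] /= [h1 h2]; exact: mono h1.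
by exists k => x Xx; apply: (hk k) => //=.
Qed.

End CompactUniform.

Section ConformalGeometry.
Variables (R : realType) (d N : nat) (gamma : R) (V X K : set 'rV[R]_d).
Variable (S : 'I_N -> 'rV[R]_d -> 'rV[R]_d).
Hypothesis d_gt0 : (0 < d)%N.
Hypothesis hgamma : 0 < gamma < 1.
Hypothesis hS : conformal_ifs gamma V X S.
Hypothesis hK : self_conformal_set X S K.
Hypothesis N_gt0 : (0 < N)%N.
Implicit Types (w : seq 'I_N) (x y z : 'rV[R]_d).

Let Vopen := cifs_open hS.
Let XV := cifs_sub hS.
Let Xcompact := cifs_compact hS.
Let gamma_gt0 : 0 < gamma. Proof. by case/andP: hgamma. Qed.

Lemma unit_vector_ex : exists u : 'rV[R]_d, enorm u = 1.
Proof.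
have v0 : (const_mx 1 : 'rV[R]_d) != 0.
  apply/eqP => /rowP /(_ (Ordinal d_gt0)); rewrite !mxE => /eqP.
  by rewrite oner_eq0.
exists ((enorm (const_mx 1 : 'rV[R]_d))^-1 *: const_mx 1).
rewrite enormZ ger0_norm ?invr_ge0 ?enorm_ge0// mulVf// gt_eqF//.
exact: enorm_gt0.
Qed.

Definition deriv_ratio i x : R := opnorm (jac (S i) x).

Lemma opnorm_jac f x : opnorm ('d f x) = opnorm (jac f x).
Proof. by rewrite jac_fun. Qed.

Lemma jac_conformal i x : V x -> exists r : R, [/\ 0 < r, r < 1 &
  forall u : 'rV[R]_d, enorm (jac (S i) x u) = r * enorm u].
Proof.
move=> /(cifs_conformal hS i)[r [r0 r1 h]]; exists r; split=> // u.
have := jacZ (S i) x 0 0; rewrite !scale0r => j0.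
have : enorm (jac (S i) x u - jac (S i) x 0) = r * enorm (u - 0) by rewrite !jacE; exact: h.
by rewrite j0 !subr0.
Qed.

Lemma deriv_ratioP i x : V x -> [/\ 0 < deriv_ratio i x, deriv_ratio i x < 1 &
  forall u : 'rV[R]_d, enorm (jac (S i) x u) = deriv_ratio i x * enorm u].
Proof.
move=> /(jac_conformal i)[r [r0 r1 h]]; rewrite /deriv_ratio.
move: (jac (S i) x) h => A h.
suff -> : opnorm A = r by [].
have [u1 hu1] := unit_vector_ex.
apply/eqP; rewrite eq_le; apply/andP; split.
  apply: ge_sup; first by exists (enorm (A 0)), 0 => //=; rewrite enorm0.
  by move=> _ [u /= ule <-]; rewrite h ler_piMr// ltW.
apply: sup_upper_bound; last by exists u1; rewrite /= ?hu1// h hu1 mulr1.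
split; first by exists (enorm (A 0)), 0 => //=; rewrite enorm0.
by exists r => _ [u /= ule <-]; rewrite h ler_piMr// ltW.
Qed.

Lemma opnormB_ub i x y (M : R) : V x -> V y ->
  opnorm (fun u => 'd (S i) x u - 'd (S i) y u) <= M ->
  forall u : 'rV[R]_d, enorm (jac (S i) x u - jac (S i) y u) <= M * enorm u.
Proof.
have -> : (fun u : 'rV[R]_d => 'd (S i) x u - 'd (S i) y u) =
  (fun u => jac (S i) x u - jac (S i) y u) by apply/funext => u; rewrite !jacE.
move=> Vx Vy; have [rx0 _ hx] := deriv_ratioP i Vx.
have [ry0 _ hy] := deriv_ratioP i Vy.
apply: (@opnorm_le _ _ _ (deriv_ratio i x + deriv_ratio i y)).
- by move=> a u; rewrite !jacZ scalerBr.
- move=> u; apply: le_trans (ler_enormD _ _) _.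
  by rewrite enormN hx hy mulrDl.
- by rewrite addr_ge0 ?ltW.
Qed.

Lemma powR_gamma_ge0 (t : R) : 0 <= t `^ gamma. Proof. exact: powR_ge0. Qed.

Lemma holder_uniform : exists e H : R, [/\ 0 < e, 0 < H & forall i x z, X x ->
  enorm (z - x) < e -> V z /\ forall u : 'rV[R]_d,
    enorm (jac (S i) z u - jac (S i) x u) <= H * enorm (z - x) `^ gamma * enorm u].
Proof.
pose P (k : nat) x := forall i z, enorm (z - x) < k.+1%:R^-1 -> V z /\ (V x ->
  forall u : 'rV[R]_d,
    enorm (jac (S i) z u - jac (S i) x u) <= k%:R * enorm (z - x) `^ gamma * enorm u).
have hP k k' x : (k <= k')%N -> P k x -> P k' x.
  move=> kk h i z zx; have [|Vz hz] := h i z.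
    apply: lt_le_trans zx _; rewrite lef_pV2 ?posrE ?ltr0n// ler_nat ltnS //.
  split=> // Vx u; apply: le_trans (hz Vx u) _.
  by rewrite ler_wpM2r ?enorm_ge0// ler_wpM2r ?powR_gamma_ge0// ler_nat.
have [k hk] : exists k, forall x, X x -> P k x.
  apply: compact_uniform => // x0 Xx0.
  have /nbhs_eballP[r0 r00 hr0] : nbhs x0 V by apply: open_nbhs_nbhs; split=> //; exact: XV.
  have loc i : exists k : nat, forall x z, enorm (x - x0) < k.+1%:R^-1 ->
     enorm (z - x0) < k.+1%:R^-1 -> [/\ V x, V z & forall u : 'rV[R]_d,
       enorm (jac (S i) z u - jac (S i) x u) <= k%:R * enorm (z - x) `^ gamma * enorm u].
    have [[_ hol] _ _] := cifs_diffeo hS i.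
    have [c [W [/nbhs_eballP[r1 r10 hr1] hW]]] := hol x0 (XV Xx0).
    have [k1 hk1] := nat_large (Num.min r0 r1)^-1.
    have [k2 hk2] := nat_large c.
    exists (maxn k1 k2) => x z xx0 zx0.
    have m0 : 0 < Num.min r0 r1 by rewrite lt_min r00.
    have kr : (maxn k1 k2).+1%:R^-1 <= Num.min r0 r1.
      rewrite -[leRHS]invrK lef_pV2 ?posrE ?invr_gt0 ?ltr0n//.
      apply: le_trans (ltW hk1) _; rewrite ler_nat ltnW// ltnS leq_maxl//.
    have kr0 : (maxn k1 k2).+1%:R^-1 <= r0 by apply: le_trans kr _; rewrite ge_min lexx.
    have kr1 : (maxn k1 k2).+1%:R^-1 <= r1 by apply: le_trans kr _; rewrite ge_min lexx orbT.
    have Vx : V x by apply: hr0; exact: lt_le_trans kr0.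
    have Vz : V z by apply: hr0; exact: lt_le_trans kr0.
    split=> // u; apply: opnormB_ub => //.
    apply: le_trans (hW z x _ _) _.
    - by apply: hr1; exact: lt_le_trans kr1.
    - by apply: hr1; exact: lt_le_trans kr1.
    rewrite ler_wpM2r ?powR_gamma_ge0//; apply: le_trans (ltW hk2) _.
    by rewrite ler_nat leq_maxr.
  have [f hf] := choice loc.
  (* The factor 2 keeps [z], which is only known to be close to [x], in the neighbourhood of [x0]
     too. *)
  pose k := (2 * \max_i f i).+1.
  exists k; apply/nbhs_eballP; exists k.+1%:R^-1; first by rewrite invr_gt0 ltr0n.
  move=> x /=; rewrite /eball /= => xx0 i z zx.
  have fi : (f i <= \max_i f i)%N by exact: leq_bigmax.
  have kf : 2 * k.+1%:R^-1 <= (f i).+1%:R^-1 :> R.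
    rewrite ler_pdivrMr ?ltr0n// mulrC ler_pdivlMr ?ltr0n//.
    rewrite -natrM ler_nat /k; lia.
  have fpos : 0 < k.+1%:R^-1 :> R by rewrite invr_gt0 ltr0n.
  set q : R := k.+1%:R^-1 in kf fpos xx0 zx *.
  set F : R := (f i).+1%:R^-1 in kf *.
  have [||Vx Vz h] := hf i x z; rewrite -?/F.
  - lra.
  - have := enorm_dist x z x0; lra.
  split=> // _ u; apply: le_trans (h u) _.
  rewrite ler_wpM2r ?enorm_ge0// ler_wpM2r ?powR_gamma_ge0// ler_nat /k; lia.
exists k.+1%:R^-1, k.+1%:R; split; rewrite ?invr_gt0 ?ltr0n// => i x z Xx zx.
have [Vz h] := hk x Xx i z zx; split=> // u; apply: le_trans (h (XV Xx) u) _.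
by rewrite ler_wpM2r ?enorm_ge0// ler_wpM2r ?powR_gamma_ge0// ler_nat.
Qed.

Lemma deriv_ratio_bounds : exists m M : R, [/\ 0 < m, M < 1 &
  forall i x, X x -> m <= deriv_ratio i x <= M].
Proof.
have [e [H [e0 H0 hol]]] := holder_uniform.
pose P (k : nat) x := forall i, V x -> k.+2%:R^-1 <= deriv_ratio i x <= 1 - k.+2%:R^-1.
have [k hk] : exists k, forall x, X x -> P k x.
  apply: compact_uniform => //.
    move=> k k' x kk h i Vx; have /andP[h1 h2] := h i Vx.
    have : k'.+2%:R^-1 <= k.+2%:R^-1 :> R by rewrite lef_pV2 ?posrE ?ltr0n// ler_nat.
    move=> h3; apply/andP; split; first exact: le_trans h3 h1.
    by apply: le_trans h2 _; rewrite lerB.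
  move=> x0 Xx0.
  have loc i : exists k : nat, forall z, enorm (z - x0) < k.+1%:R^-1 ->
     V z /\ k.+2%:R^-1 <= deriv_ratio i z <= 1 - k.+2%:R^-1.
    have Vx0 := XV Xx0; have [r0 r1 hr] := deriv_ratioP i Vx0.
    set r := deriv_ratio i x0 in r0 r1 hr.
    pose q := Num.min r (1 - r) / 2.
    have m0 : 0 < Num.min r (1 - r) by rewrite lt_min r0 subr_gt0.
    have q0 : 0 < q by rewrite divr_gt0.
    have qr : q <= r / 2 by rewrite ler_pM2r// ge_min lexx.
    have qr1 : q <= (1 - r) / 2 by rewrite ler_pM2r// ge_min lexx orbT.
    pose t := (q / H) `^ gamma^-1.
    have t0 : 0 < t by rewrite powR_gt0// divr_gt0.
    have [k1 hk1] := nat_large (Num.min e t)^-1; have [k2 hk2] := nat_large q^-1.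
    have met0 : 0 < Num.min e t by rewrite lt_min e0.
    exists (maxn k1 k2) => z zx.
    have kr : (maxn k1 k2).+1%:R^-1 <= Num.min e t.
      rewrite -[leRHS]invrK lef_pV2 ?posrE ?invr_gt0 ?ltr0n//.
      by apply: le_trans (ltW hk1) _; rewrite ler_nat ltnW// ltnS leq_maxl.
    have ze : enorm (z - x0) < e by apply: lt_le_trans zx (le_trans kr _); rewrite ge_min lexx.
    have zt : enorm (z - x0) <= t.
      by apply: le_trans (ltW zx) (le_trans kr _); rewrite ge_min lexx orbT.
    have [Vz hz] := hol i x0 z Xx0 ze; split=> //.
    have [u u1] := unit_vector_ex.
    have [_ _ hrz] := deriv_ratioP i Vz.
    have h1 : `|deriv_ratio i z - r| <= q.
      move: (hz u) (hrz u) (hr u); move: (jac (S i) z u) (jac (S i) x0 u) => A B.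
      rewrite u1 !mulr1 => h2 <- <-; apply: le_trans (enorm_sub_le _ _) _.
      apply: le_trans h2 _.
      rewrite mulrC -ler_pdivlMr//.
      have : enorm (z - x0) `^ gamma <= t `^ gamma.
        by apply: ge0_ler_powR => //; rewrite ?nnegrE ?enorm_ge0 ?(ltW t0) ?(ltW gamma_gt0).
      by rewrite /t -powRrM mulVf ?powRr1 ?gt_eqF// divr_ge0// ltW.
    have h2 : (maxn k1 k2).+2%:R^-1 <= q.
      rewrite -[leRHS]invrK lef_pV2 ?posrE ?invr_gt0 ?ltr0n//.
      by apply: le_trans (ltW hk2) _; rewrite ler_nat 2?ltnW// !ltnS leq_maxr.
    move: h1; rewrite ler_norml => /andP[h3 h4].
    set y : R := (maxn k1 k2).+2%:R^-1 in h2 *; apply/andP; split; lra.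
  have [f hf] := choice loc.
  pose k := (\max_i f i); exists k; apply/nbhs_eballP.
  exists k.+1%:R^-1; first by rewrite invr_gt0 ltr0n.
  move=> x /=; rewrite /eball /= => xx0 i _.
  have fi : (f i <= k)%N by exact: leq_bigmax.
  have [|_ /andP[h1 h2]] := hf i x.
    by apply: lt_le_trans xx0 _; rewrite lef_pV2 ?posrE ?ltr0n// ler_nat.
  have : k.+2%:R^-1 <= (f i).+2%:R^-1 :> R by rewrite lef_pV2 ?posrE ?ltr0n// ler_nat.
  move=> h3; apply/andP; split; first exact: le_trans h3 h1.
  by apply: le_trans h2 _; rewrite lerB.
exists k.+2%:R^-1, (1 - k.+2%:R^-1); split.
- by rewrite invr_gt0 ltr0n.
- by rewrite ltrBlDr ltrDl invr_gt0 ltr0n.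
- by move=> i x Xx; apply: hk => //; exact: XV.
Qed.

Lemma contraction_uniform : exists c : R, [/\ 0 < c, c < 1 &
  forall i x y, V x -> V y -> enorm (S i x - S i y) <= c * enorm (x - y)].
Proof.
have [f hf] := choice (cifs_contractive hS).
have h i : exists k : nat, f i <= 1 - k.+2%:R^-1.
  have [f1 _] := hf i; have [k hk] := nat_large (1 - f i)^-1; exists k.
  have : k.+2%:R^-1 <= 1 - f i.
    rewrite -[leRHS]invrK lef_pV2 ?posrE ?invr_gt0 ?ltr0n ?subr_gt0//.
    by apply: le_trans (ltW hk) _; rewrite ler_nat; lia.
  by set q := _^-1; lra.
have [g hg] := choice h; pose k := \max_i g i.
exists (1 - k.+2%:R^-1); split.
- by rewrite subr_gt0 invf_lt1 ?ltr0n// ltr1n.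
- by rewrite ltrBlDr ltrDl invr_gt0 ltr0n.
- move=> i x y Vx Vy; have [_ h1] := hf i; apply: le_trans (h1 x y Vx Vy) _.
  rewrite ler_wpM2r ?enorm_ge0//; apply: le_trans (hg i) _; rewrite lerB//.
  by rewrite lef_pV2 ?posrE ?ltr0n// ler_nat !ltnS leq_bigmax.
Qed.

Lemma Scomp_cat w w' x : Scomp S (w ++ w') x = Scomp S w (Scomp S w' x).
Proof. by rewrite /Scomp foldr_cat. Qed.

Lemma Scomp_X w x : X x -> X (Scomp S w x).
Proof.
move=> Xx; elim: w => //= i w IH; apply: (cifs_invariant hS (i := i)).
by exists (Scomp S w x).
Qed.

Lemma Scomp_V w x : V x -> V (Scomp S w x).
Proof.
move=> Vx; elim: w => //= i w IH; apply: (cifs_self hS (i := i)).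
by exists (Scomp S w x).
Qed.

Lemma K_sub_X : K `<=` X. Proof. by case: hK. Qed.

Lemma Scomp_K w x : K x -> K (Scomp S w x).
Proof.
move=> Kx; elim: w => //= i w IH; case: hK => _ _ _ ->.
by exists i => //; exists (Scomp S w x).
Qed.

Lemma X_bounded : exists D : R, 0 < D /\ forall x y, X x -> X y -> enorm (x - y) <= D.
Proof.
have [k hk] : exists k : nat, forall x, X x -> enorm x <= k%:R.
  apply: compact_uniform => // [k k' x kk h|x Xx]; first by apply: le_trans h _; rewrite ler_nat.
  have [k hk] := nat_large (enorm x + 1); exists k; apply/nbhs_eballP; exists 1 => // y.
  rewrite /eball /= => yx; have := ler_enormD (y - x) x; rewrite subrK; lra.
exists (2 * k%:R + 1); split; first by rewrite ltr_wpDl// mulr_ge0.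
move=> x y /hk hx /hk hy; apply: le_trans (ler_enormD _ _) _; rewrite enormN.
have := ler0n R k; lra.
Qed.

(* Logarithm of the conformal factor of [S_w] at [x]. *)
Fixpoint lr w x : R :=
  if w is i :: w' then ln (deriv_ratio i (Scomp S w' x)) + lr w' x else 0.

Lemma lr_cat w w' x : lr (w ++ w') x = lr w (Scomp S w' x) + lr w' x.
Proof. by elim: w => [|i w IH] /=; rewrite ?add0r// IH Scomp_cat addrA. Qed.

Lemma lr_bounds : exists a b : R, [/\ 0 < a, 0 <= b &
  forall w x, X x -> - b * (size w)%:R <= lr w x <= - a * (size w)%:R].
Proof.
have [m [M [m0 M1 h]]] := deriv_ratio_bounds.
have [x0 Kx0] : K !=set0 by case: hK.
have i0 := Ordinal N_gt0.
have Xx0 := K_sub_X Kx0.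
have M0 : 0 < M by have /andP[h1 h2] := h i0 _ Xx0; lra.
have m1 : m < 1 by have /andP[h1 h2] := h i0 _ Xx0; lra.
exists (- ln M), (- ln m); split.
- by rewrite oppr_gt0 ln_lt0// M0.
- by rewrite oppr_ge0 ltW// ln_lt0// m0.
move=> w x Xx; rewrite !opprK; elim: w => [|i w /andP[IH1 IH2]] /=; first by rewrite !mulr0 lexx.
have /andP[h1 h2] := h i _ (Scomp_X w Xx).
have r0 : 0 < deriv_ratio i (Scomp S w x) by lra.
have l1 : ln m <= ln (deriv_ratio i (Scomp S w x)) by rewrite ler_ln.
have l2 : ln (deriv_ratio i (Scomp S w x)) <= ln M by rewrite ler_ln.
by rewrite -natr1; apply/andP; split; lra.
Qed.

Let norm_addB4 (p q p' q' b b' : R) : `|p - q| <= b -> `|p' - q'| <= b' ->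
  `|p + p' - (q + q')| <= b' + b.
Proof.
move=> h h'; rewrite opprD addrACA addrC; apply: le_trans (ler_normD _ _) _; exact: lerD.
Qed.

(** Distortion estimates for a single map, with errors in exponential form so that they add along an
    orbit. In the last one only [x] has to lie in [X]: the orbit of [y] may leave [X] but stays in
    [V]. *)
Let one_step : exists e G c : R, [/\ 0 < e /\ 0 < G, 0 < c < 1,
  forall i x y, V x -> V y -> enorm (S i x - S i y) <= c * enorm (x - y),
  forall i x y, X x -> X y -> enorm (x - y) < e ->
    `|ln (deriv_ratio i x) - ln (deriv_ratio i y)| <= G * enorm (x - y) `^ gamma &
  forall i x y, X x -> enorm (y - x) < e -> V y /\
    expR (- (G * enorm (y - x) `^ gamma)) * (deriv_ratio i x * enorm (y - x))
      <= enorm (S i y - S i x) <=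
    expR (G * enorm (y - x) `^ gamma) * (deriv_ratio i x * enorm (y - x))].
Proof.
have [e [H [e0 H0 hol]]] := holder_uniform.
have [m [M [m0 M1 hm]]] := deriv_ratio_bounds.
have [c [c0 c1 hc]] := contraction_uniform.
(* Within this radius the derivative varies by at most half of its minimum [m], so relative errors
   are at most [1 / 2] and can be moved into an exponent at the cost of a factor 2, whence [G]. *)
pose e1 := (m / H / 2) `^ gamma^-1.
have e10 : 0 < e1 by rewrite powR_gt0// !divr_gt0.
have he1 : e1 `^ gamma = m / H / 2.
  by rewrite /e1 -powRrM mulVf ?powRr1 ?gt_eqF// !divr_ge0// ltW.
pose G := 2 * H / m.
have G0 : 0 < G by rewrite divr_gt0// mulr_gt0.
have me0 : 0 < Num.min e e1 by rewrite lt_min e0.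
have small (t : R) : 0 <= t -> t < Num.min e e1 -> t < e /\ H * t `^ gamma <= m / 2.
  rewrite lt_min => t0 /andP[te te1]; split=> //.
  rewrite mulrC -ler_pdivlMr// mulrAC -he1.
  by apply: ge0_ler_powR => //; rewrite ?nnegrE ?(ltW t0) ?(ltW e10) ?(ltW gamma_gt0)// ltW.
exists (Num.min e e1), G, c; split => //.
- by rewrite c0.
- move=> i x y Xx Xy xy.
  have [xye Hm] := small _ (enorm_ge0 _) xy.
  have [Vx hx] := hol i y x Xy xye.
  have [u u1] := unit_vector_ex.
  have [rx0 _ rx] := deriv_ratioP i Vx; have [ry0 _ ry] := deriv_ratioP i (XV Xy).
  have hd : `|deriv_ratio i x - deriv_ratio i y| <= H * enorm (x - y) `^ gamma.
    have := hx u; have := enorm_sub_le (jac (S i) x u) (jac (S i) y u).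
    rewrite rx ry u1 !mulr1; exact: le_trans.
  have /andP[mx _] := hm i x Xx; have /andP[my _] := hm i y Xy.
  have half p q : m <= p -> m <= q -> `|p - q| <= H * enorm (x - y) `^ gamma ->
      ln p - ln q <= G * enorm (x - y) `^ gamma.
    move=> mp mq pq; have p0 : 0 < p by lra. have q0 : 0 < q by lra.
    rewrite -ln_div ?posrE//.
    have -> : p / q = 1 + (p - q) / q by field; rewrite gt_eqF.
    apply: le_trans (le_ln1Dx _) _.
      by rewrite ltr_pdivlMr//; lra.
    rewrite ler_pdivrMr//; apply: le_trans (ler_norm _) _; apply: le_trans pq _.
    have -> : G * enorm (x - y) `^ gamma * q = H * enorm (x - y) `^ gamma * (2 * (q / m)).
      by rewrite /G; field; rewrite gt_eqF.
    rewrite ler_peMr ?mulr_ge0 ?powR_ge0 ?ltW//.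
    have : 1 <= q / m by rewrite ler_pdivlMr// mul1r.
    lra.
  rewrite ler_norml; apply/andP; split; last exact: half.
  by rewrite lerNl opprB; apply: half => //; rewrite distrC.
- move=> i x y Xx yx; have [yxe Hm] := small _ (enorm_ge0 _) yx.
  have [Vy _] := hol i x y Xx yxe; split=> //.
  have [r0 _ rx] := deriv_ratioP i (XV Xx).
  have /andP[mr _] := hm i x Xx.
  set t := enorm (y - x) in yx yxe Hm *; set r := deriv_ratio i x in mr r0 rx *.
  have t0 : 0 <= t by exact: enorm_ge0.
  have tg0 : 0 <= t `^ gamma by exact: powR_ge0.
  have mv : enorm (S i y - S i x - jac (S i) x (y - x)) <= H * t `^ gamma * t.
    have yE : y = x + (y - x) by rewrite addrC subrK.
    rewrite {1}yE; apply: mean_value => [a u|s s01|s /andP[s0 s1]]; first exact: jacZ.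
      have [|Vz _] := hol i x (x + s *: (y - x)) Xx.
        rewrite addrAC subrr add0r enormZ ger0_norm; last by case/andP: s01.
        by apply: le_lt_trans yxe; rewrite ler_piMl//; case/andP: s01.
      have [[df _] _ _] := cifs_diffeo hS i; exact: df.
    have sE : enorm (x + s *: (y - x) - x) = s * t.
      by rewrite addrAC subrr add0r enormZ ger0_norm.
    have st : s * t <= t by rewrite ler_piMl.
    have [|_ hz] := hol i x (x + s *: (y - x)) Xx; first by rewrite sE; lra.
    apply: le_trans (hz _) _; rewrite sE -/t ler_wpM2r// ler_pM2l//.
    by apply: ge0_ler_powR => //; rewrite ?nnegrE ?mulr_ge0// ltW.
  have h1 : `|enorm (S i y - S i x) - r * t| <= H * t `^ gamma * t.
    by apply: le_trans mv; rewrite -rx; exact: enorm_sub_le.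
  pose h := H * t `^ gamma / m.
  have h0 : 0 <= h by rewrite divr_ge0 ?mulr_ge0// ltW.
  have h2 : h <= 2^-1 by rewrite ler_pdivrMr//; lra.
  have GE : G * t `^ gamma = 2 * h by rewrite /G /h; field; rewrite gt_eqF.
  have HE : H * t `^ gamma = h * m by rewrite /h; field; rewrite gt_eqF.
  have hmt : h * m * t <= h * (r * t) by rewrite -mulrA ler_wpM2l// ler_wpM2r.
  move: h1; rewrite HE ler_norml => /andP[l1 l2].
  have rt0 : 0 <= r * t by rewrite mulr_ge0// ltW.
  rewrite GE; apply/andP; split.
    have : expR (- (2 * h)) <= 1 - h.
      have e2 : 1 + 2 * h <= expR (2 * h) by exact: expR_ge1Dx.
      rewrite expRN; have e3 : 0 < expR (2 * h) by exact: expR_gt0.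
      rewrite -div1r ler_pdivrMr//.
      have : (1 - h) * (1 + 2 * h) <= (1 - h) * expR (2 * h) by rewrite ler_wpM2l//; lra.
      have : h * h <= h * 2^-1 by rewrite ler_wpM2l.
      lra.
    move=> /(ler_wpM2r rt0); lra.
  have : 1 + h <= expR (2 * h) by apply: le_trans (expR_ge1Dx _); lra.
  move=> /(ler_wpM2r rt0); lra.
Qed.

Lemma Scomp_contraction : exists c : R, 0 < c < 1 /\
  forall w x y, V x -> V y -> enorm (Scomp S w x - Scomp S w y) <= c ^+ size w * enorm (x - y).
Proof.
have [c [c0 c1 hc]] := contraction_uniform; exists c; split; first by rewrite c0.
move=> w x y Vx Vy; elim: w => [|i w IH] /=; first by rewrite expr0 mul1r.
apply: le_trans (hc _ _ _ (Scomp_V w Vx) (Scomp_V w Vy)) _.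
by rewrite exprS -mulrA ler_pM2l.
Qed.

(* Bounded distortion.  The errors along an orbit form a geometric series, because
   the distance of the two points shrinks by a fixed factor at every step. *)
Lemma distortion : exists e C : R, [/\ 0 < e, 0 < C,
  forall w x y, X x -> X y -> enorm (x - y) < e ->
    `|lr w x - lr w y| <= C * enorm (x - y) `^ gamma &
  forall w x y, X x -> enorm (y - x) < e -> V y /\
    expR (lr w x - C * enorm (y - x) `^ gamma) * enorm (y - x)
      <= enorm (Scomp S w y - Scomp S w x) <=
    expR (lr w x + C * enorm (y - x) `^ gamma) * enorm (y - x)].
Proof.
have [e [G [c [[e0 G0] /andP[c0 c1] hc hl hs]]]] := one_step.
pose th := c `^ gamma.
have th0 : 0 < th by exact: powR_gt0.
have th1 : th < 1.
  have : c `^ gamma < 1 `^ gamma by apply: gt0_ltr_powR; rewrite ?nnegrE// ltW.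
  by rewrite powR1.
have C0 : 0 < G / (1 - th) by rewrite divr_gt0// subr_gt0.
have [A [A0 A1 A2]] : exists A : nat -> R, [/\ A 0%N = 0,
    forall n, A n.+1 = A n + G * th ^+ n & forall n, A n <= G / (1 - th)].
  exists (fun n => G / (1 - th) * (1 - th ^+ n)); split.
  - by rewrite expr0 subrr mulr0.
  - by move=> n; rewrite exprS; field; rewrite subr_eq0 gt_eqF.
  - by move=> n; rewrite ler_piMr ?(ltW C0)// lerBlDr lerDl exprn_ge0// ltW.
have powE n (t : R) : 0 <= t -> (c ^+ n * t) `^ gamma = th ^+ n * t `^ gamma.
  move=> t0; elim: n => [|n IH]; first by rewrite !expr0 !mul1r.
  by rewrite !exprS -!mulrA powRM ?IH ?mulr_ge0 ?exprn_ge0 ?(ltW c0).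
have contr w x y : V x -> V y ->
    enorm (Scomp S w x - Scomp S w y) <= c ^+ size w * enorm (x - y).
  move=> Vx Vy; elim: w => [|i w IH] /=; first by rewrite expr0 mul1r.
  apply: le_trans (hc _ _ _ (Scomp_V w Vx) (Scomp_V w Vy)) _.
  by rewrite exprS -mulrA ler_pM2l.
have step w x y : V x -> V y ->
    A (size w) * enorm (x - y) `^ gamma + G * enorm (Scomp S w x - Scomp S w y) `^ gamma
    <= A (size w).+1 * enorm (x - y) `^ gamma.
  move=> Vx Vy; rewrite A1 mulrDl lerD2l -mulrA ler_pM2l// -powE ?enorm_ge0//.
  apply: ge0_ler_powR; rewrite ?nnegrE ?enorm_ge0 ?mulr_ge0 ?enorm_ge0 ?exprn_ge0 ?(ltW c0) ?(ltW gamma_gt0)//.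
  exact: contr.
have bnd w (t : R) : A (size w) * t `^ gamma <= G / (1 - th) * t `^ gamma.
  by rewrite ler_wpM2r ?powR_ge0.
have close w x y : V x -> V y -> enorm (x - y) < e ->
    enorm (Scomp S w x - Scomp S w y) < e.
  move=> Vx Vy; apply: le_lt_trans; apply: le_trans (contr _ _ _ Vx Vy) _.
  by rewrite ler_piMl ?enorm_ge0// exprn_ile1 ?(ltW c0) ?(ltW c1)//.
exists e, (G / (1 - th)); split=> //.
  move=> w x y Xx Xy xy; apply: le_trans (bnd w _).
  elim: w => [|i w IH] /=; first by rewrite subrr normr0 A0 mul0r.
  have h1 := hl i _ _ (Scomp_X w Xx) (Scomp_X w Xy) (close w _ _ (XV Xx) (XV Xy) xy).
  apply: le_trans (step w _ _ (XV Xx) (XV Xy)).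
  exact: norm_addB4 IH.
move=> w x y Xx yx; have [Vy _] := hs (Ordinal N_gt0) x y Xx yx; split=> //.
set t := enorm (y - x) in yx *; have t0 : 0 <= t by exact: enorm_ge0.
have b0 := bnd w t.
suff /andP[h1 h2] : expR (lr w x - A (size w) * t `^ gamma) * t <=
    enorm (Scomp S w y - Scomp S w x) <= expR (lr w x + A (size w) * t `^ gamma) * t.
  apply/andP; split; [apply: le_trans h1|apply: le_trans h2 _];
    by rewrite ler_wpM2r// ler_expR; rewrite ?lerB ?lerD2l.
elim: w {b0} => [|i w /andP[IH1 IH2]] /=.
  by rewrite A0 mul0r subr0 addr0 expR0 mul1r lexx.
have cl := close w _ _ Vy (XV Xx) yx.
have [_ /andP[h1 h2]] := hs i _ _ (Scomp_X w Xx) cl.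
have h3 := step w _ _ Vy (XV Xx); rewrite -/t in h3.
have [r0 _ _] := deriv_ratioP i (XV (Scomp_X w Xx)).
set r := deriv_ratio i _ in h1 h2 r0 *.
set t' := enorm (Scomp S w y - _) in h1 h2 h3 IH1 IH2 *.
have rE : r = expR (ln r) by rewrite lnK.
move: h3 h1 h2 IH1 IH2; move: (A (size w)) (A (size w).+1) (t `^ gamma) (t' `^ gamma) => p q T T'.
move: (ln r) rE (lr w x) => l rE m h3 h1 h2 IH1 IH2.
apply/andP; split.
  apply: le_trans h1; rewrite rE.
  apply: (@le_trans _ _ (expR (- (G * T')) * (expR l * (expR (m - p * T) * t)))).
    rewrite !mulrA -!expRD ler_wpM2r// ler_expR -subr_ge0.
    by rewrite (_ : _ - _ = q * T - (p * T + G * T')) ?subr_ge0//; ring.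
  by rewrite ler_pM2l ?expR_gt0// ler_pM2l ?expR_gt0.
apply: le_trans h2 _; rewrite rE.
apply: (@le_trans _ _ (expR (G * T') * (expR l * (expR (m + p * T) * t)))).
  by rewrite ler_pM2l ?expR_gt0// ler_pM2l ?expR_gt0.
rewrite !mulrA -!expRD ler_wpM2r// ler_expR -subr_ge0.
by rewrite (_ : _ - _ = q * T - (p * T + G * T')) ?subr_ge0//; ring.
Qed.

(** The local estimates need points closer than [e]. The last [n0] letters of a word already bring
    all of [X] within that distance and change the logarithm of the factor by a bounded amount;
    shorter words are estimated outright. *)
Lemma distortion_global : exists C : R, 0 < C /\
  (forall w x y, X x -> X y -> `|lr w x - lr w y| <= C) /\
  (forall w x y, X x -> X y -> enorm (Scomp S w x - Scomp S w y) <= C * expR (lr w x)).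
Proof.
have [e [C [e0 C0 h1 h2]]] := distortion.
have [c [/andP[c0 c1] hc]] := Scomp_contraction.
have [a [b [a0 b0 hab]]] := lr_bounds.
have [D [D0 hD]] := X_bounded.
have [n0 hn0] : exists n0, c ^+ n0 * D < e.
  have l0 : 0 < - ln c by rewrite oppr_gt0 ln_lt0// c0.
  have D20 : 0 < e / D / 2 by rewrite !divr_gt0.
  have [n0 hn0] := expR_eventually_le 0 l0 D20; exists n0.
  have := hn0 n0 (leqnn _); rewrite add0r -mulNr opprK expRM_natr lnK// => h.
  have : c ^+ n0 * D <= e / D / 2 * D by rewrite ler_pM2r.
  have -> : e / D / 2 * D = e / 2 by field; rewrite gt_eqF.
  lra.
pose B := b * n0%:R; have B0 : 0 <= B by rewrite mulr_ge0.
have lrB w x : X x -> (size w <= n0)%N -> `|lr w x| <= B.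
  move=> Xx sw; have /andP[l1 l2] := hab w x Xx.
  have : b * (size w)%:R <= B by rewrite ler_wpM2l// ler_nat.
  have : 0 <= a * (size w)%:R by rewrite mulr_ge0// ltW.
  by rewrite ler_norml => *; apply/andP; split; lra.
have Ce0 : 0 <= C * e `^ gamma by rewrite mulr_ge0 ?powR_ge0// ltW.
pose E := D + e.
have E0 : 0 < E by rewrite /E; lra.
pose C' := 2 * B + C * e `^ gamma + E * expR (B + C * e `^ gamma).
have EE0 : 0 < E * expR (B + C * e `^ gamma) by rewrite mulr_gt0 ?expR_gt0.
have tg (t : R) : 0 <= t -> t < e -> C * t `^ gamma <= C * e `^ gamma.
  by move=> t0 te; rewrite ler_pM2l//; apply: ge0_ler_powR;
    rewrite ?nnegrE ?(ltW gamma_gt0) ?(ltW te) ?(ltW e0).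
have cl w x y : X x -> X y -> size w = n0 -> enorm (Scomp S w x - Scomp S w y) < e.
  move=> Xx Xy sw; apply: le_lt_trans (hc _ _ _ (XV Xx) (XV Xy)) _; rewrite sw.
  by apply: le_lt_trans hn0; rewrite ler_wpM2l ?hD// exprn_ge0// ltW.
exists C'; split; first by rewrite /C'; lra.
split=> w x y Xx Xy; have [sw|sw] := leqP (size w) n0.
- have := lrB w x Xx sw; have := lrB w y Xy sw; rewrite !ler_norml => /andP[? ?] /andP[? ?].
  by rewrite /C'; apply/andP; split; lra.
- have sw' : size (drop (size w - n0) w) = n0 by rewrite size_drop subKn// ltnW.
  rewrite -(cat_take_drop (size w - n0) w) !lr_cat.
  move: (take _ w) (drop _ w) sw' => w1 w2 sw'.
  have := lrB w2 x Xx; have := lrB w2 y Xy; rewrite sw' leqnn => /(_ isT) + /(_ isT).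
  have := h1 w1 _ _ (Scomp_X w2 Xx) (Scomp_X w2 Xy) (cl w2 _ _ Xx Xy sw').
  move=> /le_trans /(_ (tg _ (enorm_ge0 _) (cl w2 _ _ Xx Xy sw'))).
  by rewrite !ler_norml => /andP[? ?] /andP[? ?] /andP[? ?]; rewrite /C'; apply/andP; split; lra.
- apply: le_trans (hc _ _ _ (XV Xx) (XV Xy)) _; apply: (@le_trans _ _ D).
    apply: le_trans (hD _ _ Xx Xy); rewrite ler_piMl ?enorm_ge0// exprn_ile1 ?(ltW c0) ?(ltW c1)//.
  apply: (@le_trans _ _ (E * expR (B + C * e `^ gamma) * expR (lr w x))); last first.
    by rewrite ler_wpM2r ?expR_ge0// /C'; lra.
  rewrite -mulrA -expRD; apply: (@le_trans _ _ (E * 1)); first by rewrite /E; lra.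
  rewrite ler_pM2l// -expR0 ler_expR.
  by have := lrB w x Xx sw; rewrite ler_norml => /andP[? ?]; lra.
- have sw' : size (drop (size w - n0) w) = n0 by rewrite size_drop subKn// ltnW.
  rewrite -(cat_take_drop (size w - n0) w) !lr_cat !Scomp_cat.
  move: (take _ w) (drop _ w) sw' => w1 w2 sw'.
  have cl' := cl w2 y x Xy Xx sw'.
  have [_ /andP[_ h]] := h2 w1 _ _ (Scomp_X w2 Xx) cl'.
  rewrite enormB; apply: le_trans h _.
  have := lrB w2 x Xx; rewrite sw' leqnn => /(_ isT); rewrite ler_norml => /andP[l1 l2].
  have t1 := tg _ (enorm_ge0 _) cl'.
  set t := enorm (Scomp S w2 y - _) in cl' t1 *.
  have tE : t <= E by rewrite /E; lra.
  apply: (@le_trans _ _ (E * expR (B + C * e `^ gamma) * expR (lr w1 (Scomp S w2 x) + lr w2 x))); last first.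
    by rewrite ler_wpM2r ?expR_ge0// /C'; lra.
  rewrite -mulrA -expRD mulrC ler_pM ?expR_ge0 ?enorm_ge0// ler_expR; lra.
Qed.

Lemma S_inj i x y : V x -> V y -> S i x = S i y -> x = y.
Proof.
move=> Vx Vy xy; have [_ _ [g [hg _]]] := cifs_diffeo hS i.
by rewrite -(hg x Vx) -(hg y Vy) xy.
Qed.

Lemma Scomp_inj w x y : V x -> V y -> Scomp S w x = Scomp S w y -> x = y.
Proof.
move=> Vx Vy; elim: w => //= i w IH /S_inj h.
by apply: IH; apply: h; exact: Scomp_V.
Qed.

Lemma S_open i (U : set 'rV[R]_d) : open U -> U `<=` V -> open (S i @` U).
Proof.
move=> Uo UV; have [_ So [g [hg [gd _]]]] := cifs_diffeo hS i.
rewrite openE => _ [x Ux <-].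
have Sx : (S i @` V) (S i x) by exists x => //; exact: UV.
have gc := differentiable_continuous (gd _ Sx).
have : nbhs (S i x) (g @^-1` U).
  by apply: gc; rewrite hg; [exact: open_nbhs_nbhs|exact: UV].
have : nbhs (S i x) (S i @` V) by exact: open_nbhs_nbhs.
apply: filterS2 => z [y Vy <-] /=; rewrite hg// => Uy; by exists y.
Qed.

Lemma Scomp_open w (U : set 'rV[R]_d) : open U -> U `<=` V -> open (Scomp S w @` U).
Proof.
move=> Uo UV; elim: w => [|i w IH] /=; first by rewrite image_id.
rewrite (_ : _ @` U = S i @` (Scomp S w @` U)); last by rewrite -image_comp.
by apply: S_open => // _ [x Ux <-]; apply: Scomp_V; exact: UV.
Qed.

Lemma S_continuous i x : V x -> {for x, continuous (S i)}.
Proof.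
by move=> Vx; have [[df _] _ _] := cifs_diffeo hS i; exact/differentiable_continuous/df.
Qed.

Lemma Scomp_continuous w x : V x -> {for x, continuous (Scomp S w)}.
Proof.
move=> Vx; elim: w => [|i w IH] /=; first exact: cvg_id.
by apply: continuous_comp; [exact: IH|apply: S_continuous; exact: Scomp_V].
Qed.

Lemma eball_compact x (r : R) : compact [set y | enorm (y - x) <= r].
Proof.
apply: bounded_closed_compact.
  exists (`|x| + r); split; first exact: num_real.
  move=> M hM y /= yx; apply: le_trans (ltW hM).
  have := ler_normD (y - x) x; rewrite subrK; have := norm_le_enorm (y - x); lra.
rewrite (_ : [set y | _] = (fun y => enorm (y - x)) @^-1` [set t | t <= r])//.
apply: closed_comp; last exact: closed_le.
move=> y _; apply: (@continuous_comp _ _ _ (fun y => y - x)); last exact: enorm_continuous.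
by apply: (@cvgB R _ _ (nbhs y) _ id (cst x) y x); [exact: cvg_id|exact: cvg_cst].
Qed.

(* A clopen argument along the segment from the centre to the given point. *)
Lemma image_ball_sub w x0 (r k : R) : 0 < r -> 0 < k -> eball x0 r `<=` V ->
  (forall y, enorm (y - x0) < r -> k * enorm (y - x0) <= enorm (Scomp S w y - Scomp S w x0)) ->
  eball (Scomp S w x0) (k * r) `<=` Scomp S w @` eball x0 r.
Proof.
move=> r0 k0 BV hk z; rewrite /eball /= => hz.
set f := Scomp S w; set y0 := f x0.
have Vx0 : V x0 by apply: BV; exact: eball_center.
pose r' := (enorm (z - y0) / k + r) / 2.
have zr : enorm (z - y0) / k < r by rewrite ltr_pdivrMr// mulrC.
have r'r : r' < r by rewrite /r'; lra.
have zr' : enorm (z - y0) < k * r' by rewrite mulrC -ltr_pdivrMr// /r'; lra.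
have r'0 : 0 < r'.
  have zk : 0 <= enorm (z - y0) / k by rewrite divr_ge0 ?enorm_ge0// ltW.
  by rewrite /r'; lra.
pose g (t : R) := y0 + t *: (z - y0).
have gc : continuous g.
  by move=> t; apply: cvgD; [exact: cvg_cst|apply: cvgZr_tmp; exact: cvg_id].
have gz t : 0 <= t <= 1 -> enorm (g t - y0) <= enorm (z - y0).
  move=> /andP[t0 t1]; rewrite /g addrAC subrr add0r enormZ ger0_norm//.
  by rewrite ler_piMl ?enorm_ge0.
have Br : eball x0 r' `<=` V by move=> y hy; apply: BV; exact: lt_trans r'r.
have Bc : [set y | enorm (y - x0) <= r'] `<=` V.
  by move=> y hy; apply: BV; exact: le_lt_trans r'r.
pose A := `[0, 1]%classic `&` (g @^-1` (f @` eball x0 r')).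
have AE : A = `[0, 1]%classic.
  apply: (@segment_connected R 0 1).
  - exists 0; split; first by rewrite /= in_itv /= lexx ler01.
    by exists x0; [exact: eball_center|rewrite /g scale0r addr0].
  - exists (g @^-1` (f @` eball x0 r')) => //.
    apply: open_comp; first by move=> t _; exact: gc.
    by apply: Scomp_open => //; exact: eball_open.
  - exists (g @^-1` (f @` [set y | enorm (y - x0) <= r'])).
      apply: closed_comp; first by move=> t _; exact: gc.
      apply: compact_closed; first exact: norm_hausdorff.
      apply: continuous_compact; last exact: eball_compact.
      apply: continuous_in_subspaceT => y /[!inE] hy; apply: Scomp_continuous.
      exact: Bc.
    (* The open and the closed ball give the same set, because the sphere of radius [r'] is sent to
       distance at least [k * r'] from [y0], farther than any point of the segment. *)
    apply/seteqP; split=> t [t01 [y hy yt]]; split=> //; exists y => //.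
      exact: ltW.
    rewrite /eball /= lt_neqAle hy andbT; apply/eqP => yr.
    have := hk y; rewrite yr => /(_ r'r); rewrite -/f yt.
    have : 0 <= t <= 1 by move: t01; rewrite /= in_itv.
    by move=> /gz; rewrite -/f -/y0; lra.
have : A 1 by rewrite AE /= in_itv /= ler01 lexx.
move=> [_ [y hy yz]]; exists y; first exact: lt_trans r'r.
by rewrite -/f yz /g scale1r addrC subrK.
Qed.

(** A long word contracts two distinct points of [K]; the local distortion estimate then applies to
    the pair. *)
Lemma close_pair : (exists x y, [/\ K x, K y & x <> y]) ->
  forall e : R, 0 < e -> exists x y, [/\ K x, K y, x <> y & enorm (x - y) < e].
Proof.
move=> [x [y [Kx Ky xy]]] e e0.
have [c [/andP[c0 c1] hc]] := Scomp_contraction.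
have l0 : 0 < - ln c by rewrite oppr_gt0 ln_lt0// c0.
have t0 : 0 < enorm (x - y) by apply: enorm_gt0; rewrite subr_eq0; apply/eqP.
have e20 : 0 < e / enorm (x - y) / 2 by rewrite !divr_gt0.
have [n hn] := expR_eventually_le 0 l0 e20.
have := hn n (leqnn _); rewrite add0r -mulNr opprK expRM_natr lnK// => h.
pose w := nseq n (Ordinal N_gt0).
exists (Scomp S w x), (Scomp S w y); split; [exact: Scomp_K|exact: Scomp_K| |].
  by move=> /Scomp_inj h'; apply: xy; apply: h'; apply: XV; exact: K_sub_X.
apply: le_lt_trans (hc _ _ _ (XV (K_sub_X Kx)) (XV (K_sub_X Ky))) _.
rewrite size_nseq; have : c ^+ n * enorm (x - y) <= e / enorm (x - y) / 2 * enorm (x - y).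
  by rewrite ler_pM2r.
have -> : e / enorm (x - y) / 2 * enorm (x - y) = e / 2 by field; rewrite gt_eqF.
lra.
Qed.

Lemma diam_bounds (A : set 'rV[R]_d) (M : R) x y : A x -> A y ->
  (forall x y, A x -> A y -> enorm (x - y) <= M) -> enorm (x - y) <= diam A <= M.
Proof.
move=> Ax Ay hM.
have lo : ((enorm (x - y))%:E <= ediam A)%E.
  by apply: ereal_sup_ubound; right; exists x, y.
have hi : (ediam A <= M%:E)%E.
  apply: ge_ereal_sup => e [->|[x' [y' [Ax' Ay' ->]]]]; last by rewrite lee_fin hM.
  by rewrite lee_fin; apply: le_trans (hM _ _ Ax Ay); exact: enorm_ge0.
have fn : ediam A \is a fin_num.
  by move: lo hi; case: (ediam A).
by rewrite /diam -!lee_fin fineK// lo hi.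
Qed.

Variable x0 : 'rV[R]_d.
Hypothesis Kx0 : K x0.
Hypothesis hK2 : (1 < N)%N -> exists x y, [/\ K x, K y & x <> y].

(* For [N = 1] the set [K] is a point, all diameters vanish and every word has slope
   [0]; the conformal factor then replaces the diameter. *)
Definition logdiam w : R := if (1 < N)%N then ln (diam (Scomp S w @` K)) else lr w x0.

(** From above this is global distortion; from below, [S_w] separates a fixed close pair of points
    of [K] by about its conformal factor. *)
Lemma logdiam_lr : exists C : R, 0 < C /\ forall w x, X x -> `|logdiam w - lr w x| <= C.
Proof.
have [C [C0 [hC1 hC2]]] := distortion_global.
rewrite /logdiam; case: ltnP => N1; last first.
  by exists C; split=> // w x Xx; apply: hC1 => //; exact: K_sub_X.
have [e [G [e0 G0 hd1 hd2]]] := distortion.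
have [x1 [y1 [Kx1 Ky1 xy1 xye]]] := close_pair (hK2 N1) e0.
have Xx1 := K_sub_X Kx1.
pose t := enorm (y1 - x1).
have t0 : 0 < t by apply: enorm_gt0; rewrite subr_eq0; apply/eqP => h; apply: xy1.
exists (C + `|ln C| + C + G * t `^ gamma + `|ln t|); split.
  have := normr_ge0 (ln C); have := normr_ge0 (ln t).
  have := mulr_ge0 (ltW G0) (powR_ge0 t gamma); lra.
move=> w x Xx; rewrite enormB in xye; have [_ /andP[lo _]] := hd2 w x1 y1 Xx1 xye.
rewrite -/t in lo.
have lrx := hC1 w x x1 Xx Xx1.
have /andP[d1 d2] : enorm (Scomp S w y1 - Scomp S w x1) <= diam (Scomp S w @` K)
    <= C * expR (lr w x + C).
  apply: diam_bounds; [by exists y1|by exists x1|].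
  move=> _ _ [a Ka <-] [b Kb <-]; apply: le_trans (hC2 w a b (K_sub_X Ka) (K_sub_X Kb)) _.
  rewrite ler_pM2l// ler_expR; have := hC1 w a x (K_sub_X Ka) Xx.
  by rewrite ler_norml => /andP[? ?]; lra.
have p0 : 0 < diam (Scomp S w @` K).
  by apply: lt_le_trans d1; apply: lt_le_trans lo; rewrite mulr_gt0 ?expR_gt0.
have l1 : lr w x1 - G * t `^ gamma + ln t <= ln (diam (Scomp S w @` K)).
  rewrite -[X in X + ln t]expRK -lnM ?posrE ?expR_gt0// ler_ln ?posrE ?mulr_gt0 ?expR_gt0//.
  exact: le_trans d1.
have l2 : ln (diam (Scomp S w @` K)) <= ln C + (lr w x + C).
  rewrite -[X in _ + X]expRK -lnM ?posrE ?expR_gt0// ler_ln ?posrE ?mulr_gt0 ?expR_gt0//.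
have := ler_norm (ln C); have := ler_norm (- ln t); rewrite normrN.
have := mulr_ge0 (ltW G0) (powR_ge0 t gamma); have := normr_ge0 (ln C); have := normr_ge0 (ln t).
move: lrx; rewrite !ler_norml => /andP[? ?] *; apply/andP; split; lra.
Qed.

Variables (p : 'I_N -> R) (proj : (nat -> 'I_N) -> 'rV[R]_d) (beta : R -> R).
Hypothesis hp : forall i, 0 < p i.
Hypothesis hproj : projection S K proj.

Local Notation sft := (@Defs.shift N).

Definition logp w : R := ln (\prod_(i <- w) p i).

Lemma prod_p_gt0 w : 0 < \prod_(i <- w) p i.
Proof. by apply: prodr_gt0. Qed.

Lemma logp_cat w w' : logp (w ++ w') = logp w + logp w'.
Proof. by rewrite /logp big_cat lnM ?posrE ?prod_p_gt0. Qed.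

Lemma logp_bound : exists b : R, 0 <= b /\ forall w, `|logp w| <= b * (size w)%:R.
Proof.
exists (\sum_i `|ln (p i)|); split; first exact: sumr_ge0.
elim=> [|i w IH]; first by rewrite /logp big_nil ln1 normr0 mulr0.
rewrite -cat1s logp_cat -natr1 mulrDr mulr1 addrC; apply: le_trans (ler_normD _ _) _.
rewrite lerD// /logp big_seq1 (bigD1 i)//= lerDl; exact: sumr_ge0.
Qed.

Lemma mkseq_shift (u : nat -> 'I_N) n : mkseq u n.+1 = u 0%N :: mkseq (sft u) n.
Proof. by rewrite /mkseq /= -[1%N]addn0 iotaDl -map_comp. Qed.

Lemma proj_in (u : nat -> 'I_N) n : (Scomp S (mkseq u n) @` K) (proj u).
Proof. by have : [set proj u] (proj u) by []; rewrite (hproj u) => /(_ n I). Qed.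

Lemma proj_K u : K (proj u).
Proof. by have [x Kx <-] := proj_in u 0. Qed.

Lemma proj_eq u x : (forall n, (Scomp S (mkseq u n) @` K) x) -> x = proj u.
Proof. by move=> h; have : [set proj u] x by rewrite (hproj u) => n _; exact: h. Qed.

Lemma proj_shift u : S (u 0%N) (proj (sft u)) = proj u.
Proof.
apply: proj_eq => -[|n]; first by exists (Scomp S [:: u 0%N] (proj (sft u))) => //;
  apply: Scomp_K; exact: proj_K.
rewrite mkseq_shift; have [x Kx hx] := proj_in (sft u) n.
by exists x => //=; rewrite hx.
Qed.

(** The chain rule along a code: the Birkhoff sum of the scaling map is the logarithmic conformal
    factor of the first [n] maps at the point coded by the shifted sequence. *)
Lemma scaling_sum (u : nat -> 'I_N) n :
  \sum_(k < n) scaling S proj (iter k sft u) = lr (mkseq u n) (proj (iter n sft u))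
  /\ Scomp S (mkseq u n) (proj (iter n sft u)) = proj u.
Proof.
elim: n u => [|n IH] u; first by rewrite big_ord0.
have [h1 h2] := IH (sft u).
rewrite mkseq_shift /= -/(iter n.+1 sft u) iterSr h2 proj_shift; split=> //.
rewrite big_ord_recl /= {1}/scaling opnorm_jac -/(deriv_ratio _ _); congr +%R.
rewrite -h1; apply: eq_bigr => k _.
by rewrite add0n -iterS iterSr.
Qed.

Lemma pot_sum (u : nat -> 'I_N) n :
  \sum_(k < n) pot p (iter k sft u) = logp (mkseq u n).
Proof.
elim: n u => [|n IH] u; first by rewrite big_ord0 /logp big_nil ln1.
rewrite mkseq_shift -cat1s logp_cat {1}/logp big_seq1 big_ord_recl; congr +%R.
rewrite -IH; apply: eq_bigr => k _.
by rewrite lift0 iterSr.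
Qed.

Lemma cylinder_neq0 w : cylinder w !=set0.
Proof. by exists (fun k => nth (Ordinal N_gt0) w k); exact: mkseq_nth. Qed.

(** By bounded distortion the Birkhoff sums over one cylinder differ by a bounded amount, so any
    point of it can stand for the supremum. *)
Lemma sup_exp_bounds : exists C : R, 0 < C /\ forall (t q : R) w,
  expR (- (C * `|t|)) * expR (t * logdiam w + q * logp w)
  <= sup_exp (fun u => t * scaling S proj u + q * pot p u) w <=
  expR (C * `|t|) * expR (t * logdiam w + q * logp w).
Proof.
have [C [C0 hC]] := logdiam_lr; exists C; split=> // t q w.
apply: sup_between; first by have [u hu] := cylinder_neq0 w; exists (expR (\sum_(k < size w)
    (t * scaling S proj (iter k sft u) + q * pot p (iter k sft u)))), u.
move=> _ [u /= hu <-]; rewrite big_split /= -!mulr_sumr pot_sum.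
have [-> _] := scaling_sum u (size w); rewrite hu -!expRD !ler_expR.
have : `|t * (logdiam w - lr w (proj (iter (size w) sft u)))| <= C * `|t|.
  by rewrite normrM mulrC ler_wpM2r//; apply: hC; apply: K_sub_X; exact: proj_K.
move: (logdiam w) (lr w _) (C * `|t|) (q * logp w) => a b c s.
by rewrite ler_norml => /andP[? ?]; apply/andP; split; lra.
Qed.

Hypothesis hbeta : forall q : R,
  pressure (fun u => beta q * scaling S proj u + q * pot p u) = 0.

(** The logarithm of the partition sum is quasi-additive, so vanishing of the limit bounds it for
    every single [n]. *)
Lemma conformal_gibbs_system : exists a b c : R,
  gibbs_system logp logdiam a b c beta /\ forall D t n,
  expR (- (c * `|t|)) * (n%:R^-1 * slope_sum logp logdiam D t n)
  <= n%:R^-1 * wsum n (fun w => if `[< D (word_slope logp logdiam w) >]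
       then sup_exp (fun u => t * scaling S proj u) w else 0)
  <= expR (c * `|t|) * (n%:R^-1 * slope_sum logp logdiam D t n).
Proof.
have [C1 [C10 h1]] := sup_exp_bounds.
have [C2 [C20 h2]] := logdiam_lr.
have [a [b1 [a0 b10 h3]]] := lr_bounds.
have [b2 [b20 h4]] := logp_bound.
have [C3 [C30 [h5 _]]] := distortion_global.
have Xx0 := K_sub_X Kx0.
(* Comparing [L (u ++ v)] with [L u + L v] uses [logdiam_lr] three times. Exchanging [sup_exp] for
   [expR] costs [C1] in each of the three terms of quasi-additivity, and once more to return to the
   sums of [expR]. *)
pose b := b1 + b2; pose c1 := 3 * C2 + C3; pose c := c1 + 4 * C1.
have c1c : c1 <= c by rewrite /c; lra.
have cL u v : `|logdiam (u ++ v) - logdiam u - logdiam v| <= c1.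
  have k1 := h2 (u ++ v) x0 Xx0; have k2 := h2 u (Scomp S v x0) (Scomp_X v Xx0).
  have k3 := h2 v x0 Xx0; rewrite lr_cat in k1.
  move: k1 k2 k3; move: (logdiam _) (logdiam u) (logdiam v) (lr u _) (lr v _) => p1 p2 p3 p4 p5.
  by rewrite /c1 !ler_norml => /andP[? ?] /andP[? ?] /andP[? ?]; apply/andP; split; lra.
have p_le (x t : R) : 0 <= t -> x <= c -> x * t <= c * t by move=> t0 xc; rewrite ler_wpM2r.
exists a, b, c; split; last first.
  move=> D t n; have n0 : 0 <= n%:R^-1 :> R by rewrite invr_ge0.
  rewrite ![_ * (n%:R^-1 * _)]mulrCA; apply/andP; split; rewrite ler_wpM2l// -wsumZ;
    apply: wsum_le => w _; case: ifP => _; rewrite ?mulr0//.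
    have /andP[k1 _] := h1 t 0 w.
    have phiE : (fun u => t * scaling S proj u + 0 * pot p u) = (fun u => t * scaling S proj u).
      by apply/funext => u; rewrite mul0r addr0.
    rewrite phiE mul0r addr0 in k1; apply: le_trans k1; rewrite ler_wpM2r ?expR_ge0// ler_expR lerN2.
    by apply: p_le => //; rewrite /c /c1; lra.
  have /andP[_ k1] := h1 t 0 w.
  have phiE : (fun u => t * scaling S proj u + 0 * pot p u) = (fun u => t * scaling S proj u).
    by apply/funext => u; rewrite mul0r addr0.
  rewrite phiE mul0r addr0 in k1; apply: (le_trans k1); rewrite ler_wpM2r ?expR_ge0// ler_expR.
  by apply: p_le => //; rewrite /c /c1; lra.
split => //.
- by rewrite /b addr_ge0.
- by rewrite /c /c1; lra.
- exact: logp_cat.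
- by move=> w; apply: le_trans (h4 w) _; rewrite ler_wpM2r// /b lerDr.
- by move=> u v; exact: le_trans (cL u v) c1c.
- move=> w; have := h2 w x0 Xx0; have /andP[_ k] := h3 w x0 Xx0.
  by rewrite ler_norml => /andP[? ?]; rewrite /c /c1; lra.
- move=> w; have := h2 w x0 Xx0; have /andP[k _] := h3 w x0 Xx0.
  have k' : 0 <= b2 * (size w)%:R by rewrite mulr_ge0.
  by rewrite ler_norml => /andP[? ?]; rewrite /c /c1 /b; lra.
move=> q n; pose t := beta q; pose ph u := t * scaling S proj u + q * pot p u.
pose Z n := wsum n (fun w => expR (t * logdiam w + q * logp w)).
pose A n := ln (\sum_(w : n.-tuple 'I_N) sup_exp ph w).
have Z0 m : 0 < Z m by apply: wsum_gt0 => // w; exact: expR_gt0.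
have AZ m : `|A m - ln (Z m)| <= C1 * `|t|.
  have s1 : expR (- (C1 * `|t|)) * Z m <= wsum m (sup_exp ph).
    by rewrite -wsumZ; apply: wsum_le => w _; have /andP[] := h1 t q w.
  have s2 : wsum m (sup_exp ph) <= expR (C1 * `|t|) * Z m.
    by rewrite -wsumZ; apply: wsum_le => w _; have /andP[] := h1 t q w.
  have s0 : 0 < wsum m (sup_exp ph) by apply: lt_le_trans s1; rewrite mulr_gt0 ?expR_gt0.
  rewrite /A tuple_wsum.
  move: s1 s2; rewrite -ler_ln ?posrE ?mulr_gt0 ?expR_gt0// => s1.
  rewrite -ler_ln ?posrE ?mulr_gt0 ?expR_gt0// => s2.
  rewrite !lnM ?posrE ?expR_gt0// !expRK in s1 s2.
  by rewrite ler_norml; apply/andP; split; lra.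
have ZZ m k : `|ln (Z (m + k)%N) - ln (Z m) - ln (Z k)| <= c1 * `|t|.
  have e1 u v : `|t * (logdiam (u ++ v) - logdiam u - logdiam v)| <= c1 * `|t|.
    by rewrite normrM mulrC ler_wpM2r.
  have s1 : expR (- (c1 * `|t|)) * (Z m * Z k) <= Z (m + k)%N.
    rewrite /Z wsum_cat -wsum_mul -wsumZ; apply: wsum_le => u _; rewrite -wsumZ.
    apply: wsum_le => v _; rewrite -!expRD ler_expR logp_cat.
    by have := e1 u v; rewrite ler_norml => /andP[? ?]; lra.
  have s2 : Z (m + k)%N <= expR (c1 * `|t|) * (Z m * Z k).
    rewrite /Z wsum_cat -wsum_mul -wsumZ; apply: wsum_le => u _; rewrite -wsumZ.
    apply: wsum_le => v _; rewrite -!expRD ler_expR logp_cat.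
    by have := e1 u v; rewrite ler_norml => /andP[? ?]; lra.
  move: s1 s2; rewrite -ler_ln ?posrE ?mulr_gt0 ?expR_gt0// => s1.
  rewrite -ler_ln ?posrE ?mulr_gt0 ?expR_gt0// => s2.
  rewrite !lnM ?posrE ?mulr_gt0 ?expR_gt0// !expRK in s1 s2.
  by rewrite ler_norml; apply/andP; split; lra.
have hA : `|A n| <= (c1 + 3 * C1) * `|t|.
  apply: quasi_additive_limit0; last exact: hbeta.
  move=> m k; have := ZZ m k; have := AZ m; have := AZ k; have := AZ (m + k)%N.
  rewrite !ler_norml => /andP[? ?] /andP[? ?] /andP[? ?] /andP[? ?].
  by apply/andP; split; lra.
have hZ : `|ln (Z n)| <= c * `|t|.
  have := AZ n; move: hA; rewrite !ler_norml => /andP[? ?] /andP[? ?].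
  by rewrite /c; apply/andP; split; lra.
have hZ' : `|ln (Z n)| <= c * (1 + `|q| + `|t|).
  apply: le_trans hZ _; rewrite ler_wpM2l//; first by rewrite /c /c1; lra.
  by have := normr_ge0 q; lra.
by move: hZ'; rewrite ler_norml => h; exact: (ln_expR_bounds (Z0 n) h).
Qed.

(** For [N = 1] the only probability is 1, so both quotients have numerator 0. *)
Lemma word_ratio_slope w : \sum_i p i = 1 -> word_ratio S p K w = word_slope logp logdiam w.
Proof.
move=> p1; rewrite /word_ratio /word_slope -/(logp w) /logdiam; case: ltnP => // N1.
suff -> : logp w = 0 by rewrite !mul0r.
have pE i : p i = 1.
  rewrite -p1 (bigD1 i)//= big1 ?addr0// => j /eqP ji; exfalso; apply: ji.
  by apply/val_inj => /=; case: i j => i hi [j hj] /=; lia.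
by rewrite /logp big1 ?ln1// => i _; exact: pE.
Qed.

End ConformalGeometry.

(** * The self-conformal measure *)

Section WordCut.
Variables (N : nat).
Implicit Types (v w : seq 'I_N) (stop : pred (seq 'I_N)).

(** The descendants of [v] at which [stop] first holds, cut off after [n] further letters: an
    antichain that meets every long branch. It describes the cylinders of one scale or, with a
    predicate that never holds, of one generation. *)
Fixpoint wcut stop n v : seq (seq 'I_N) :=
  if n is n'.+1 then
    if stop v then [:: v] else flatten [seq wcut stop n' (rcons v i) | i <- enum 'I_N]
  else [:: v].

Lemma wcut_prefix stop n v w : w \in wcut stop n v -> prefix v w.
Proof.
elim: n v => [|n IH] v /=; first by rewrite inE => /eqP ->; exact: prefix_refl.
case: ifP => _; first by rewrite inE => /eqP ->; exact: prefix_refl.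
move=> /flattenP[s /mapP[i _ ->] /IH]; apply: prefix_trans; exact: prefix_rcons.
Qed.

Lemma prefix_rcons_inj v w (i j : 'I_N) : prefix (rcons v i) w -> prefix (rcons v j) w -> i = j.
Proof.
rewrite -!cats1 => /prefixP[s ->] /prefixP[t]; rewrite -!catA => /eqP.
by rewrite eqseq_cat// eqxx /= eqseq_cons => /andP[/eqP].
Qed.

Lemma wcut_antichain stop n v w w' : w \in wcut stop n v -> w' \in wcut stop n v ->
  prefix w w' -> w = w'.
Proof.
elim: n v => [|n IH] v /=; first by rewrite !inE => /eqP -> /eqP ->.
case: ifP => _; first by rewrite !inE => /eqP -> /eqP ->.
move=> /flattenP[s /mapP[i _ ->] hw] /flattenP[s' /mapP[j _ ->] hw'] ww.
suff ij : i = j by move: hw; rewrite ij => hw; exact: IH hw hw' ww.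
exact: prefix_rcons_inj (prefix_trans (wcut_prefix hw) ww) (wcut_prefix hw').
Qed.

Lemma wcut_uniq stop n v : uniq (wcut stop n v).
Proof.
elim: n v => [|n IH] v //=; case: ifP => // _.
elim: (enum 'I_N) (enum_uniq 'I_N) => //= i s IHs /andP[iNs us].
rewrite cat_uniq IH IHs// andbT /=; apply/hasPn => w /flattenP[t /mapP[j js ->] hw].
apply/negP => hw'; have := prefix_rcons_inj (wcut_prefix hw) (wcut_prefix hw').
by move=> ji; move: iNs; rewrite -ji js.
Qed.

Lemma wcut_parent stop n v w : w \in wcut stop n v ->
  w = v \/ exists w' i, w = rcons w' i /\ ~~ stop w'.
Proof.
elim: n v => [|n IH] v /=; first by rewrite inE => /eqP ->; left.
case: ifP => sv; first by rewrite inE => /eqP ->; left.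
move=> /flattenP[s /mapP[i _ ->] /IH [->|]]; last by right.
by right; exists v, i; rewrite sv.
Qed.

Lemma wcut_stop stop n v w : w \in wcut stop n v -> stop w \/ size w = (size v + n)%N.
Proof.
elim: n v => [|n IH] v /=; first by rewrite inE => /eqP ->; right; rewrite addn0.
case: ifP => sv; first by rewrite inE => /eqP ->; left.
move=> /flattenP[s /mapP[i _ ->] /IH [|->]]; first by left.
by right; rewrite size_rcons addSnnS.
Qed.

Lemma wcut_cover stop n v w : prefix v w -> (size v + n <= size w)%N ->
  exists2 u, u \in wcut stop n v & prefix u w.
Proof.
elim: n v w => [|n IH] v w vw nw /=; first by exists v; rewrite ?inE.
case: ifP => _; first by exists v; rewrite ?inE.
move: vw nw => /prefixP[[|i t] ->]; first by rewrite cats0; lia.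
move=> hsz; have [u hu uw] : exists2 u, u \in wcut stop n (rcons v i) & prefix u (v ++ i :: t).
  apply: IH; first by rewrite -cat_rcons; exact: prefix_prefix.
  by rewrite size_rcons; move: hsz; rewrite !size_cat /=; lia.
by exists u => //; apply/flattenP; exists (wcut stop n (rcons v i)) => //; apply/mapP; exists i; rewrite ?mem_enum.
Qed.

End WordCut.

Section SelfConformalMeasure.
Variables (R : realType) (d N : nat) (V K : set 'rV[R]_d) (S : 'I_N -> 'rV[R]_d -> 'rV[R]_d).
Variables (p : 'I_N -> R) (mu : probability (g_sigma_algebraType (@open 'rV[R]_d)) R).
Hypothesis Vopen : open V.
Hypothesis SV : forall w x, V x -> V (Scomp S w x).
Hypothesis Scont : forall w x, V x -> {for x, continuous (Scomp S w)}.
Hypothesis contr : exists c : R, 0 < c < 1 /\ forall w x y, V x -> V y ->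
  enorm (Scomp S w x - Scomp S w y) <= c ^+ size w * enorm (x - y).
Hypothesis KV : K `<=` V.
Hypothesis Kcompact : compact K.
Hypothesis ScompK : forall w x, K x -> K (Scomp S w x).
Variable x0 : 'rV[R]_d.
Hypothesis Kx0 : K x0.
Hypothesis hp : forall i, 0 < p i.
Hypothesis hmu : self_conformal_measure V S p mu.

Definition mass (B : set 'rV[R]_d) : R := fine (mu B).

Definition prodp (w : seq 'I_N) : R := \prod_(i <- w) p i.

Lemma prodp_gt0 w : 0 < prodp w. Proof. by apply: prodr_gt0. Qed.

Let pre w B := V `&` Scomp S w @^-1` B.

Let pre_open w B : open B -> open (pre w B).
Proof.
move=> Bo; rewrite openE => x [Vx Bx]; apply: filterI; first exact: open_nbhs_nbhs.
by apply: Scont => //; exact: open_nbhs_nbhs.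
Qed.

Lemma open_measurable (B : set 'rV[R]_d) : open B ->
  measurable (B : set (g_sigma_algebraType (@open 'rV[R]_d))).
Proof. by move=> Bo; apply: sub_sigma_algebra. Qed.

Lemma massE (B : set 'rV[R]_d) : open B -> mu B = (mass B)%:E.
Proof. by move=> Bo; rewrite /mass fineK// fin_num_measure//; exact: open_measurable. Qed.

Lemma mass_ge0 B : 0 <= mass B.
Proof. by rewrite /mass fine_ge0// measure_ge0. Qed.

Lemma le_mass A B : open A -> open B -> A `<=` B -> mass A <= mass B.
Proof.
move=> Ao Bo AB; rewrite -lee_fin -!massE//.
by apply: le_measure => //; rewrite inE; exact: open_measurable.
Qed.

Lemma mass_setT : mass setT = 1.
Proof. by rewrite /mass probability_setT. Qed.

Let mass_step B : open B -> mass B = \sum_i p i * mass (pre [:: i] B).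
Proof.
move=> Bo; have := hmu (open_measurable Bo); rewrite massE// => h.
have {}h : (mass B)%:E = (\sum_i (p i * mass (pre [:: i] B))%:E)%E.
  rewrite h; apply: eq_bigr => i _; rewrite EFinM -massE//; exact: pre_open.
by apply: EFin_inj; rewrite h sumEFin.
Qed.

Let mass_pre w B : open B -> mass (pre w B) = \sum_i p i * mass (pre (rcons w i) B).
Proof.
move=> Bo; rewrite mass_step; last exact: pre_open.
apply: eq_bigr => i _; congr (_ * mass _); apply/seteqP; split=> x [Vx] /=.
  by move=> [_]; rewrite /pre /= /Scomp foldr_rcons.
rewrite /Scomp foldr_rcons => Bx; split=> //; split=> //.
exact: (SV [:: i] Vx).
Qed.

Lemma mass_cut_pre B stop n v : open B ->
  prodp v * mass (pre v B) = \sum_(w <- wcut stop n v) prodp w * mass (pre w B).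
Proof.
move=> Bo; elim: n v => [|n IH] v /=; first by rewrite big_seq1.
case: ifP => _; first by rewrite big_seq1.
rewrite big_flatten big_map big_enum /= mass_pre// mulr_sumr; apply: eq_bigr => i _.
by rewrite -IH mulrA /prodp -cats1 big_cat big_seq1.
Qed.

(** The defining equation sees only preimages inside [V], which the maps send into [V]; hence [mu]
    does not charge the complement of [V]. *)
Let pre0 B : open B -> mass (pre [::] B) = mass B.
Proof.
move=> Bo; rewrite [in RHS]mass_step// mass_step; last exact: pre_open.
apply: eq_bigr => i _; congr (_ * mass _); apply/seteqP; split=> x [Vx] /=; first by case.
by move=> Bx; split=> //; split=> //; exact: (SV [:: i] Vx).
Qed.

Lemma mass_cut B stop n : open B ->
  mass B = \sum_(w <- wcut stop n [::]) prodp w * mass (pre w B).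
Proof. by move=> Bo; rewrite -mass_cut_pre// pre0// /prodp big_nil mul1r. Qed.

Lemma sum_cut_prodp stop n : \sum_(w <- wcut stop n [::]) prodp w = 1.
Proof.
have VT w : pre w setT = V by apply/seteqP; split=> x; [case|].
have h := mass_cut stop n openT; have V1 : mass V = 1 by rewrite -(VT [::]) pre0 ?mass_setT//; exact: openT.
move: h; rewrite mass_setT => ->; apply: eq_bigr => w _; by rewrite VT V1 mulr1.
Qed.

Lemma mass_large_ball (e : R) : 0 < e -> exists r : R, 0 < r /\ 1 - e <= mass (eball x0 r).
Proof.
move=> e0; pose F n := eball x0 n%:R.
have FT : \bigcup_n F n = setT.
  apply/seteqP; split=> // x _; have [n hn] := nat_large (enorm (x - x0)).
  by exists n.
have : (mu \o F) x @[x --> \oo] --> mu (\bigcup_n F n).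
  apply: nondecreasing_cvg_mu.
  - by move=> n; apply: open_measurable; exact: eball_open.
  - by apply: open_measurable; rewrite FT; exact: openT.
  - move=> m n mn; apply/subsetPset => x; rewrite /F /eball /= => h.
    by apply: (lt_le_trans h); rewrite ler_nat.
have muF : mu \o F = EFin \o (fun n => mass (F n)).
  by apply/funext => n /=; rewrite massE//; exact: eball_open.
rewrite FT probability_setT muF => /fine_cvgP[_ /cvgrPdist_le /(_ _ e0)] [n _ hn].
have := hn n.+1 (leqnSn n); rewrite /= ler_norml => /andP[_ h].
by exists n.+1%:R; rewrite ltr0n; split=> //; move: h; rewrite -/(F n.+1); lra.
Qed.

Lemma compact_eball_sub (U : set 'rV[R]_d) : open U -> K `<=` U ->
  exists2 r : R, 0 < r & forall x, K x -> eball x r `<=` U.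
Proof.
move=> Uo KU.
have [k hk] : exists k : nat, forall x, K x -> eball x k.+1%:R^-1 `<=` U.
  apply: compact_uniform => // [k k' x kk h y hy|x Kx].
    apply: h; apply: (lt_le_trans hy); rewrite lef_pV2 ?posrE ?ltr0n// ler_nat; lia.
  have [r r0 hr] := (open_eballP U).1 Uo x (KU x Kx).
  have [k hk] := nat_large (2 / r); exists k; apply/nbhs_eballP; exists (r / 2).
    by rewrite divr_gt0.
  move=> y yx z zy; apply: hr; move: yx zy; rewrite /eball /=.
  have : k.+1%:R^-1 <= r / 2.
    rewrite -[r / 2]invrK lef_pV2 ?posrE ?ltr0n ?invr_gt0 ?divr_gt0// invf_div.
    by apply: le_trans (ltW hk) _; rewrite ler_nat.
  have := enorm_dist y z x; set q : R := k.+1%:R^-1; lra.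
by exists k.+1%:R^-1; rewrite ?invr_gt0 ?ltr0n.
Qed.

(** Almost all the mass sits in one ball, and all words of a large length contract its part in [V]
    into [U]. *)
Lemma mass_open_sup (U : set 'rV[R]_d) : open U -> K `<=` U -> mass U = 1.
Proof.
move=> Uo KU; apply/eqP; rewrite eq_le -{1}mass_setT le_mass//; last exact: openT.
have [r r0 hr] := compact_eball_sub Uo KU.
apply/ler_addgt0Pr => e e0; have [s [s0 hs]] := mass_large_ball e0.
have [c [/andP[c0 c1] hc]] := contr.
have [n hn] : exists n, c ^+ n * s < r.
  have l0 : 0 < - ln c by rewrite oppr_gt0 ln_lt0// c0.
  have [n hn] := expR_eventually_le 0 l0 (divr_gt0 r0 (mulr_gt0 (ltr0Sn R 1) s0)).
  exists n; have := hn n (leqnn n); rewrite sub0r mulNr opprK mulr_natr -lnXn// lnK ?posrE ?exprn_gt0//.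
  rewrite ler_pdivlMr ?mulr_gt0//.
  have q0 : 0 < c ^+ n * s by rewrite mulr_gt0// exprn_gt0.
  by rewrite [2 * s]mulr_natl mulrnAr mulr2n => h; lra.
have h1 : mass (eball x0 s) <= mass U.
  rewrite (mass_cut (fun=> false) n Uo) -[leLHS]mul1r -(sum_cut_prodp (fun=> false) n).
  rewrite mulr_suml; rewrite big_seq [leRHS]big_seq; apply: ler_sum => w wc.
  rewrite ler_pM2l ?prodp_gt0// -(pre0 (@eball_open _ _ x0 s)); apply: le_mass; try exact: pre_open.
    by apply: pre_open; exact: eball_open.
  move=> x [Vx] /=; rewrite /eball /= => xs; split=> //=.
  apply: (hr (Scomp S w x0)); first exact: ScompK.
  rewrite /eball /=; apply: (le_lt_trans (hc w x x0 Vx (KV Kx0))).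
  have [//|->] := wcut_stop wc; rewrite add0n; apply: le_lt_trans hn.
  by rewrite ler_pM2l ?exprn_gt0// ltW.
by move: h1 hs; lra.
Qed.

(** [B] is covered by the complements of the shrinking neighbourhoods [U n] of [K], each of which is
    null by [mass_open_sup]. *)
Lemma mass_disjoint B : open B -> B `&` K = set0 -> mass B = 0.
Proof.
move=> Bo BK.
pose U (n : nat) := \bigcup_(y in K) eball y n.+1%:R^-1.
have Uo n : open (U n) by apply: bigcup_open => y _; exact: eball_open.
have KU n : K `<=` U n.
  by move=> y Ky; exists y => //; apply: eball_center; rewrite invr_gt0 ltr0n.
have muC n : mu (~` U n) = 0%E.
  by rewrite probability_setC ?massE ?mass_open_sup ?subee//; exact: open_measurable.
suff : (mu B <= 0)%E by rewrite massE// lee_fin => h; apply/eqP; rewrite eq_le h mass_ge0.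
have BU : B `<=` \bigcup_n ~` U n.
  move=> x Bx; have [r r0 hr] := (open_eballP B).1 Bo x Bx.
  have [k hk] := nat_large r^-1; exists k => // -[y Ky] /=; rewrite /eball /= => xy.
  have : (B `&` K) y.
    split=> //; apply: hr; rewrite /eball /= enormB; apply: lt_le_trans xy _.
    rewrite -[r]invrK lef_pV2 ?posrE ?ltr0n ?invr_gt0//; apply: le_trans (ltW hk) _.
    by rewrite ler_nat.
  by rewrite BK.
have := measure_sigma_subadditive mu _ (open_measurable Bo) BU.
have mC n : measurable (~` U n : set (g_sigma_algebraType (@open 'rV[R]_d))).
  by apply: measurableC; exact: open_measurable.
by move=> /(_ mC); rewrite eseries0// => n _ _; exact: muC.
Qed.

Lemma mass_ge_prodp A w : open A -> (forall y, K y -> A (Scomp S w y)) -> prodp w <= mass A.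
Proof.
move=> Ao hA; pose stop := (fun=> false) : pred (seq 'I_N).
have wc : w \in wcut stop (size w) [::].
  have [u uc uw] := @wcut_cover N stop (size w) [::] w (prefix0s _) (leqnn _).
  have [//|us] := wcut_stop uc; rewrite add0n in us.
  have /eqP wu : w == u by move: uw; rewrite prefixE us take_size.
  by rewrite [X in X \in _]wu.
rewrite (mass_cut stop (size w) Ao) (big_rem w)//= mass_open_sup ?mulr1.
- by rewrite lerDl; apply: sumr_ge0 => v _; rewrite mulr_ge0 ?mass_ge0// ltW// prodp_gt0.
- exact: pre_open.
- by move=> y Ky; split; [exact: KV|exact: hA].
Qed.

(** Cylinders that miss [B] contribute nothing by [mass_disjoint]; the others are counted with their
    full weight, whatever their overlaps. *)
Lemma mass_le_cut B stop n : open B ->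
  mass B <= \sum_(w <- wcut stop n [::] | `[< exists2 y, K y & B (Scomp S w y) >]) prodp w.
Proof.
move=> Bo; rewrite (mass_cut stop n Bo) [leRHS]big_mkcond; apply: ler_sum => w _.
have p0 := ltW (prodp_gt0 w).
case: asboolP => [_|h].
  rewrite -[leRHS]mulr1 ler_wpM2l// -mass_setT le_mass//; first exact: pre_open.
  exact: openT.
rewrite mass_disjoint ?mulr0//; first exact: pre_open.
by apply/seteqP; split=> // y [[_ By] Ky]; case: h; exists y.
Qed.

End SelfConformalMeasure.

(** * The open set condition *)

Section Packing.
Variables (R : realType) (d : nat).

(** Pigeonhole on a grid of mesh [r / (d + 1)]: two points in one cell would be closer than [r].
    Indices are counted rather than points, because the indices will be words. *)
Lemma packing (A : R) : exists M : nat, forall (I : eqType) (f : I -> 'rV[R]_d) (z : 'rV[R]_d)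
  (r : R) (s : seq I), 0 < r -> uniq s ->
  (forall i j, i \in s -> j \in s -> i != j -> r <= enorm (f i - f j)) ->
  (forall i, i \in s -> enorm (f i - z) <= A * r) -> (size s <= M)%N.
Proof.
pose D : R := d%:R + 1; have D0 : 0 < D by rewrite /D ltr_wpDl.
have [m hm] := nat_large (2 * (A * D)).
exists #|{ffun 'I_d -> 'I_m.+1}| => I f z r s r0 us sep near.
pose q i j : R := (f i ord0 j - z ord0 j) / (r / D) + A * D.
have dl0 : 0 < r / D by rewrite divr_gt0.
have qb i j : i \in s -> 0 <= q i j < m.+1%:R.
  move=> /near h; have := le_trans (coord_le_enorm (f i - z) j) h.
  rewrite !mxE ler_norml /q => /andP[h1 h2].
  have e1 : A * D = A * r / (r / D) by field; rewrite !gt_eqF.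
  have m1 : (m%:R <= m.+1%:R :> R) by rewrite ler_nat.
  have k1 : - (A * D) <= (f i ord0 j - z ord0 j) / (r / D).
    by rewrite ler_pdivlMr// e1 mulNr divfK ?gt_eqF.
  have k2 : (f i ord0 j - z ord0 j) / (r / D) <= A * D.
    by rewrite ler_pdivrMr// e1 divfK ?gt_eqF.
  by apply/andP; split; lra.
pose cell i : {ffun 'I_d -> 'I_m.+1} := [ffun j => inord (Num.truncn (q i j))].
have cinj : {in s &, injective cell}.
  move=> i j si sj cij; apply/eqP; apply/negPn/negP => ij.
  have dq k : `|q i k - q j k| < 1.
    have /andP[i0 i1] := qb i k si; have /andP[j0 j1] := qb j k sj.
    have /ffunP/(_ k) := cij; rewrite !ffunE => /(congr1 val) /=.
    have tb (x : R) : 0 <= x -> x < m.+1%:R -> (Num.truncn x < m.+1)%N.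
      move=> x0 xm; have /andP[h _] := truncn_itv x0.
      by rewrite -(ltr_nat R); exact: le_lt_trans h xm.
    rewrite !inordK ?tb// => te.
    have /andP[a1 a2] := truncn_itv i0; have /andP[b1 b2] := truncn_itv j0.
    move: a1 a2; rewrite te => a1 a2; rewrite -natr1 in a2 b2.
    by rewrite ltr_norml; apply/andP; split; lra.
  have := sep i j si sj ij; apply/negP; rewrite -ltNge.
  apply: le_lt_trans (enorm_le_norm _) _.
  have h : `|f i - f j| <= r / D.
    rewrite [`|_|]mx_normrE; apply: bigmax_le => [|[k l] _ /=]; first exact: ltW.
    rewrite ord1 !mxE; have := dq l; rewrite /q opprD addrACA subrr addr0 -mulrBl.
    rewrite normrM [`|(r / D)^-1|]gtr0_norm ?invr_gt0// ltr_pdivrMr// mul1r.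
    rewrite (_ : f i ord0 l - z ord0 l - (f j ord0 l - z ord0 l) = f i ord0 l - f j ord0 l); last by ring.
    exact: ltW.
  apply: le_lt_trans (ler_wpM2l (ler0n _ _) h) _.
  by rewrite mulrA ltr_pdivrMr// mulrC ltr_pM2l// /D ltrDl.
rewrite -(size_map cell) -(card_uniqP _) ?max_card//.
by rewrite map_inj_in_uniq.
Qed.

End Packing.

Section OpenSet.
Variables (R : realType) (d N : nat) (gamma : R) (V X K : set 'rV[R]_d).
Variable (S : 'I_N -> 'rV[R]_d -> 'rV[R]_d).
Hypothesis d_gt0 : (0 < d)%N.
Hypothesis hgamma : 0 < gamma < 1.
Hypothesis hS : conformal_ifs gamma V X S.
Hypothesis hK : self_conformal_set X S K.
Hypothesis N_gt0 : (0 < N)%N.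
Variable x0 : 'rV[R]_d.
Hypothesis Kx0 : K x0.
Hypothesis osc : open_set_condition X S.
Implicit Types (v w : seq 'I_N).

(** Common first letters are cancelled by injectivity; at the first letters that differ, the images
    of [O] are disjoint. *)
Lemma osc_comparable (O : set 'rV[R]_d) : O `<=` V -> (forall i, S i @` O `<=` O) ->
  (forall i j, i <> j -> S i @` O `&` S j @` O = set0) ->
  forall v w x y, O x -> O y -> Scomp S v x = Scomp S w y -> prefix v w \/ prefix w v.
Proof.
move=> OV SO dis.
have SOw w x : O x -> O (Scomp S w x).
  by move=> Ox; elim: w => //= i w IH; apply: (SO i); exists (Scomp S w x).
elim=> [|i v IH] [|j w] x y Ox Oy //= e; try by [left | right].
have [ij|ij] := eqVneq i j; last first.
  have : (S i @` O `&` S j @` O) (S i (Scomp S v x)).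
    split; first by exists (Scomp S v x) => //; exact: SOw.
    by rewrite e; exists (Scomp S w y) => //; exact: SOw.
  by rewrite dis//; exact/eqP.
subst j => /=; apply: (IH w x y) => //.
by apply: (S_inj hS) e; apply: OV; exact: SOw.
Qed.

(** With [y0] in the open set, the image of that set under [S_v] contains a ball of radius
    comparable to [r] around [S_v y0]. For incomparable words these images are disjoint, so the
    points [S_v y0] are separated. The hypotheses speak of [x0], which need not lie in the open set;
    global distortion passes to [y0]. *)
Lemma osc_count (A kap : R) : exists M : nat, forall (z : 'rV[R]_d) (r : R) (s : seq (seq 'I_N)),
  0 < r -> uniq s -> (forall v w, v \in s -> w \in s -> prefix v w -> v = w) ->
  (forall v, v \in s -> enorm (Scomp S v x0 - z) <= A * r /\ `|lr S v x0 - ln r| <= kap) ->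
  (size s <= M)%N.
Proof.
have [W [Wo [y0 Oy0] _ OX [SO dis]]] := osc.
have XV := cifs_sub hS.
have [e [C [e0 C0 _ hd]]] := distortion d_gt0 hgamma hS N_gt0.
have [G [G0 [hG1 hG2]]] := distortion_global d_gt0 hgamma hS hK N_gt0.
have Xx0 := K_sub_X hK Kx0; have Xy0 := OX _ Oy0.
have [r1 r10 hr1] := (open_eballP W).1 Wo y0 Oy0.
pose rho := Num.min r1 (e / 2).
have rho0 : 0 < rho by rewrite lt_min r10 divr_gt0.
have rhoe : rho < e by rewrite gt_min; apply/orP; right; lra.
have rhoO : eball y0 rho `<=` W.
  by move=> y hy; apply: hr1; apply: (lt_le_trans hy); rewrite ge_min lexx.
have /andP[g0 _] := hgamma.
pose k0 := expR (- kap - G - C * rho `^ gamma).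
have k00 : 0 < k0 := expR_gt0 _.
have [M hM] := packing d ((G * expR kap + A) / (k0 * rho)).
exists M => z r s r0 us anti near; apply: (hM _ (fun v => Scomp S v y0) z (r * k0 * rho)) => //.
- by rewrite !mulr_gt0.
- move=> v w sv sw vw; rewrite leNgt; apply/negP => close.
  have [_] := near v sv; rewrite ler_norml => /andP[l1 _].
  have := hG1 v x0 y0 Xx0 Xy0; rewrite ler_norml => /andP[_ l2].
  pose k := expR (lr S v y0 - C * rho `^ gamma).
  have kk : r * k0 <= k.
    rewrite -{1}(lnK (_ : r \is Num.pos)) ?posrE// -expRD ler_expR.
    by move: l1 l2; move: (C * _) (ln r) (lr S v x0) (lr S v y0) => *; lra.
  have sub : eball (Scomp S v y0) (k * rho) `<=` Scomp S v @` eball y0 rho.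
    apply: (image_ball_sub hS rho0 (expR_gt0 _)); first by move=> y /rhoO /OX /XV.
    move=> y yr; have [_ /andP[h _]] := hd v y0 y Xy0 (lt_trans yr rhoe).
    have pw : enorm (y - y0) `^ gamma <= rho `^ gamma.
      by apply: ge0_ler_powR; rewrite ?nnegrE ?enorm_ge0//; exact: ltW.
    have ek : k <= expR (lr S v y0 - C * enorm (y - y0) `^ gamma).
      by rewrite /k ler_expR lerD2l lerN2; apply: ler_wpM2l; [exact: ltW|exact: pw].
    exact: (le_trans (ler_wpM2r (enorm_ge0 _) ek) h).
  have [y yb ye] : (Scomp S v @` eball y0 rho) (Scomp S w y0).
    apply: sub; rewrite /eball /= enormB; apply: lt_le_trans close _.
    by rewrite ler_pM2r.
  have [pv|pw] := osc_comparable (subset_trans OX XV) SO dis (rhoO _ yb) Oy0 ye.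
    by move: vw; rewrite (anti v w)// eqxx.
  by move: vw; rewrite (anti w v)// eqxx.
move=> v sv; have [h1 h2] := near v sv.
have -> : (G * expR kap + A) / (k0 * rho) * (r * k0 * rho) = (G * expR kap + A) * r.
  by field; rewrite !gt_eqF.
apply: le_trans (enorm_dist (Scomp S v x0) _ _) _; rewrite mulrDl lerD//.
rewrite enormB; apply: le_trans (hG2 v x0 y0 Xx0 Xy0) _.
rewrite -mulrA ler_pM2l// -{1}(lnK (_ : r \is Num.pos)) ?posrE// -expRD ler_expR.
by move: h2; rewrite ler_norml => /andP[_]; move: (ln r) (lr _ _ _) => *; lra.
Qed.

End OpenSet.

(** * Upper bound for the dimension *)

Lemma sum_le_size (R : realType) (I : eqType) (s : seq I) (F : I -> R) (B : R) :
  (forall i, i \in s -> F i <= B) -> \sum_(i <- s) F i <= (size s)%:R * B.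
Proof.
elim: s => [|i s IH] h; first by rewrite big_nil mul0r.
rewrite big_cons /= -natr1 mulrDl mul1r addrC lerD//; last by apply: h; rewrite mem_head.
by apply: IH => j js; apply: h; rewrite inE js orbT.
Qed.

Section ScaleCut.
Variables (R : realType) (N : nat) (Phi L : seq 'I_N -> R) (a b c : R) (beta : R -> R).
Hypothesis gs : gibbs_system Phi L a b c beta.

(** One more letter lowers [L] by at most [b + 2 c], so a word stopped as soon as [L <= T]
    overshoots by no more than that; [T <= 0] covers the empty word. *)
Lemma scale_cut (T : R) : T <= 0 -> exists n,
  (forall w, (n <= size w)%N -> L w <= T) /\
  forall w, w \in wcut [pred v | L v <= T] n [::] -> T - b - 2 * c <= L w <= T.
Proof.
move=> T0; have [[a0 b0] c0] := (gs_a gs, gs_b gs, gs_c gs).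
have [n hn] : exists n : nat, - a * n%:R + c <= T.
  have [n hn] := nat_large ((c - T) / a); exists n; move: hn; rewrite ltr_pdivrMr// => h.
  by rewrite mulNr [a * _]mulrC; lra.
have hL w : (n <= size w)%N -> L w <= T.
  move=> nw; apply: le_trans (gs_L_ub gs w) _; apply: le_trans hn.
  by rewrite lerD2r !mulNr lerN2 ler_pM2l// ler_nat.
exists n; split=> // w wc; apply/andP; split; last first.
  by have [//|] := wcut_stop wc; rewrite add0n => sw; apply: hL; rewrite sw.
have [->|[w' [i [-> /= ]]]] := wcut_parent wc.
  by have := gs_L_lb gs [::]; rewrite mulr0; lra.
rewrite -ltNge -cats1 => sw'; have := gs_L_cat gs w' [:: i]; rewrite ler_norml => /andP[h _].
by have := gs_L_lb gs [:: i]; rewrite mulr1; lra.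
Qed.

End ScaleCut.

Section LocalDimension.
Variables (R : realType) (d N : nat) (K : set 'rV[R]_d) (S : 'I_N -> 'rV[R]_d -> 'rV[R]_d).
Variables (p : 'I_N -> R) (mu : probability (g_sigma_algebraType (@open 'rV[R]_d)) R).
Variables (L : seq 'I_N -> R) (a b c : R) (beta : R -> R) (x0 : 'rV[R]_d) (G : R).
Hypothesis gs : gibbs_system (logp p) L a b c beta.
Hypothesis Kx0 : K x0.
Hypothesis hp : forall i, 0 < p i.
Hypothesis K_cover : forall x n, K x -> exists w y, [/\ size w = n, K y & x = Scomp S w y].
Hypothesis G0 : 0 < G.
Hypothesis diamL : forall w x y, K x -> K y -> enorm (Scomp S w x - Scomp S w y) <= G * expR (L w).
Hypothesis mass_ge : forall A w, open A -> (forall y, K y -> A (Scomp S w y)) ->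
  prodp p w <= mass mu A.
Hypothesis mass_le : forall B stop n, open B -> mass mu B <=
  \sum_(w <- wcut stop n [::] | `[< exists2 y, K y & B (Scomp S w y) >]) prodp p w.
Hypothesis countL : forall A kap : R, exists M : nat, forall (z : 'rV[R]_d) (r : R)
  (s : seq (seq 'I_N)), 0 < r -> uniq s ->
  (forall v w, v \in s -> w \in s -> prefix v w -> v = w) ->
  (forall v, v \in s -> enorm (Scomp S v x0 - z) <= A * r /\ `|L v - ln r| <= kap) ->
  (size s <= M)%N.

Let a0 := gs_a gs.
Let b0 := gs_b gs.
Let c0 := gs_c gs.

Let m x r := mass mu (eball x r).

Lemma mass_le1 A : open A -> mass mu A <= 1.
Proof. by move=> Ao; rewrite -(mass_setT mu); apply: le_mass => //; exact: openT. Qed.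

Lemma cylinder_sub_eball w x y (r : R) : K y -> enorm (Scomp S w y - x) < r ->
  G * expR (L w) <= r -> forall z, K z -> eball x (2 * r) (Scomp S w z).
Proof.
move=> Ky yx wr z Kz; rewrite /eball /=.
by have := enorm_dist (Scomp S w y) (Scomp S w z) x; have := diamL w Kz Ky; lra.
Qed.

(** A cylinder through [x] inside the ball needs only about [- ln r / a] letters, and each letter
    costs at most [b] in [logp]. *)
Lemma mass_ball_lower : exists A B : R, [/\ 0 <= A, 0 <= B & forall x (r : R), K x -> 0 < r < 1 ->
  0 < m x r /\ - ln (m x r) <= A * (- ln r) + B].
Proof.
exists (b / a), (b * ((`|ln G| + c + 1) / a + 1)); split.
- by rewrite divr_ge0// ltW.
- by rewrite mulr_ge0// addr_ge0// divr_ge0 ?addr_ge0// ltW.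
move=> x r Kx /andP[r0 r1].
have lr0 : 0 <= - ln r by rewrite oppr_ge0 ln_le0// ltW.
pose T := (- ln r + `|ln G| + c + 1) / a.
have T0 : 0 <= T by rewrite divr_ge0 ?addr_ge0// ltW.
have /andP[n1 n2] := truncn_itv T0; set n := Num.truncn T in n1 n2.
have [w [y [wn Ky xy]]] := K_cover n.+1 Kx.
have wr : G * expR (L w) < r.
  rewrite -{1}(lnK (_ : G \is Num.pos)) ?posrE// -expRD -[ltRHS](lnK (_ : r \is Num.pos)) ?posrE//.
  rewrite ltr_expR; have := gs_L_ub gs w; rewrite wn.
  have h : - ln r + `|ln G| + c + 1 < a * n.+1%:R by rewrite mulrC -ltr_pdivrMr.
  by have := ler_norm (ln G); move: h; rewrite mulNr; move: (a * n.+1%:R) => an; lra.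
have pm : prodp p w <= m x r.
  apply: mass_ge; first exact: eball_open.
  by move=> z Kz; rewrite /eball /= xy; apply: le_lt_trans wr; exact: diamL.
have m0 : 0 < m x r by apply: lt_le_trans pm; exact: prodp_gt0.
split=> //; have pl : logp p w <= ln (m x r) by rewrite ler_ln ?posrE// prodp_gt0.
have := gs_Phi_bound gs w; rewrite ler_norml wn => /andP[h _].
have h2 : b * n.+1%:R <= b * (T + 1) by rewrite ler_wpM2l// -natr1 lerD2r.
have -> : b / a * - ln r + b * ((`|ln G| + c + 1) / a + 1) = b * (T + 1).
  by rewrite /T; field; rewrite gt_eqF.
by move: h2 h pl; move: (b * n.+1%:R) (b * (T + 1)) => *; lra.
Qed.

Lemma local_ratio_bound : exists D : R, 0 <= D /\ forall x (r : R), K x -> 0 < r < expR (- 1) ->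
  0 <= local_ratio mu x r <= D.
Proof.
have [A [B [A0 B0 h]]] := mass_ball_lower; exists (A + B); split; first exact: addr_ge0.
move=> x r Kx /andP[r0 r1].
have e1 : expR (- 1) < 1 :> R by rewrite expR_lt1 ltrN10.
have lr1 : ln r < - 1 by rewrite -[- 1]expRK ltr_ln ?posrE ?expR_gt0.
have [m0 hm] : 0 < m x r /\ - ln (m x r) <= A * (- ln r) + B.
  by apply: h => //; rewrite r0 (lt_trans r1).
rewrite /local_ratio -/(mass mu _) -/(m x r).
have m1 : ln (m x r) <= 0 by rewrite ln_le0// mass_le1//; exact: eball_open.
have -> : ln (m x r) / ln r = (- ln (m x r)) / (- ln r) by rewrite invrN mulrNN.
have l0 : 0 < - ln r by lra.
rewrite divr_ge0 ?oppr_ge0//=; last by lra.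
rewrite ler_pdivrMr//; apply: le_trans hm _.
by rewrite mulrDl lerD2l -[leLHS]mulr1 ler_wpM2l//; lra.
Qed.

(** Values of the bounded local ratio that stay away from [C] would accumulate somewhere; by
    hypothesis that point lies in [C], which is absurd. *)
Lemma local_ratio_near (C : set R) x (e : R) : K x ->
  cluster (local_ratio mu x r @[r --> 0^'+]) `<=` C -> 0 < e ->
  exists2 r1 : R, 0 < r1 & forall r, 0 < r < r1 -> near_set C e (local_ratio mu x r).
Proof.
move=> Kx hC e0; apply/(near_right0P (fun r => near_set C e (local_ratio mu x r))).
have [D [D0 hD]] := local_ratio_bound.
pose f := local_ratio mu x; pose F := f @ (within (~` (f @^-1` near_set C e)) 0^'+).
have [//|nF] := pselect (\forall r \near 0^'+, near_set C e (f r)); exfalso.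
have FF : ProperFilter F.
  apply: fmap_proper_filter; apply: (Build_ProperFilter _ (within_filter _ _)) => h.
  have h' : \forall r \near 0^'+, (~` (f @^-1` near_set C e)) r -> False := h.
  by apply: nF; apply: filterS h' => r hr; exact: contrapT.
have Fcpt : F `[0, D]%classic.
  have : \forall r \near 0^'+, (`[0, D]%classic : set R) (f r).
    apply/near_right0P; exists (expR (- 1)); first exact: expR_gt0.
    by move=> r r01; rewrite /= in_itv /=; exact: hD.
  by apply: filterS.
have [y [_ Fy]] := @segment_compact _ 0 D F FF Fcpt.
have Cy : C y.
  apply: hC => P Q hP; apply: Fy.
  have hP' : \forall r \near 0^'+, P (f r) := hP.
  suff : \forall r \near 0^'+, (~` (f @^-1` near_set C e)) r -> P (f r) by [].
  exact: filterS hP'.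
have : F (~` near_set C e).
  by rewrite /F /= /fmap /= /within /=; exact: nearW.
move=> /Fy /(_ (nbhsx_ballx y e e0)) [z [nz yz]]; apply: nz; exists y => //.
by move: yz; rewrite /ball /= distrC.
Qed.

Lemma frequently_small_increment (u : nat -> R) (A B : R) : (forall k, 0 <= u k <= A * k%:R + B) ->
  forall k0, exists2 k, (k0 <= k)%N & u k.+1 - u k <= A + 1.
Proof.
move=> hu k0; apply: contrapT => no.
have grow j : (A + 1) * j%:R <= u (k0 + j)%N.
  elim: j => [|j IH]; first by rewrite mulr0; have /andP[] := hu (k0 + 0)%N.
  have : A + 1 < u (k0 + j).+1 - u (k0 + j)%N.
    by rewrite ltNge; apply/negP => h; apply: no; exists (k0 + j)%N => //; exact: leq_addr.
  by rewrite addnS -natr1 mulrDr; lra.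
have [j hj] := nat_large (A * k0%:R + B).
by have := grow j; have /andP[_] := hu (k0 + j)%N; rewrite natrD mulrDr mulrDl; lra.
Qed.

(** The mass decays at most polynomially, so along the radii [2^-k] it cannot drop by more than a
    fixed factor at every step. Doubling is claimed only at arbitrarily small radii, which is all
    that covers require. *)
Lemma doubling_scale x : K x -> exists A1 : R, 0 <= A1 /\ forall r1 : R, 0 < r1 ->
  exists r : R, [/\ 0 < r < r1, 0 < m x r & ln (m x (2 * r)) <= A1 + ln (m x r)].
Proof.
move=> Kx; have [A [B [A0 B0 h]]] := mass_ball_lower.
have half0 : 0 < 2^-1 :> R by rewrite invr_gt0.
have half1 : 2^-1 < 1 :> R by rewrite invf_lt1// ltr1n.
have l2 : 0 <= ln 2 :> R by rewrite ln_ge0// ler1n.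
have lnq k : - ln (2^-1 ^+ k : R) = k%:R * ln 2.
  by rewrite exprVn lnV ?posrE ?exprn_gt0// opprK lnXn// mulr_natl.
have hr k : 0 < (2^-1 : R) ^+ k.+1 < 1 by rewrite exprn_gt0//= exprn_ilt1// ltW.
pose u k := - ln (m x (2^-1 ^+ k.+1)).
have hu k : 0 <= u k <= (A * ln 2) * k%:R + (A * ln 2 + B).
  have [_ h2] := h x _ Kx (hr k); rewrite lnq in h2; apply/andP; split.
    by rewrite oppr_ge0 ln_le0// mass_le1//; exact: eball_open.
  by apply: le_trans h2 _; rewrite -natr1; move: (k%:R) => kk; nra.
exists (A * ln 2 + 1); split; first by rewrite addr_ge0// mulr_ge0.
move=> r1 r10.
have l20 : 0 < ln 2 :> R by rewrite ln_gt0// ltr1n.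
have [k0 hk0] := expR_eventually_le 0 l20 (divr_gt0 r10 (ltr0Sn R 1)).
have [k k0k hk] := frequently_small_increment hu k0.
exists (2^-1 ^+ k.+2); split; last by move: hk; rewrite /u [in m x (2 * _)]exprS mulVKf ?gt_eqF//; lra.
  rewrite exprn_gt0//=; have /= := hk0 k.+2 (leq_trans k0k (leq_trans (leqnSn _) (leqnSn _))).
  rewrite sub0r mulrC -lnq opprK lnK ?posrE ?exprn_gt0// => h'.
  by apply: le_lt_trans h' _; lra.
by have [] := h x _ Kx (hr k.+1).
Qed.

Lemma near_setD (C : set R) (e e' y z : R) : near_set C e y -> `|z - y| < e' -> near_set C (e + e') z.
Proof.
move=> [al Cal h] h'; exists al => //; have := ler_normD (z - y) (y - al).
by rewrite addrA subrK; lra.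
Qed.

(* At a scale where the mass of a ball does not drop much, some cylinder of that scale near
   [x] carries a fixed proportion of the mass of the ball, so its slope is close to the local
   ratio; its code need not be a prefix of a code of [x]. *)
Lemma good_word_near (C : set R) x (e : R) n0 : K x ->
  cluster (local_ratio mu x r @[r --> 0^'+]) `<=` C -> 0 < e ->
  exists w, [/\ (n0 <= size w)%N, near_set C e (word_slope (logp p) L w) &
    enorm (x - Scomp S w x0) <= (2 * expR (`|ln G| + 1 + b + 2 * c)) * expR (L w)].
Proof.
move=> Kx hC e0; have [b0' c0'] := (b0, c0); pose g := `|ln G| + 1; pose kap := g + b + 2 * c.
have g0 : 0 < g by rewrite /g ltr_wpDl.
have kap0 : 0 < kap by rewrite /kap -addrA ltr_wpDr// addr_ge0// mulr_ge0.
have [M hM] := countL 2 kap.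
have [D [D0 hD]] := local_ratio_bound.
have e20 : 0 < e / 2 by rewrite divr_gt0.
have [r1 r10 hr1] := local_ratio_near Kx hC e20.
have [A1 [A10 dbl]] := doubling_scale Kx.
pose c5 := A1 + ln M.+1%:R.
have lM : 0 <= ln M.+1%:R :> R by rewrite ln_ge0// ler1n.
have c50 : 0 <= c5 by rewrite addr_ge0.
(* Since [ln r < - (Z + kap)], [- L w] exceeds both [(c5 + D * kap) / (e / 2)], which makes the
   error of the slope less than [e / 2], and [b * n0 + c], which makes [w] long enough. *)
pose Z := (c5 + D * kap) / (e / 2) + b * n0%:R + c + 1.
have q0 : 0 <= (c5 + D * kap) / (e / 2) by rewrite divr_ge0 ?(ltW e20)// addr_ge0// mulr_ge0// ltW.
have bn0 : 0 <= b * n0%:R by rewrite mulr_ge0.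
have Z0 : 1 <= Z.
  rewrite /Z; move: q0 bn0; move: ((c5 + D * kap) / (e / 2)) (b * n0%:R) => q bn q0 bn0.
  by have := c0; lra.
have rm0 : 0 < Num.min r1 (expR (- (Z + kap))) by rewrite lt_min r10 expR_gt0.
have [r [/andP[r0 rmin] mr0 mr2]] := dbl _ rm0.
move: rmin; rewrite lt_min => /andP[rr1 rZ].
have lrZ : ln r < - (Z + kap) by rewrite -[ltRHS]expRK ltr_ln ?posrE ?expR_gt0.
have re1 : 0 < r < expR (- 1).
  by rewrite r0; apply: (lt_trans rZ); rewrite ltr_expR; lra.
pose T := ln r - g; pose stop := [pred v : seq 'I_N | L v <= T].
have T0 : T <= 0 by move: lrZ; rewrite /T; lra.
have [n [_ cutL]] := scale_cut gs T0.
have Gr w : L w <= T -> G * expR (L w) <= r.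
  move=> h; rewrite -{1}(lnK (_ : G \is Num.pos)) ?posrE// -expRD.
  rewrite -[leRHS](lnK (_ : r \is Num.pos)) ?posrE// ler_expR.
  by have := ler_norm (ln G); move: h; rewrite /T /g; lra.
pose s := [seq w <- wcut stop n [::] | `[< exists2 y, K y & eball x r (Scomp S w y) >]].
have sP w : w \in s -> (exists2 y, K y & enorm (Scomp S w y - x) < r) /\ w \in wcut stop n [::].
  by rewrite mem_filter => /andP[/asboolP].
have sM : (size s <= M)%N.
  apply: (hM x r) => //; first by rewrite filter_uniq// wcut_uniq.
    by move=> v w /sP[_ vc] /sP[_ wc]; exact: wcut_antichain vc wc.
  move=> v /sP[[y Ky yx] vc]; have /andP[h1 h2] := cutL v vc; split.
    have := enorm_dist (Scomp S v y) (Scomp S v x0) x; have := diamL v Kx0 Ky.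
    by have := Gr v h2; lra.
  by rewrite ler_norml; move: h1 h2; rewrite /T /kap; move=> *; apply/andP; split; lra.
(* Pigeonhole: at most [M] cylinders of this scale meet the ball, and together they carry its
   mass. *)
have [w ws wm] : exists2 w, w \in s & m x r <= M.+1%:R * prodp p w.
  apply: contrapT => no.
  have small w : w \in s -> prodp p w <= m x r / M.+1%:R.
    move=> ws; rewrite ler_pdivlMr ?ltr0n// mulrC leNgt; apply/negP => h; apply: no.
    by exists w => //; exact: ltW.
  have := mass_le stop n (@eball_open _ _ x r); rewrite -big_filter -/s => h.
  have : \sum_(w <- s) prodp p w <= (size s)%:R * (m x r / M.+1%:R).
    exact: sum_le_size.
  apply/negP; rewrite -ltNge; apply: lt_le_trans h.
  by rewrite -/(m x r) mulrA ltr_pdivrMr ?ltr0n// [X in X < _]mulrC ltr_pM2l// ltr_nat ltnS.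
have [[y Ky yx] wc] := sP w ws; have /andP[lw1 lw2] := cutL w wc.
have up : prodp p w <= m x (2 * r).
  apply: mass_ge; first exact: eball_open.
  by move=> z; apply: cylinder_sub_eball yx (Gr w lw2) z.
have lp1 : logp p w <= A1 + ln (m x r).
  apply: le_trans mr2; rewrite ler_ln ?posrE ?prodp_gt0//.
  by apply: lt_le_trans up; exact: prodp_gt0.
have lp2 : ln (m x r) <= ln M.+1%:R + logp p w.
  by rewrite /logp -lnM ?posrE ?ltr0n ?prodp_gt0// ler_ln ?posrE ?mulr_gt0 ?ltr0n// prodp_gt0.
exists w; split.
- rewrite leqNgt; apply/negP => wn0; have := gs_L_lb gs w.
  have : b * (size w)%:R <= b * n0%:R by rewrite ler_wpM2l// ler_nat ltnW.
  by rewrite mulNr; move: (b * (size w)%:R) => bs; move: lw2; rewrite /T; rewrite /Z in lrZ; lra.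
- rewrite -[e](_ : e / 2 + e / 2 = e); last by lra.
  apply: (near_setD (hr1 r _)); first by rewrite r0.
  set lam := local_ratio mu x r.
  have /andP[lam0 lamD] := hD x r Kx re1.
  have lame : lam * ln r = ln (m x r).
    rewrite /lam /local_ratio -/(mass mu _) -/(m x r) divfK//.
    by rewrite lt_eqF//; move: lrZ kap0; lra.
  have Lneg : L w < 0 by move: lw2 lrZ; rewrite /T; lra.
  have -> : word_slope (logp p) L w - lam = (logp p w - ln (m x r) - lam * (L w - ln r)) / L w.
    by rewrite -lame /word_slope; field; rewrite lt_eqF.
  rewrite normrM normfV (ltr0_norm Lneg) ltr_pdivrMr ?oppr_gt0//.
  have h1 : `|lam * (L w - ln r)| <= D * kap.
    rewrite normrM ger0_norm//; apply: ler_pM => //; rewrite ler_norml.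
    by move: lw1 lw2; rewrite /T /kap; move=> *; apply/andP; split; lra.
  have h2 : `|logp p w - ln (m x r)| <= c5 by rewrite ler_norml /c5; apply/andP; split; lra.
  apply: le_lt_trans (ler_normB _ _) _; apply: le_lt_trans (lerD h2 h1) _.
  rewrite [ltRHS]mulrC -ltr_pdivrMr//.
  by move: lw2 lrZ; rewrite /T /Z; move: ((c5 + D * kap) / (e / 2)) q0 => q q0; lra.
have h1 : enorm (x - Scomp S w x0) <= 2 * r.
  rewrite enormB; have := enorm_dist (Scomp S w y) (Scomp S w x0) x; have := diamL w Kx0 Ky.
  by have := Gr w lw2; lra.
apply: le_trans h1 _; rewrite -mulrA ler_pM2l// -expRD -{1}(lnK (_ : r \is Num.pos)) ?posrE//.
by rewrite ler_expR; move: lw1; rewrite /T /g; lra.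
Qed.

End LocalDimension.

(** * Hausdorff measure and dimension *)

Section HausdorffNull.
Variables (R : realType) (d N : nat).
Implicit Types (A E : set 'rV[R]_d).

Lemma ediam_le A (M : R) : 0 <= M -> (forall x y, A x -> A y -> enorm (x - y) <= M) ->
  (ediam A <= M%:E)%E.
Proof.
move=> M0 h; apply: ge_ereal_sup => _ [->|[x [y [Ax Ay ->]]]]; first by rewrite lee_fin.
by rewrite lee_fin; exact: h.
Qed.

Lemma ediam_ge0 A : (0 <= ediam A)%E.
Proof. by apply: ereal_sup_ubound; left. Qed.

Lemma hausdorff_premeasure_ge0 (s delta : R) E : (0 <= hausdorff_premeasure s delta E)%E.
Proof.
by apply: le_ereal_inf_tmp => _ [U _ <-]; apply: nneseries_ge0 => n _ _; exact: poweR_ge0.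
Qed.

Lemma hausdorff_measure_ge0 (s : R) E : (0 <= hausdorff_measure s E)%E.
Proof.
apply: le_trans (hausdorff_premeasure_ge0 s 1 E) _.
by apply: ereal_sup_ubound; exists 1 => //=.
Qed.

Lemma hausdorff_measure_eq0 (t : R) E : (forall delta e : R, 0 < delta -> 0 < e ->
    exists (U : nat -> set 'rV[R]_d) (f : nat -> R),
    [/\ E `<=` \bigcup_k U k, forall k, (ediam (U k) <= delta%:E)%E,
        forall k, (ediam (U k) `^ t <= (f k)%:E)%E &
        forall n, \sum_(k < n) f k <= e]) ->
  hausdorff_measure t E = 0%E.
Proof.
move=> h; apply/eqP; rewrite eq_le hausdorff_measure_ge0 andbT.
apply: ge_ereal_sup => _ [delta /= delta0 <-]; apply/lee_addgt0Pr => e e0; rewrite add0e.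
have [U [f [EU Ud Uf fe]]] := h delta e delta0 e0.
apply: (@le_trans _ _ (\sum_(0 <= k <oo) (ediam (U k) `^ t))%E).
  by apply: ereal_inf_lbound; exists U.
apply: lime_le; first by apply: is_cvg_nneseries => n _ _; exact: poweR_ge0.
apply: nearW => n; apply: (@le_trans _ _ (\sum_(k < n) f k)%:E); last by rewrite lee_fin.
by rewrite big_mkord -sumEFin; apply: lee_sum => k _; exact: Uf.
Qed.

Lemma hausdorff_dim_set0 : hausdorff_dim (set0 : set 'rV[R]_d) = -oo%E.
Proof. by rewrite /hausdorff_dim; case: asboolP. Qed.

Lemma hausdorff_dim_le E (t : R) : 0 < t -> hausdorff_measure t E = 0%E ->
  (hausdorff_dim E <= t%:E)%E.
Proof.
move=> t0 h; rewrite /hausdorff_dim; case: asboolP => _; first exact: leNye.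
by apply: ereal_inf_lbound; exists t.
Qed.

Lemma hausdorff_dim_ge E (t : R) : E !=set0 ->
  (forall s : R, 0 < s -> s < t -> hausdorff_measure s E <> 0%E) -> (t%:E <= hausdorff_dim E)%E.
Proof.
move=> [x Ex] h; rewrite /hausdorff_dim; case: asboolP => [E0|_].
  by move: Ex; rewrite E0.
apply: le_ereal_inf_tmp => _ [s [s0 hs] <-]; rewrite lee_fin leNgt; apply/negP => st.
exact: h s0 st hs.
Qed.

Lemma hausdorff_dim_subset E E' : E `<=` E' -> (hausdorff_dim E <= hausdorff_dim E')%E.
Proof.
move=> EE; rewrite {1}/hausdorff_dim; case: asboolP => [_|E0]; first exact: leNye.
rewrite /hausdorff_dim; case: asboolP => [E'0|_].
  by exfalso; apply: E0; apply/seteqP; split=> // x /EE; rewrite E'0.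
apply: ereal_inf_le_tmp => _ [s [s0 hs] <-]; exists s => //; split=> //.
apply/eqP; rewrite eq_le hausdorff_measure_ge0 andbT -hs.
apply: ge_ereal_sup => _ [delta delta0 <-].
apply: (@le_trans _ _ (hausdorff_premeasure s delta E')); last first.
  by apply: ereal_sup_ubound; exists delta.
by apply: ereal_inf_le_tmp => _ [U [E'U hU] <-]; exists U => //; split=> //; exact: subset_trans E'U.
Qed.

Lemma sum_words_by_length (F : seq 'I_N -> R) (s : seq (seq 'I_N)) m : (forall w, 0 <= F w) ->
  uniq s -> all (fun w => size w < m)%N s -> \sum_(w <- s) F w <= \sum_(n < m) wsum n F.
Proof.
move=> F0; elim: m s => [|m IH] s us hs.
  by case: s us hs => // _ _; rewrite big_nil big_ord0.
rewrite big_ord_recr /= (bigID (fun w => size w == m)) /= addrC lerD//.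
  rewrite -big_filter; apply: IH; first exact: filter_uniq.
  apply/allP => w; rewrite mem_filter => /andP[wm /(allP hs)]; rewrite ltnS leq_eqVlt.
  by rewrite (negbTE wm).
rewrite -big_filter; apply: uniq_sum_le_wsum => //; first exact: filter_uniq.
by apply/allP => w; rewrite mem_filter => /andP[].
Qed.

Lemma sum_wsum_le (F : seq 'I_N -> R) (D rho : R) n0 : 0 < rho -> 0 <= D ->
  (forall n, (n0 <= n)%N -> wsum n F <= D * expR (- rho * n%:R)) ->
  (forall n, (n < n0)%N -> wsum n F = 0) ->
  forall m, \sum_(n < m) wsum n F <= D / (1 - expR (- rho)) * expR (- rho * n0%:R).
Proof.
move=> rho0 D0 hF hF0; set q := expR (- rho); have q1 : 0 < 1 - q.
  by rewrite subr_gt0 expR_lt1 oppr_lt0.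
have B0 : 0 <= D / (1 - q) by rewrite divr_ge0// ltW.
have small m : (m <= n0)%N -> \sum_(n < m) wsum n F = 0.
  by move=> mn; apply: big1 => i _; apply: hF0; apply: leq_trans mn.
have large j : \sum_(n < n0 + j) wsum n F <=
    D / (1 - q) * (expR (- rho * n0%:R) - expR (- rho * (n0 + j)%:R)).
  elim: j => [|j IH]; first by rewrite addn0 small// subrr mulr0.
  rewrite addnS big_ord_recr /=; apply: le_trans (lerD IH (hF _ (leq_addr _ _))) _.
  have -> : expR (- rho * (n0 + j).+1%:R) = expR (- rho * (n0 + j)%:R) * q.
    by rewrite -expRD -natr1; congr expR; ring.
  move: (expR (- rho * n0%:R)) (expR (- rho * (n0 + j)%:R)) => x y.
  by rewrite le_eqVlt; apply/orP; left; apply/eqP; field; rewrite gt_eqF.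
move=> m; case: (leqP m n0) => mn; first by rewrite small// mulr_ge0// expR_ge0.
rewrite -(subnKC (ltnW mn)); apply: le_trans (large _) _.
by rewrite ler_wpM2l// lerBlDr lerDl expR_ge0.
Qed.

(** Covers are indexed by integers, so words are enumerated by [pickle]; a partial sum sees only
    words of bounded length. *)
Lemma sum_pickled_words (F : seq 'I_N -> R) m : (forall w, 0 <= F w) ->
  exists m', \sum_(k < m) oapp F 0 (pickle_inv k) <= \sum_(n < m') wsum n F.
Proof.
move=> F0; pose s : seq (seq 'I_N) := pmap pickle_inv (iota 0 m).
exists (\max_(w <- s) size w).+1.
have -> : \sum_(k < m) oapp F 0 (pickle_inv k) = \sum_(w <- s) F w.
  by rewrite big_pmap -(big_mkord xpredT (fun k => oapp F 0 (pickle_inv k))) /index_iota subn0.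
apply: sum_words_by_length => //; first by rewrite (pmap_uniq pickle_invK)// iota_uniq.
by apply/allP => w ws; rewrite ltnS; apply: leq_bigmax_seq.
Qed.

End HausdorffNull.

Section DimensionUpper.
Variables (R : realType) (d N : nat) (K : set 'rV[R]_d) (S : 'I_N -> 'rV[R]_d -> 'rV[R]_d).
Variables (mu : probability (g_sigma_algebraType (@open 'rV[R]_d)) R).
Variables (Phi L : seq 'I_N -> R) (a b c : R) (beta : R -> R) (x0 : 'rV[R]_d) (D : R).
Hypothesis gs : gibbs_system Phi L a b c beta.
Hypothesis D0 : 0 < D.
Hypothesis good_word : forall (C : set R) x (e : R) n0, K x ->
  cluster (local_ratio mu x r @[r --> 0^'+]) `<=` C -> 0 < e ->
  exists w, [/\ (n0 <= size w)%N, near_set C e (word_slope Phi L w) &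
    enorm (x - Scomp S w x0) <= D * expR (L w)].

Definition acc_set (C : set R) : set 'rV[R]_d :=
  [set x | K x /\ cluster (local_ratio mu x r @[r --> 0^'+]) `<=` C].

Section Fixed.
Variables (C : set R) (t : R).
Hypothesis Cclosed : closed C.
Hypothesis hC : forall alpha, C alpha -> exists y, alpha * y + beta y < t.

(** The dimension is defined through positive exponents only. A point of the set provides
    arbitrarily long words of slope near [C], and for [t <= 0] each of them contributes at least 1
    to sums that tend to 0. *)
Lemma acc_set_exponent_gt0 : acc_set C !=set0 -> 0 < t.
Proof.
move=> [x [Kx hx]]; rewrite ltNge; apply/negP => t0.
have [r [rho [M [r0 rho0 M0 [n0 hn0]]]]] := core_upper gs Cclosed hC.
have [n1 hn1] := L_neg_large gs.
have h2 : 0 < (2 * M)^-1 by rewrite invr_gt0 mulr_gt0.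
have [n2 hn2] := expR_eventually_le 0 rho0 h2.
have [w [nw sw _]] := good_word (n0 + n1 + n2)%N Kx hx r0.
pose F v := if `[< near_set C r (word_slope Phi L v) >] then expR (t * L v) else 0.
have F0 v : 0 <= F v by rewrite /F; case: ifP => // _; exact: expR_ge0.
have Fw : 1 <= F w.
  rewrite /F ifT; last exact/asboolP.
  rewrite -[leLHS]expR0 ler_expR mulr_le0//; apply: le_trans (hn1 w _) _.
    by apply: leq_trans nw; rewrite addnAC leq_addl.
  by rewrite mulNr oppr_le0 mulr_ge0// divr_ge0// ltW// (gs_a gs).
have h3 : wsum (size w) F <= M * expR (- rho * (size w)%:R) by apply: hn0; apply: leq_trans nw; rewrite -addnA leq_addr.
have h4 : expR (- rho * (size w)%:R) <= (2 * M)^-1.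
  by have := hn2 (size w); rewrite sub0r mulNr; apply; apply: leq_trans nw; rewrite leq_addl.
have : 1 <= M * (2 * M)^-1.
  apply: le_trans Fw _; apply: le_trans (wsum_ge_term F0 (erefl _)) _.
  by apply: le_trans h3 _; rewrite ler_pM2l.
by rewrite invfM mulrCA divff ?gt_eqF// mulr1; lra.
Qed.

(** The cover consists of the balls around [S_w x0] of radius [D * expR (L w)], for all words of
    length at least [m] and slope near [C]; [core_upper] makes the tail of their [t]-costs small. *)
Lemma acc_set_null : 0 < t -> hausdorff_measure t (acc_set C) = 0%E.
Proof.
move=> t0; apply: hausdorff_measure_eq0 => delta e delta0 e0.
have [r [rho [M [r0 rho0 M0 [n0 hn0]]]]] := core_upper gs Cclosed hC.
have a0 := gs_a gs; have DD0 : 0 < 2 * D by rewrite mulr_gt0.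
have Dt0 : 0 < (2 * D) `^ t by rewrite powR_gt0.
have [n1 hn1] := expR_eventually_le (c + ln (2 * D)) a0 delta0.
pose M' := (2 * D) `^ t * M; have M'0 : 0 < M' by rewrite mulr_gt0.
have q0 : 0 < 1 - expR (- rho) by rewrite subr_gt0 expR_lt1 oppr_lt0.
have [n2 hn2] := expR_eventually_le 0 rho0 (divr_gt0 e0 (divr_gt0 M'0 q0)).
pose m := maxn n0 (maxn n1 n2).
have m0 : (n0 <= m)%N by rewrite leq_maxl.
have m1 : (n1 <= m)%N by rewrite /m !leq_max leqnn ?orbT.
have m2 : (n2 <= m)%N by rewrite /m !leq_max leqnn ?orbT.
pose good w := (m <= size w)%N && `[< near_set C r (word_slope Phi L w) >].
pose F w : R := if good w then (2 * D) `^ t * expR (t * L w) else 0.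
pose U k : set 'rV[R]_d := if pickle_inv k is Some w then
  [set x | good w /\ enorm (x - Scomp S w x0) <= D * expR (L w)] else set0.
have F0 w : 0 <= F w.
  by rewrite /F; case: ifP => // _; rewrite mulr_ge0 ?powR_ge0// expR_ge0.
pose dia k : R := if pickle_inv k is Some w then if good w then 2 * D * expR (L w) else 0 else 0.
have dU k : (ediam (U k) <= (dia k)%:E)%E.
  rewrite /U /dia; case: pickle_inv => [w|]; last by apply: ediam_le => // x y [].
  case: ifP => gw; last by apply: ediam_le => // x y [].
  apply: ediam_le => [|x y [_ hx] [_ hy]]; first by rewrite mulr_ge0 ?expR_ge0// ltW.
  have := enorm_dist (Scomp S w x0) x y; rewrite (enormB (Scomp S w x0) y).
  by move: hx hy; rewrite -mulrA; move: (D * expR _) => z; lra.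
exists U, (fun k => oapp F 0 (pickle_inv k)); split.
- move=> x [Kx hx]; have [w [mw sw xw]] := good_word m Kx hx r0.
  exists (pickle w) => //; rewrite /U pickleK_inv; split=> //.
  by rewrite /good mw; exact/asboolP.
- move=> k; apply: le_trans (dU k) _; rewrite lee_fin /dia.
  case: pickle_inv => [w|]; last exact: ltW.
  case: ifP => [/andP[mw _]|_]; last exact: ltW.
  apply: le_trans (hn1 _ (leq_trans m1 mw)).
  rewrite -{1}(lnK (_ : 2 * D \is Num.pos)) ?posrE// -expRD ler_expR.
  by have := gs_L_ub gs w; move: (_%:R) (ln _) => *; lra.
- move=> k; apply: (@le_trans _ _ ((dia k)%:E `^ t)%E).
    have := dU k; have := ediam_ge0 (U k); case: (ediam _) => [u| |] //= u0 h.
    rewrite lee_fin; apply: ge0_ler_powR; rewrite ?nnegrE ?(ltW t0)//.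
    by rewrite -lee_fin; exact: le_trans h.
  rewrite poweR_EFin lee_fin /dia; case: pickle_inv => [w|] /=; last by rewrite powR0// gt_eqF.
  rewrite /F; case: ifP => _; last by rewrite powR0// gt_eqF.
  by rewrite powRM ?expR_ge0 ?(ltW DD0)// [expR (L w) `^ t]/powR gt_eqF ?expR_gt0// expRK.
move=> n; have [n' h] := sum_pickled_words n F0; apply: (le_trans h).
apply: le_trans (sum_wsum_le rho0 (ltW M'0) (_ : forall n, (m <= n)%N -> _) _ n') _.
- move=> k mk; apply: le_trans (_ : (2 * D) `^ t * (M * expR (- rho * k%:R)) <= _); last by rewrite /M' mulrA.
  apply: le_trans (ler_wpM2l (ltW Dt0) (hn0 k (leq_trans m0 mk))).
  rewrite -wsumZ; apply: wsum_le => w wk; rewrite /F /good wk mk /=.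
  rewrite -/(near_set C r (word_slope Phi L w)).
  by case: asboolP => _; rewrite ?mulr0.
- move=> k km; rewrite -(wsum0 R N k); apply: eq_wsum => w wk.
  by rewrite /F /good wk leqNgt km.
have := hn2 m m2; rewrite sub0r -mulNr => h'.
by rewrite mulrC -ler_pdivlMr// divr_gt0.
Qed.

End Fixed.

Lemma dim_acc_set_le (C : set R) : closed C ->
  (hausdorff_dim (acc_set C) <= sup_star beta C)%E.
Proof.
move=> Cclosed; have [->|E0] := eqVneq (acc_set C) set0.
  by rewrite hausdorff_dim_set0 leNye.
have Ene : acc_set C !=set0 by apply/set0P.
have key (t : R) : (sup_star beta C < t%:E)%E -> 0 < t /\ (hausdorff_dim (acc_set C) <= t%:E)%E.
  move=> /sup_star_ltP h; have t0 := acc_set_exponent_gt0 Cclosed h Ene.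
  by split=> //; apply: hausdorff_dim_le => //; exact: acc_set_null.
case E : (sup_star beta C) => [t| |]; first 1 last.
- exact: leey.
- have [] := key (- 1); first by rewrite E ltNyr.
  by rewrite ltr0N1.
apply/lee_addgt0Pr => e e0; rewrite -EFinD.
by have [|_] := key (t + e) => //; rewrite E lte_fin ltrDl.
Qed.

End DimensionUpper.

(** * Separation of cylinders *)

Section Separation.
Variables (R : realType) (d N : nat) (gamma : R) (V X K : set 'rV[R]_d).
Variable (S : 'I_N -> 'rV[R]_d -> 'rV[R]_d).
Hypothesis d_gt0 : (0 < d)%N.
Hypothesis hgamma : 0 < gamma < 1.
Hypothesis hS : conformal_ifs gamma V X S.
Hypothesis hK : self_conformal_set X S K.
Hypothesis N_gt0 : (0 < N)%N.
Variable x0 : 'rV[R]_d.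
Hypothesis Kx0 : K x0.
Implicit Types (g h u v w : seq 'I_N).

Lemma K_cover x n : K x -> exists w y, [/\ size w = n, K y & x = Scomp S w y].
Proof.
elim: n x => [|n IH] x Kx; first by exists [::], x.
have [_ _ _ KE] := hK; move: Kx; rewrite {1}KE => -[i _ [z Kz <-]].
by have [w [y [sw Ky ->]]] := IH z Kz; exists (i :: w), y; rewrite /= sw.
Qed.

Let l w := lr S w x0.

Section Clusters.
Variables (a b G e C A0 kap th : R) (n1 : nat).
Hypothesis a0 : 0 < a.
Hypothesis b0 : 0 <= b.
Hypothesis lrb : forall w x, X x -> - b * (size w)%:R <= lr S w x <= - a * (size w)%:R.
Hypothesis lrG : forall w x y, X x -> X y -> `|lr S w x - lr S w y| <= G.
Hypothesis SG : forall w x y, X x -> X y ->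
  enorm (Scomp S w x - Scomp S w y) <= G * expR (lr S w x).
Hypothesis lrC : forall w x y, X x -> X y -> enorm (x - y) < e ->
  `|lr S w x - lr S w y| <= C * enorm (x - y) `^ gamma.
Hypothesis SC : forall w x y, X x -> enorm (y - x) < e ->
  enorm (Scomp S w y - Scomp S w x) <= expR (lr S w x + C * enorm (y - x) `^ gamma) * enorm (y - x).
Hypothesis G0 : 0 < G.
Hypothesis kapE : G + b <= kap.
Hypothesis A0E : 2 * G + 1 <= A0.
Hypothesis th0 : 0 <= th.
Hypothesis n1G : G < a * n1%:R.

Let Xx0 := K_sub_X hK Kx0.

(** Incomparable words of about the size of [u], all near [S_u x0]. The tolerances grow by [th] with
    each added word, because prefixing a cluster distorts it slightly. *)
Definition cluster_around j u (s : seq (seq 'I_N)) := [/\ (n1 <= size u)%N,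
  uniq s, size s = j.+1, forall v w, v \in s -> w \in s -> prefix v w -> v = w &
  forall v, v \in s -> `|l v - l u| <= kap + j%:R * th /\
    enorm (Scomp S v x0 - Scomp S u x0) <= A0 * expR (j%:R * th) * expR (l u)].

Lemma cluster_around0 : exists u s, cluster_around 0 u s.
Proof.
exists (nseq n1 (Ordinal N_gt0)), [:: nseq n1 (Ordinal N_gt0)]; split; rewrite ?size_nseq//.
  by move=> v w; rewrite !inE => /eqP -> /eqP ->.
have [[[h1 h2] h3] h4] := (b0, G0, kapE, A0E).
have kap0 : 0 <= kap by lra.
have A00 : 0 <= A0 by lra.
move=> v; rewrite inE => /eqP ->; rewrite !subrr normr0 enorm0 mul0r addr0; split=> //.
by rewrite mulr_ge0 ?mulr_ge0 ?expR_ge0.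
Qed.

(** [h] is continued by a code of [y] and cut where the size first falls to [expR T]; the cut may
    fall inside [h]. *)
Lemma word_at_scale h y (T : R) : T < 0 -> K y -> exists w', exists n,
  [/\ (n <= size (h ++ w'))%N, T - kap <= l (take n (h ++ w')) <= T &
   enorm (Scomp S (take n (h ++ w')) x0 - Scomp S h y) <= G * expR T].
Proof.
move=> T0 Ky; have [[[h1 h2] h3] h4] := (b0, G0, kapE, A0E); have [m hm] := nat_large (- T / a); rewrite ltr_pdivrMr// mulrC in hm.
have [w' [y' [sw' Ky' yy']]] := K_cover m Ky; exists w'; set h' := h ++ w'.
have ex : exists n, (n <= size h')%N && (l (take n h') <= T).
  exists (size h'); rewrite leqnn take_size /=.
  have /andP[_ k] := lrb h' Xx0; apply: le_trans k _.
  have : a * m%:R <= a * (size h')%:R by rewrite ler_pM2l// ler_nat /h' size_cat sw' leq_addl.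
  by rewrite mulNr; lra.
case: (ex_minnP ex) => n /andP[nh lT] nmin; exists n.
have lT' : T - kap <= l (take n h').
  case: n nh lT nmin => [|n] nh lT nmin; first by move: lT; rewrite take0 /l /=; lra.
  have lT1 : T < l (take n h').
    rewrite ltNge; apply/negP => k1; have := nmin n; rewrite (ltnW nh) k1 => /(_ isT).
    by rewrite ltnn.
  rewrite (take_nth (Ordinal N_gt0) nh) -cats1 /l lr_cat.
  have := lrG (take n h') (Scomp_X hS [:: nth (Ordinal N_gt0) h' n] Xx0) Xx0; rewrite ler_norml => /andP[i2 _].
  have /andP[i3 _] := lrb [:: nth (Ordinal N_gt0) h' n] Xx0; rewrite mulr1 in i3.
  by move: i2 i3 lT1; rewrite /l; move=> *; lra.
split=> //; first by rewrite lT' lT.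
have -> : Scomp S h y = Scomp S (take n h') (Scomp S (drop n h') y').
  by rewrite -Scomp_cat cat_take_drop /h' Scomp_cat -yy'.
have Xd := Scomp_X hS (drop n h') (K_sub_X hK Ky').
apply: le_trans (SG _ Xx0 Xd) _; by rewrite ler_pM2l// ler_expR.
Qed.

(** If the new word extends [h], it disagrees with [g] inside the first [size g] letters. If it is
    shorter and a prefix of [g], then [g ++ u] continues it by at least [n1] letters, and [n1G]
    makes [l (g ++ u)] strictly smaller than its own [l], against the choice of scale. *)
Lemma scale_word_incomparable g h w' u v n : (n1 <= size u)%N -> size g = size h -> g <> h ->
  l (take n (h ++ w')) <= l (g ++ u) -> (n <= size (h ++ w'))%N ->
  ~ prefix (take n (h ++ w')) (g ++ v) /\ ~ prefix (g ++ v) (take n (h ++ w')).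
Proof.
move=> nu sgh gh lT nh; have n1G' := n1G; case: (leqP (size h) n) => hn.
  have ph : prefix h (take n (h ++ w')) by rewrite take_cat ltnNge hn /=; exact: prefix_prefix.
  have eqg t : prefix g t -> prefix h t -> False.
    by rewrite !prefixE sgh => /eqP e1 /eqP e2; apply: gh; rewrite -[LHS]e1 -[RHS]e2.
  split=> k; first exact: eqg (prefix_prefix _ _) (prefix_trans ph k).
  exact: eqg (prefix_trans (prefix_prefix _ _) k) ph.
split=> k; last first.
  by have := size_prefix k; rewrite size_cat size_takel// sgh leqNgt (leq_trans hn)// leq_addr.
have pg : prefix (take n (h ++ w')) g.
  have ge : take n (g ++ v) = take n g by rewrite takel_cat// sgh ltnW.
  by move: k; rewrite !prefixE size_takel// ge.
have [g' gE] := prefixP pg; move: lT; rewrite {1}gE -catA /l lr_cat => lT.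
have /andP[_ h1] := lrb (g' ++ u) Xx0.
have := lrG (take n (h ++ w')) (Scomp_X hS (g' ++ u) Xx0) Xx0; rewrite ler_norml => /andP[_ h2].
have : a * n1%:R <= a * (size (g' ++ u))%:R.
  by rewrite ler_pM2l// ler_nat size_cat (leq_trans nu)// leq_addl.
rewrite mulNr in h1 => h4; suff : (1 : R) <= 0 by rewrite ler10.
lra.
Qed.

(** The failure of separation for the suffix [u] gives [g] and [h] with a point of the cylinder
    [g ++ u] very close to one of [h]. Prefixing by [g] keeps the shape of the cluster, and a word
    through the latter point, of the size of [g ++ u], is the new member. *)
Lemma cluster_around_grow j u s :
  (forall tau (c2 : R), 0 < c2 -> exists g h x y, [/\ size g = size h, g <> h, K x, K y &
    enorm (Scomp S (g ++ tau) x - Scomp S h y) < c2 * expR (l g)]) ->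
  (forall v, v \in s -> enorm (Scomp S v x0 - Scomp S u x0) < e /\
     C * enorm (Scomp S v x0 - Scomp S u x0) `^ gamma <= th) ->
  cluster_around j u s -> exists u' s', cluster_around j.+1 u' s'.
Proof.
move=> bad small [nu us ss anti cl].
have [[[[h1 h2] h3] h4] [h5 h6]] := (b0, G0, kapE, A0E, (th0, n1G)).
(* With this constant the distance is at most [expR T], the size of the cylinder [g ++ u] itself;
   [G] accounts for evaluating the factor of [g] at [x0]. *)
have [g [h [x [y [sgh gh Kx Ky close]]]]] := bad u _ (expR_gt0 (l u - G)).
pose T := l (g ++ u).
have TE : T = lr S g (Scomp S u x0) + l u by rewrite /T /l lr_cat.
have Xu := Scomp_X hS u Xx0.
have T0 : T < 0.
  have /andP[_ k] := lrb (g ++ u) Xx0; apply: le_lt_trans k _.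
  rewrite mulNr oppr_lt0 mulr_gt0// ltr0n size_cat addn_gt0; apply/orP; right.
  apply: leq_trans nu; rewrite lt0n; apply/negP => /eqP n10.
  by move: (h6); rewrite n10 mulr0 => /(lt_trans h2); rewrite ltxx.
have [w' [n [nh lT dT]]] := word_at_scale h T0 Ky.
have /andP[lT1 lT2] := lT; set b' := take n (h ++ w') in lT lT1 lT2 dT *.
have inc v : ~ prefix b' (g ++ v) /\ ~ prefix (g ++ v) b'.
  exact: scale_word_incomparable nu sgh gh lT2 nh.
have jj : j.+1%:R * th = j%:R * th + th by rewrite -natr1 mulrDl mul1r.
have jth0 : 0 <= j%:R * th by rewrite mulr_ge0.
exists (g ++ u), (b' :: map (cat g) s); split.
- by rewrite size_cat (leq_trans nu)// leq_addl.
- rewrite /= map_inj_uniq ?us ?andbT; last by move=> v w /eqP; rewrite eqseq_cat// eqxx => /eqP.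
  by apply/mapP => -[v _ bv]; have [k _] := inc v; apply: k; rewrite bv prefix_refl.
- by rewrite /= size_map ss.
- move=> v w; rewrite !inE => /orP[/eqP ->|/mapP[v' sv' ->]] /orP[/eqP ->|/mapP[w1 sw1 ->]] //.
  + by move=> k; have [] := inc w1.
  + by move=> k; have [] := inc v'.
  + by rewrite prefix_catr// eqxx /= => k; rewrite (anti v' w1).
move=> v; rewrite inE jj expRD => /orP[/eqP ->|/mapP[v' sv' ->]].
  split; first by rewrite -/T ler_norml; move: lT1 lT2 jth0 th0; move=> *; apply/andP; split; lra.
  have s1 : enorm (Scomp S (g ++ u) x - Scomp S h y) <= expR T.
    apply: (le_trans (ltW close)); rewrite -expRD ler_expR TE.
    have := lrG g Xu Xx0; rewrite ler_norml => /andP[k _]; move: k; rewrite /l.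
    by move: (lr S g _) (lr S g x0) (lr S u x0) => *; lra.
  have s2 := SG (g ++ u) Xx0 (K_sub_X hK Kx); rewrite -/(l (g ++ u)) -/T in s2.
  have s3 := enorm_dist (Scomp S h y) (Scomp S b' x0) (Scomp S (g ++ u) x0).
  have s4 := enorm_dist (Scomp S (g ++ u) x) (Scomp S h y) (Scomp S (g ++ u) x0).
  rewrite enormB in s1; rewrite enormB in s2; rewrite -/(l (g ++ u)) -/T.
  have s5 : (2 * G + 1) * expR T <= A0 * (expR (j%:R * th) * expR th) * expR T.
    rewrite ler_pM2r ?expR_gt0//; apply: le_trans A0E _.
    rewrite -[leLHS]mulr1 ler_wpM2l//; first by lra.
    by rewrite -expRD -[leLHS]expR0 ler_expR addr_ge0.
  by apply: le_trans s5; move: s1 s2 s3 s4 dT; rewrite mulrDl mul1r -mulrA; lra.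
have [cl1 cl2] := cl v' sv'; have [sm1 sm2] := small v' sv'.
have Xv := Scomp_X hS v' Xx0; split.
  have -> : l (g ++ v') - l (g ++ u) =
     (lr S g (Scomp S v' x0) - lr S g (Scomp S u x0)) + (l v' - l u) by rewrite /l !lr_cat; ring.
  apply: le_trans (ler_normD _ _) _; rewrite addrA [leRHS]addrC lerD//.
  exact: le_trans (lrC g Xv Xu sm1) sm2.
rewrite !Scomp_cat; apply: le_trans (SC g Xu sm1) _.
have -> : A0 * (expR (j%:R * th) * expR th) * expR (l (g ++ u)) =
  expR (lr S g (Scomp S u x0) + th) * (A0 * expR (j%:R * th) * expR (l u)).
  by rewrite -/T TE !expRD; ring.
by apply: ler_pM => //; rewrite ?expR_ge0 ?enorm_ge0// ler_expR lerD2l.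
Qed.

End Clusters.

(* Schief's argument: if cylinders of equal length came arbitrarily close to the cylinders with
   suffix [tau], for every [tau], one could append a new word to any cluster of incomparable
   words of comparable size, contradicting the open set condition.  The words are taken so
   long that the distortion is negligible, hence the constants survive all the steps. *)
Lemma separation : open_set_condition X S -> exists tau (c2 : R), 0 < c2 /\
  forall g h x y, size g = size h -> g <> h -> K x -> K y ->
    c2 * expR (l g) <= enorm (Scomp S (g ++ tau) x - Scomp S h y).
Proof.
move=> osc; apply: contrapT => no.
have bad tau (c2 : R) : 0 < c2 -> exists g h x y, [/\ size g = size h, g <> h, K x, K y &
    enorm (Scomp S (g ++ tau) x - Scomp S h y) < c2 * expR (l g)].
  move=> c20; apply: contrapT => no'; apply: no; exists tau, c2; split=> // g h x y sgh gh Kx Ky.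
  by rewrite leNgt; apply/negP => k; apply: no'; exists g, h, x, y.
have [a [b [a0 b0 lrb]]] := lr_bounds d_gt0 hgamma hS hK N_gt0.
have [e [C [e0 C0 lrC SC']]] := distortion d_gt0 hgamma hS N_gt0.
have [G [G0 [lrG SG]]] := distortion_global d_gt0 hgamma hS hK N_gt0.
have SC w x y : X x -> enorm (y - x) < e -> enorm (Scomp S w y - Scomp S w x) <=
    expR (lr S w x + C * enorm (y - x) `^ gamma) * enorm (y - x).
  by move=> Xx xy; have [_ /andP[]] := SC' w x y Xx xy.
have /andP[g0 _] := hgamma.
pose A0 := 2 * G + 1; have A00 : 0 < A0 by rewrite /A0; lra.
have [M hM] := osc_count d_gt0 hgamma hS hK N_gt0 Kx0 osc (A0 * expR 1) (G + b + 1).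
(* [M + 1] steps increase the tolerance in the exponent by at most 1 altogether, which [hM] was
   asked to allow. *)
pose th : R := M.+1%:R^-1; have th0 : 0 < th by rewrite invr_gt0 ltr0n.
have eta0 : 0 < Num.min (e / 2) ((th / C) `^ gamma^-1).
  by rewrite lt_min divr_gt0// powR_gt0// divr_gt0.
have [n2 hn2] := expR_eventually_le (ln (A0 * expR 1)) a0 eta0.
have [n3 hn3] := nat_large (G / a); rewrite ltr_pdivrMr// mulrC in hn3.
pose n1 := maxn n2 n3.
have n1G : G < a * n1%:R.
  by apply: lt_le_trans hn3 _; rewrite ler_pM2l// ler_nat leq_maxr.
have jth j : (j <= M.+1)%N -> j%:R * th <= 1.
  by move=> jM; rewrite /th ler_pdivrMr ?ltr0n// mul1r ler_nat.
have A1E j : (j <= M.+1)%N -> A0 * expR (j%:R * th) <= A0 * expR 1.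
  by move=> jM; rewrite ler_pM2l// ler_expR jth.
have P j : (j <= M.+1)%N -> exists u s, cluster_around A0 (G + b) th n1 j u s.
  elim: j => [_|j IH jM].
    exact: (cluster_around0 th n1 b0 G0 (lexx _) (lexx _)).
  have [u [s cl]] := IH (ltnW jM).
  apply: (cluster_around_grow a0 b0 lrb lrG SG lrC SC G0 _ _ (ltW th0) n1G bad _ cl) => //.
  move=> v sv; have [nu _ _ _ /(_ v sv)[_ close]] := cl.
  set D := enorm _ in close *.
  have D0 : 0 <= D by exact: enorm_ge0.
  have : D <= Num.min (e / 2) ((th / C) `^ gamma^-1).
    apply: le_trans (hn2 n1 (leq_maxl _ _)); apply: (le_trans close).
    apply: le_trans (ler_wpM2r (expR_ge0 _) (A1E j (ltnW jM))) _.
    rewrite -{1}(lnK (_ : A0 * expR 1 \is Num.pos)) ?posrE ?mulr_gt0 ?expR_gt0//.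
    rewrite -expRD ler_expR lerD2l -mulNr.
    have /andP[_ k] := lrb u x0 (K_sub_X hK Kx0); apply: (le_trans k).
    by rewrite !mulNr lerN2 ler_pM2l// ler_nat.
  rewrite le_min => /andP[De Dg]; split; first by move: De e0; lra.
  have : D `^ gamma <= th / C.
    apply: le_trans (_ : ((th / C) `^ gamma^-1) `^ gamma <= _).
      by apply: ge0_ler_powR; rewrite ?nnegrE ?powR_ge0// ltW.
    by rewrite -powRrM mulVf ?gt_eqF// powRr1// divr_ge0// ltW.
  by rewrite ler_pdivlMr// mulrC.
have [u [s [_ us ss anti cl]]] := P M.+1 (leqnn _).
have := hM (Scomp S u x0) (expR (l u)) s (expR_gt0 _) us anti; rewrite ss => /(_ _)/wrap[].
  move=> v /cl[c1 c2]; rewrite expRK; split; last first.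
    by apply: le_trans c1 _; rewrite lerD2l jth.
  by apply: le_trans c2 _; rewrite ler_wpM2r ?expR_ge0// A1E.
by rewrite ltnNge leqnSn.
Qed.

End Separation.

(** * Mass distribution *)

Section BlockMass.
Variables (R : realType) (N : nat).
Hypothesis N_gt0 : (0 < N)%N.
Variables (len : nat -> nat) (om : nat -> seq 'I_N -> R).
Hypothesis len_gt0 : forall j, (0 < len j)%N.
Hypothesis om_ge0 : forall j v, 0 <= om j v.
Hypothesis om_sum : forall j, wsum (len j) (om j) = 1.
Implicit Types (P v w : seq 'I_N) (u : nat -> 'I_N).

Definition pos j := (\sum_(i < j) len i)%N.

Lemma posS j : pos j.+1 = (pos j + len j)%N.
Proof. by rewrite /pos big_ord_recr. Qed.

Lemma leq_pos j : (j <= pos j)%N.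
Proof. by elim: j => // j IH; rewrite posS -addn1 leq_add. Qed.

Lemma pos_homo i j : (i <= j)%N -> (pos i <= pos j)%N.
Proof. by move=> /subnKC <-; rewrite /pos big_split_ord leq_addr. Qed.

Definition block_index m := (\max_(j < m.+1 | (pos j <= m)%N) j)%N.

Lemma block_indexP m : (pos (block_index m) <= m < pos (block_index m).+1)%N.
Proof.
apply/andP; split.
  rewrite /block_index; elim/big_ind: _ => //; first by rewrite /pos big_ord0.
  by move=> x y px py; rewrite /maxn; case: ifP.
rewrite ltnNge; apply/negP => h.
have lt : ((block_index m).+1 < m.+1)%N by rewrite ltnS (leq_trans (leq_pos _)).
by have := @leq_bigmax_cond _ (fun j : 'I_m.+1 => (pos j <= m)%N) val (Ordinal lt) h; rewrite ltnn.
Qed.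

(** The mass of the cylinder of [w], a concatenation of [j] blocks, under the product of the weights
    [om]. *)
Fixpoint block_mass j w : R :=
  if j is j'.+1 then block_mass j' (take (pos j') w) * om j' (drop (pos j') w) else 1.

Lemma block_massS j w v : size w = pos j -> block_mass j.+1 (w ++ v) = block_mass j w * om j v.
Proof. by move=> sw /=; rewrite -sw take_size_cat// drop_size_cat. Qed.

Lemma block_mass_ge0 j w : 0 <= block_mass j w.
Proof. by elim: j w => //= j IH w; rewrite mulr_ge0. Qed.

Lemma wsum_big n (I : Type) (s : seq I) (f : I -> seq 'I_N -> R) :
  wsum n (fun v => \sum_(i <- s) f i v) = \sum_(i <- s) wsum n (f i).
Proof.
elim: s => [|i s IH]; first by rewrite big_nil -[RHS](wsum0 R N n); apply: eq_wsum => v _; rewrite big_nil.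
by rewrite big_cons -IH -wsumD; apply: eq_wsum => v _; rewrite big_cons.
Qed.

(** At most one extension of [w] by [n] letters is a prefix of [P]. *)
Lemma wsum_prefix n (w P : seq 'I_N) (q : R) : 0 <= q ->
  wsum n (fun v => if prefix (w ++ v) P then q else 0) <= if prefix w P then q else 0.
Proof.
move=> q0; case: ifP => wP; last first.
  rewrite -[leRHS](wsum0 R N n); apply: wsum_le => v _.
  by case: ifP => // /catl_prefix; rewrite wP.
have [Q ->] := prefixP wP.
rewrite (@eq_wsum _ _ _ _ (fun v => if prefix v Q then q else 0)); last first.
  by move=> v _; rewrite prefix_catr// eqxx.
elim: n Q {wP} => [|n IH] Q /=; first by rewrite prefix0s.
case: Q => [|i Q]; first by rewrite big1// => j _; rewrite /= wsum0.
rewrite (bigD1 i)//= big1 ?addr0; last first.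
  move=> j ji; rewrite -[RHS](wsum0 R N n); apply: eq_wsum => v _.
  by rewrite /= (negbTE ji).
by apply: le_trans (IH Q); apply: wsum_le => v _; rewrite eqxx.
Qed.

(* Along the path, the mass of the cylinder exceeds the total mass of the
   forbidden cylinders below it, so that the path never meets a forbidden cylinder. *)
Lemma greedy_path (T : nat -> seq (nat * seq 'I_N)) :
  (\sum_(k <oo) (\sum_(q <- T k) block_mass q.1 q.2)%:E < 1)%E ->
  exists u, forall j, 0 < block_mass j (mkseq u (pos j)) /\
    forall k, (j, mkseq u (pos j)) \notin T k.
Proof.
move=> hT.
pose g k w : R := \sum_(q <- T k) if prefix w q.2 then block_mass q.1 q.2 else 0.
have g0 k w : 0 <= g k w.
  by apply: sumr_ge0 => q _; case: ifP => // _; exact: block_mass_ge0.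
pose h w := (\sum_(k <oo) (g k w)%:E)%E.
have hfin w : h w = (fine (h w))%:E.
  rewrite fineK// ge0_fin_numE; last by apply: nneseries_ge0 => k _ _; rewrite lee_fin.
  apply: le_lt_trans (lt_trans hT (ltry 1)); apply: lee_nneseries => [k _ _|k _]; rewrite lee_fin//.
  by apply: ler_sum => q _; case: ifP => // _; exact: block_mass_ge0.
have hsum n w : wsum n (fun v => fine (h (w ++ v))) <= fine (h w).
  rewrite -lee_fin -hfin -tuple_wsum -sumEFin.
  rewrite (eq_bigr (fun v : n.-tuple 'I_N => h (w ++ v))); last by move=> v _; rewrite -hfin.
  rewrite -nneseries_sum; last by move=> v k _; rewrite lee_fin.
  apply: lee_nneseries => [k _ _|k _].
    by apply: sume_ge0 => v _; rewrite lee_fin.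
  rewrite sumEFin lee_fin (tuple_wsum _ (fun v => g k (w ++ v))) /g wsum_big; apply: ler_sum => q _.
  exact/wsum_prefix/block_mass_ge0.
pose inv j w := size w = pos j /\ fine (h w) < block_mass j w.
have step (jw : nat * seq 'I_N) : exists v, inv jw.1 jw.2 ->
    size v = len jw.1 /\ inv jw.1.+1 (jw.2 ++ v).
  case: jw => j w /=; have [i|ni] := pselect (inv j w); last by exists [::].
  have [sw hw] := i; have [v sv hv] : exists2 v, size v = len j &
      fine (h (w ++ v)) < block_mass j w * om j v.
    apply: wsum_lt_ex; rewrite wsumZ om_sum mulr1; exact: le_lt_trans (hsum _ _) hw.
  by exists v => _; split=> //; split; rewrite ?size_cat ?sw ?sv ?posS ?block_massS.
have [f hf] := choice step.
pose path := fix path j := if j is j'.+1 then path j' ++ f (j', path j') else [::].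
have pinv j : inv j (path j).
  elim: j => [|j IH]; last by have [_] := hf (j, path j) IH.
  split; first by rewrite /pos big_ord0.
  rewrite -lte_fin -hfin; apply: le_lt_trans hT; apply: lee_nneseries => [k _ _|k _].
    by rewrite lee_fin.
  by rewrite lee_fin; apply: ler_sum => q _; rewrite prefix0s.
have psub i j : prefix (path i) (path (i + j)%N).
  elim: j => [|j IH]; first by rewrite addn0 prefix_refl.
  by rewrite addnS; apply: (prefix_trans IH) => /=; exact: prefix_prefix.
pose i0 := Ordinal N_gt0; pose u k := nth i0 (path k.+1) k.
have nthp i j k : (i <= j)%N -> (k < pos i)%N -> nth i0 (path i) k = nth i0 (path j) k.
  move=> /subnKC ij ki; have [t ht] := prefixP (psub i (j - i)%N).
  by rewrite -ij ht nth_cat (pinv i).1 ki.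
have uE j : mkseq u (pos j) = path j.
  apply: (@eq_from_nth _ i0); first by rewrite size_mkseq (pinv j).1.
  move=> k; rewrite size_mkseq => kj; rewrite nth_mkseq// /u.
  case: (leqP k.+1 j) => h1; last by rewrite (nthp j k.+1)// ltnW.
  by apply: nthp => //; exact: leq_pos.
exists u => j; rewrite uE; have [sj hj] := pinv j; split.
  apply: le_lt_trans hj; rewrite fine_ge0//; apply: nneseries_ge0 => k _ _.
  by rewrite lee_fin.
move=> k; apply/negP => jk; move: hj; apply/negP; rewrite -leNgt -lee_fin -hfin.
apply: (@le_trans _ _ (g k (path j))%:E).
  rewrite lee_fin /g (big_rem _ jk) /= prefix_refl lerDl; apply: sumr_ge0 => q _.
  by case: ifP => // _; exact: block_mass_ge0.
rewrite /h (nneseries_split 0 k.+1); last by move=> ? _; rewrite lee_fin.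
rewrite add0n big_mkord big_ord_recr /= -[leLHS]add0e -addeA leeD//.
  by apply: sume_ge0 => i _; rewrite lee_fin.
by rewrite leeDl// nneseries_ge0// => i _ _; rewrite lee_fin.
Qed.

End BlockMass.

Lemma take_mkseq (T : Type) (u : nat -> T) m n : (m <= n)%N -> take m (mkseq u n) = mkseq u m.
Proof. by move=> mn; rewrite /mkseq -map_take take_iota (minn_idPl mn). Qed.

Section MassDistribution.
Variables (R : realType) (d N : nat) (K : set 'rV[R]_d) (S : 'I_N -> 'rV[R]_d -> 'rV[R]_d).
Variables (Phi L : seq 'I_N -> R) (a b c : R) (beta : R -> R) (x0 : 'rV[R]_d) (G : R).
Variable proj : (nat -> 'I_N) -> 'rV[R]_d.
Hypothesis N_gt0 : (0 < N)%N.
Hypothesis gs : gibbs_system Phi L a b c beta.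
Hypothesis Kx0 : K x0.
Hypothesis G0 : 0 < G.
Hypothesis diamL : forall w x y, K x -> K y -> enorm (Scomp S w x - Scomp S w y) <= G * expR (L w).
Hypothesis countL : forall A kap : R, exists M : nat, forall (z : 'rV[R]_d) (r : R)
  (s : seq (seq 'I_N)), 0 < r -> uniq s ->
  (forall v w, v \in s -> w \in s -> prefix v w -> v = w) ->
  (forall v, v \in s -> enorm (Scomp S v x0 - z) <= A * r /\ `|L v - ln r| <= kap) ->
  (size s <= M)%N.
Hypothesis hproj : projection S K proj.
Variables (len : nat -> nat) (om : nat -> seq 'I_N -> R).
Hypothesis len_gt0 : forall j, (0 < len j)%N.
Hypothesis om_ge0 : forall j v, 0 <= om j v.
Hypothesis om_sum : forall j, wsum (len j) (om j) = 1.

Definition block_codes : set (nat -> 'I_N) :=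
  [set u | forall j, 0 < block_mass len om j (mkseq u (pos len j))].

Lemma block_codes_neq0 : block_codes !=set0.
Proof.
have [|u hu] := greedy_path N_gt0 len_gt0 om_ge0 om_sum (T := fun=> [::]).
  by rewrite eseries0// => k _ _; rewrite big_nil.
by exists u => j; have [] := hu j.
Qed.

Variables (s D : R).
Hypothesis s0 : 0 < s.
Hypothesis D0 : 0 < D.
Hypothesis mass_bound : forall j w, (pos len j <= size w <= pos len j.+1)%N ->
  block_mass len om j (take (pos len j) w) <= D * expR (s * L w).

(** At most [M] cylinders of the size of [U k] meet it, and each has block mass at most [D] times
    the [s]-th power of that size. Forbidding all of them costs less than 1, so a greedy path avoids
    every [U k]. *)
Lemma cover_block_codes : exists2 e : R, 0 < e & forall U : nat -> set 'rV[R]_d,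
  (forall k, (ediam (U k) <= 1)%E) -> (\sum_(k <oo) ediam (U k) `^ s < e%:E)%E ->
  exists2 u, block_codes u & forall k, ~ U k (proj u).
Proof.
have [[[a0 b0] c0] [G0' s0']] := (gs_a gs, gs_b gs, gs_c gs, (G0, s0)).
pose kap := b + 2 * c; have [M hM] := countL (G + 1) kap.
pose MD := M%:R * D; have MD0 : 0 <= MD by rewrite mulr_ge0// ltW.
pose e := (4 * (1 + MD))^-1.
have e0 : 0 < e by rewrite invr_gt0; lra.
have e1 : e <= 4^-1 by rewrite lef_pV2 ?posrE//; lra.
have eMD : MD * (2 * e) < 1.
  rewrite /e invfM [2 * _]mulrA mulrA ltr_pdivrMr; last by lra.
  by lra.
exists e => // U U1 Ue.
pose dl k := fine (ediam (U k)).
have dlE k : ediam (U k) = (dl k)%:E.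
  rewrite /dl fineK// ge0_fin_numE ?ediam_ge0//; exact: le_lt_trans (U1 k) (ltry _).
have dl0 k : 0 <= dl k by rewrite -lee_fin -dlE ediam_ge0.
(* The second summand gives a positive size to sets of diameter 0 too, at total cost [e]. *)
pose q k : R := dl k `^ s + e / (2 ^ k.+1)%:R.
have q0 k : 0 < q k by rewrite ltr_wpDl ?powR_ge0// divr_gt0// ltr0n expn_gt0.
have qsum : (\sum_(k <oo) (q k)%:E < (2 * e)%:E)%E.
  apply: (@le_lt_trans _ _ (\sum_(k <oo) ediam (U k) `^ s + e%:E)%E); last first.
    have -> : 2 * e = e + e by ring.
    by rewrite EFinD lteD2rE.
  apply: le_trans (epsilon_trick xpredT _ (ltW e0)); last by move=> k; exact: poweR_ge0.
  by apply: lee_nneseries => [k _ _|k _]; rewrite ?lee_fin ?(ltW (q0 _))// dlE.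
have q1 k : q k < 1.
  have h : ((q k)%:E <= \sum_(k <oo) (q k)%:E)%E.
    rewrite (nneseries_split 0 k.+1); last by move=> ? _; rewrite lee_fin ltW.
    rewrite add0n big_mkord big_ord_recr /= -[leLHS]add0e -addeA leeD//.
      by apply: sume_ge0 => i _; rewrite lee_fin ltW.
    by rewrite leeDl// nneseries_ge0// => i _ _; rewrite lee_fin ltW.
  have := le_lt_trans h qsum; rewrite lte_fin => h'; apply: (lt_trans h'); lra.
pose T k := s^-1 * ln (q k); pose r k := expR (T k).
have T0 k : T k <= 0.
  by rewrite /T mulr_ge0_le0 ?invr_ge0 ?(ltW s0)// ln_le0// ltW.
have rs k : expR (s * T k) = q k by rewrite /T mulVKf ?gt_eqF// lnK// posrE.
have dr k : dl k <= r k.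
  have [->|dn0] := eqVneq (dl k) 0; first exact: expR_ge0.
  have dp : 0 < dl k by rewrite lt_neqAle eq_sym dn0 dl0.
  rewrite -[leLHS](lnK (_ : dl k \is Num.pos)) ?posrE// ler_expR /T mulrC ler_pdivlMr//.
  rewrite mulrC -ln_powR ler_ln ?posrE ?powR_gt0 ?q0//.
  by rewrite /q lerDl divr_ge0// ltW.
have [n hn] := choice (fun k => scale_cut gs (T0 k)).
pose W k := [seq w <- wcut [pred v | L v <= T k] (n k) [::]
               | `[< exists2 y, K y & U k (Scomp S w y) >]].
have WP k w : w \in W k -> [/\ exists2 y, K y & U k (Scomp S w y),
    w \in wcut [pred v | L v <= T k] (n k) [::] & T k - b - 2 * c <= L w <= T k].
  rewrite mem_filter => /andP[/asboolP h wc]; split=> //.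
  by have [_ h2] := hn k; exact: h2.
have WM k : (size (W k) <= M)%N.
  case: (posnP (size (W k))) => [->//|Wk].
  have w0W : nth [::] (W k) 0 \in W k by rewrite mem_nth.
  have [[y0 Ky0 Uy0] _ _] := WP k _ w0W.
  apply: (hM (Scomp S (nth [::] (W k) 0) y0) (r k)) => //.
  - exact: expR_gt0.
  - by rewrite filter_uniq// wcut_uniq.
  - by move=> v w /WP[_ vc _] /WP[_ wc _]; exact: wcut_antichain vc wc.
  move=> v /WP[[y Ky Uy] _ /andP[h1 h2]]; rewrite expRK; split; last first.
    by rewrite ler_norml /kap; apply/andP; split; lra.
  have := enorm_dist (Scomp S v y) (Scomp S v x0) (Scomp S (nth [::] (W k) 0) y0).
  have := diamL v Kx0 Ky.
  have : G * expR (L v) <= G * r k by rewrite ler_pM2l// ler_expR.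
  have : enorm (Scomp S v y - Scomp S (nth [::] (W k) 0) y0) <= r k.
    apply: le_trans (dr k); rewrite -lee_fin -dlE; apply: ereal_sup_ubound; right.
    by exists (Scomp S v y), (Scomp S (nth [::] (W k) 0) y0).
  by rewrite mulrDl mul1r; lra.
(* Masses are attached to complete blocks, so a word is forbidden through its longest prefix made of
   complete blocks. *)
pose bk (w : seq 'I_N) := block_index len (size w).
have bkP (w : seq 'I_N) : (pos len (bk w) <= size w <= pos len (bk w).+1)%N.
  by have /andP[h1 h2] := block_indexP len_gt0 (size w); rewrite h1 ltnW.
have [u hu] : exists u, forall j, 0 < block_mass len om j (mkseq u (pos len j)) /\
    forall k, (j, mkseq u (pos len j)) \notin [seq (bk w, take (pos len (bk w)) w) | w <- W k].
  apply: (greedy_path N_gt0 len_gt0 om_ge0 om_sum).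
  apply: (@le_lt_trans _ _ (\sum_(k <oo) (MD%:E * (q k)%:E))%E).
    apply: lee_nneseries => [k _ _|k _].
      by rewrite lee_fin; apply: sumr_ge0 => p _; exact: block_mass_ge0.
    rewrite lee_fin big_map /=; apply: (@le_trans _ _ ((size (W k))%:R * (D * q k))).
      apply: sum_le_size => w /WP[_ _ /andP[_ h]]; apply: le_trans (mass_bound (bkP w)) _.
      by rewrite ler_pM2l// -rs ler_expR ler_pM2l.
    by rewrite /MD -mulrA ler_wpM2r ?ler_nat// mulr_ge0// ltW.
  rewrite nneseriesZl; last by move=> k _; rewrite lee_fin ltW.
  apply: (@le_lt_trans _ _ (MD%:E * (2 * e)%:E)%E); last by rewrite -EFinM lte_fin.
  by rewrite lee_wpmul2l// ?lee_fin// ltW.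
exists u; first by move=> j; have [] := hu j.
move=> k Uk; pose z := mkseq u (n k).
have [w wc wz] : exists2 w, w \in wcut [pred v | L v <= T k] (n k) [::] & prefix w z.
  by apply: wcut_cover; rewrite ?prefix0s// /z size_mkseq.
have wE : w = mkseq u (size w).
  move: (wz); rewrite prefixE => /eqP {1}<-; rewrite take_mkseq//.
  by have := size_prefix wz; rewrite size_mkseq.
have ww : w \in W k.
  rewrite mem_filter wc andbT; apply/asboolP.
  have := proj_in hproj u (size w); rewrite -wE => -[y Ky hy].
  by exists y => //; rewrite hy.
have [_ /(_ k) /negP[]] := hu (bk w); apply/mapP; exists w => //; congr pair.
have /andP[h _] := bkP w.
by rewrite -[LHS](take_mkseq u h) -wE.
Qed.

Lemma hausdorff_block_codes (E : set 'rV[R]_d) : proj @` block_codes `<=` E ->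
  hausdorff_measure s E <> 0%E.
Proof.
move=> hE; have [e e0 he] := cover_block_codes.
have : (e%:E <= hausdorff_measure s E)%E.
  apply: (@le_trans _ _ (hausdorff_premeasure s 1 E)); last first.
    by apply: ereal_sup_ubound; exists 1 => //=.
  apply: le_ereal_inf_tmp => _ [U [EU U1] <-]; rewrite leNgt; apply/negP => lt.
  have [u uc nu] := he U U1 lt.
  have [k _ Uk] : (\bigcup_k U k) (proj u) by apply/EU/hE; exists u.
  exact: nu Uk.
by move=> h h0; move: h; rewrite h0 lee_fin leNgt e0.
Qed.

End MassDistribution.

(** * The Moran set *)

Section CodeLocalRatio.
Variables (R : realType) (d N : nat) (K : set 'rV[R]_d) (S : 'I_N -> 'rV[R]_d -> 'rV[R]_d).
Variables (p : 'I_N -> R) (mu : probability (g_sigma_algebraType (@open 'rV[R]_d)) R).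
Variables (L : seq 'I_N -> R) (a b c : R) (beta : R -> R) (G : R).
Variable proj : (nat -> 'I_N) -> 'rV[R]_d.
Hypothesis gs : gibbs_system (logp p) L a b c beta.
Hypothesis hp : forall i, 0 < p i.
Hypothesis G0 : 0 < G.
Hypothesis diamL : forall w x y, K x -> K y -> enorm (Scomp S w x - Scomp S w y) <= G * expR (L w).
Hypothesis mass_ge : forall A w, open A -> (forall y, K y -> A (Scomp S w y)) ->
  prodp p w <= mass mu A.
Hypothesis mass_le : forall B stop n, open B -> mass mu B <=
  \sum_(w <- wcut stop n [::] | `[< exists2 y, K y & B (Scomp S w y) >]) prodp p w.
Hypothesis hproj : projection S K proj.
Variables (tau : seq 'I_N) (c2 : R).
Hypothesis c20 : 0 < c2.
Hypothesis sep : forall g h x y, size g = size h -> g <> h -> K x -> K y ->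
  c2 * expR (L g) <= enorm (Scomp S (g ++ tau) x - Scomp S h y).

Section OneCode.
Variables (u : nat -> 'I_N).
Let w n := mkseq u n.

(** When [tau] follows [w n], separation keeps every other cylinder of generation [n] outside the
    ball. *)
Lemma code_mass_le n (r : R) : w (n + size tau) = w n ++ tau -> r <= c2 * expR (L (w n)) ->
  mass mu (eball (proj u) r) <= prodp p (w n).
Proof.
move=> ht hr; apply: le_trans (mass_le xpred0 n (@eball_open _ _ (proj u) r)) _.
rewrite -big_filter; set s := [seq _ <- _ | _].
have sw v : v \in s -> v = w n.
  rewrite mem_filter => /andP[/asboolP[y Ky yr] vc]; apply: contrapT => vn.
  have [//|sv] := wcut_stop vc; rewrite add0n in sv.
  have [z Kz hz] := proj_in hproj u (n + size tau); rewrite -/(w _) ht in hz.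
  have h1 : size (w n) = size v by rewrite size_mkseq sv.
  have h2 : w n <> v by move/esym.
  have := sep h1 h2 Kz Ky; rewrite hz leNgt => /negP; apply.
  by apply: lt_le_trans hr; rewrite enormB.
have ss : (size s <= 1)%N.
  apply: (@uniq_leq_size _ s [:: w n]); first by rewrite filter_uniq// wcut_uniq.
  by move=> v /sw ->; rewrite mem_head.
apply: le_trans (sum_le_size (B := prodp p (w n)) _) _; first by move=> v /sw ->.
by rewrite -[leRHS]mul1r ler_wpM2r ?ler_nat ?(ltW (prodp_gt0 hp _))// (ler_nat _ _ 1).
Qed.

Lemma code_mass_ge n (r : R) : G * expR (L (w n)) < r ->
  prodp p (w n) <= mass mu (eball (proj u) r).
Proof.
move=> hr; apply: mass_ge; first exact: eball_open.
move=> y Ky; rewrite /eball /=; have [z Kz <-] := proj_in hproj u n.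
exact: le_lt_trans (diamL _ Ky Kz) hr.
Qed.

Lemma code_catE n' n : (n' <= n)%N -> exists2 t, size t = (n - n')%N & w n = w n' ++ t.
Proof.
move=> nn; exists (drop n' (w n)); first by rewrite size_drop size_mkseq.
by rewrite -[w n'](take_mkseq u nn) cat_take_drop.
Qed.

Lemma code_scale (r : R) : 0 < r -> r <= G * expR (L [::]) -> exists n,
  ln r - ln G - b - 2 * c <= L (w n) < ln r - ln G.
Proof.
move=> r0 r1; have [[a0 b0] c0] := (gs_a gs, gs_b gs, gs_c gs).
pose T := ln r - ln G.
have ex : exists n, L (w n) < T.
  have [n hn] := nat_large ((c - T) / a); exists n; move: hn; rewrite ltr_pdivrMr// => h.
  by apply: le_lt_trans (gs_L_ub gs _) _; rewrite size_mkseq mulNr [a * _]mulrC; lra.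
case: (ex_minnP ex) => -[|n] hn nmin.
  exfalso; move: hn; apply/negP; rewrite -leNgt /T.
  rewrite -ln_div ?posrE// -ler_expR lnK ?posrE ?divr_gt0//.
  by rewrite ler_pdivrMr// mulrC.
exists n.+1; rewrite hn andbT.
have hT : T <= L (w n).
  by rewrite leNgt; apply/negP => /nmin; rewrite ltnn.
have [t st ->] := code_catE (leqnSn n).
have := gs_L_cat gs (w n) t; rewrite ler_norml => /andP[h _].
have := gs_L_lb gs t; rewrite st subSnn mulr1 => h'.
by move: hT; rewrite /T; lra.
Qed.

Variable alpha : R.
Hypothesis slope : forall e : R, 0 < e -> exists n0, forall n, (n0 <= n)%N ->
  `|logp p (w n) - alpha * L (w n)| <= e * n%:R.
Hypothesis dense : forall e : R, 0 < e -> exists n0, forall n, (n0 <= n)%N ->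
  exists n', [/\ (n <= n')%N, n'%:R <= n%:R + e * n%:R & w (n' + size tau) = w n' ++ tau].

(** Start about [2 e n] letters before [n]: [dense] finds an occurrence of [tau] within the next
    [e n] letters, hence still at least [e n >= C] letters before [n]. *)
Lemma good_prefix (e : R) (C : R) : 0 < e <= 4^-1 -> exists n0, forall n, (n0 <= n)%N -> exists n',
  [/\ (n' <= n)%N, C <= (n - n')%:R :> R, (n - n')%:R <= 3 * e * n%:R :> R &
   w (n' + size tau) = w n' ++ tau].
Proof.
move=> /andP[e0 e4]; have [m0 hm0] := dense e0.
have [n1 hn1] := nat_large (C / e); have [n2 hn2] := nat_large (1 / e).
have [n3 hn3] := nat_large (4 * m0%:R : R).
rewrite ltr_pdivrMr// in hn1; rewrite ltr_pdivrMr// in hn2.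
exists (n1 + n2 + n3)%N => n nn.
have big m : (m <= n1 + n2 + n3)%N -> (m%:R <= n%:R :> R).
  by move=> h; rewrite ler_nat (leq_trans h).
have k1 : C <= n%:R * e.
  apply: le_trans (ltW hn1) _; rewrite ler_pM2r//; apply: big; by rewrite -addnA leq_addr.
have k2 : 1 <= n%:R * e.
  apply: le_trans (ltW hn2) _; rewrite ler_pM2r//; apply: big.
  by rewrite -addnA addnCA leq_addr.
have k3 : 4 * m0%:R <= n%:R :> R.
  by apply: le_trans (ltW hn3) _; apply: big; rewrite leq_addl.
have t0 : 0 <= 2 * e * n%:R by rewrite !mulr_ge0// ltW.
have /andP[j1 j2] := truncn_itv t0; set j := Num.truncn _ in j1 j2.
have e3 : n%:R * e <= n%:R * 4^-1 by rewrite ler_wpM2l.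
have jn : (j.+1 <= n)%N.
  by rewrite -(ler_nat R) -natr1; move: j1; rewrite -mulrA [e * _]mulrC; lra.
have kE : (n - j.+1)%:R = n%:R - j.+1%:R :> R by rewrite natrB.
have k0 : (m0 <= n - j.+1)%N.
  by rewrite -(ler_nat R) kE -natr1; move: j1; rewrite -mulrA [e * _]mulrC; lra.
have [n' [n'1 n'2 ht]] := hm0 _ k0.
have q1 : (n - j.+1)%:R <= n'%:R :> R by rewrite ler_nat.
have q2 : e * (n - j.+1)%:R <= n%:R * e.
  by rewrite mulrC ler_pM2r// ler_nat leq_subr.
rewrite kE in q1; rewrite kE in n'2; rewrite kE in q2; rewrite -natr1 in q1 n'2 q2 j2.
move: j1 j2; rewrite -mulrA [e * _]mulrC => j1 j2.
have le' : n'%:R <= n%:R - C by lra.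
have le2 : (n' <= n)%N by rewrite -(ler_nat R); move: k1 k2; lra.
by exists n'; split=> //; rewrite natrB//; lra.
Qed.

(** The mass of the ball lies between the weights of two prefixes: one of size about [r], and a
    shorter one followed by [tau]. Their lengths differ by at most [3 q n], which moves [logp] by a
    small multiple of [n]. *)
Lemma local_ratio_cvg : local_ratio mu (proj u) r @[r --> 0^'+] --> alpha.
Proof.
have [[a0 b0] c0] := (gs_a gs, gs_b gs, gs_c gs).
apply/cvgrPdist_le => e e0; apply/near_right0P.
pose C1 := `|ln G| + b + 2 * c.
have C10 : 0 <= C1 by rewrite /C1 !addr_ge0// mulr_ge0.
pose q := Num.min 4^-1 (e * a / (4 * (3 * b + 1))).
have b1 : 0 < 3 * b + 1 by lra.
have q0 : 0 < q by rewrite lt_min invr_gt0 ltr0n/= divr_gt0 ?mulr_gt0//.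
have q4 : q <= 4^-1 by rewrite ge_min lexx.
have qe : (3 * b + 1) * q <= e * a / 4.
  rewrite -ler_pdivlMl//; apply: (@le_trans _ _ (e * a / (4 * (3 * b + 1)))).
    by rewrite ge_min lexx orbT.
  by rewrite invfM mulrA mulrC.
have [m1 hm1] := @good_prefix q ((C1 + 2 * c - ln c2) / a) (introT andP (conj q0 q4)).
have [m2 hm2] := slope q0.
have [m3 hm3] := nat_large (4 * (`|alpha| * C1 + 1) / (e * a)).
rewrite ltr_pdivrMr ?mulr_gt0// in hm3.
have [m4 hm4] := nat_large (2 * (c + C1 + 1) / a); rewrite ltr_pdivrMr// in hm4.
pose m0 := (m1 + m2 + (m3 + m4))%N.
exists (Num.min (G * expR (L [::])) (Num.min (expR (- 1)) (expR (ln G - b * m0%:R - c)))).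
  by rewrite !lt_min mulr_gt0 ?expR_gt0.
move=> r /andP[r0]; rewrite !lt_min => /and3P[rG re1 rm].
have lr1 : ln r < - 1 by rewrite -[- 1]expRK ltr_ln ?posrE ?expR_gt0.
have lrm : ln r < ln G - b * m0%:R - c by rewrite -[ltRHS]expRK ltr_ln ?posrE ?expR_gt0.
have [n /andP[Ln1 Ln2]] := code_scale r0 (ltW rG).
have nm : (m0 <= n)%N.
  rewrite leqNgt; apply/negP => h; have := gs_L_lb gs (w n); rewrite size_mkseq.
  have : b * n%:R <= b * m0%:R by rewrite ler_wpM2l// ler_nat ltnW.
  by rewrite mulNr; lra.
have big m : (m <= m0)%N -> (m%:R <= n%:R :> R) by move=> h; rewrite ler_nat (leq_trans h).
have n1 : (m1 <= n)%N by apply: leq_trans nm; rewrite /m0 -addnA leq_addr.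
have n2 : (m2 <= n)%N by apply: leq_trans nm; rewrite /m0 -addnA addnCA leq_addr.
have n3 : m3%:R * (e * a) <= n%:R * (e * a).
  by rewrite ler_pM2r ?mulr_gt0//; apply: big; rewrite /m0 addnCA leq_addr.
have n4 : m4%:R * a <= n%:R * a by rewrite ler_pM2r//; apply: big; rewrite /m0 addnA leq_addl.
have [n' [n'n dC d3 ht]] := hm1 n n1.
have [t st wt] := code_catE n'n.
rewrite ler_pdivrMr// in dC.
have Gl : - `|ln G| <= ln G <= `|ln G| by rewrite -ler_norml.
have /andP[Gl1 Gl2] := Gl.
have up : mass mu (eball (proj u) r) <= prodp p (w n').
  apply: code_mass_le => //; rewrite -(lnK (_ : c2 \is Num.pos)) ?posrE// -expRD.
  rewrite -[leLHS](lnK (_ : r \is Num.pos)) ?posrE// ler_expR.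
  have := gs_L_cat gs (w n') t; rewrite -wt ler_norml => /andP[_ k1].
  have := gs_L_ub gs t; rewrite st mulNr [a * _]mulrC => k2.
  by rewrite /C1 in dC; lra.
have lo : prodp p (w n) <= mass mu (eball (proj u) r).
  apply: code_mass_ge; rewrite -{1}(lnK (_ : G \is Num.pos)) ?posrE// -expRD.
  by rewrite -[ltRHS](lnK (_ : r \is Num.pos)) ?posrE// ltr_expR; lra.
have m_gt0 : 0 < mass mu (eball (proj u) r) by apply: lt_le_trans lo; exact: prodp_gt0.
rewrite /local_ratio -/(mass mu _).
have {}up : ln (mass mu (eball (proj u) r)) <= logp p (w n').
  by rewrite ler_ln ?posrE// prodp_gt0.
have {}lo : logp p (w n) <= ln (mass mu (eball (proj u) r)).
  by rewrite ler_ln ?posrE// prodp_gt0.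
move: up lo; set lm := ln (mass _ _) => up lo.
have := hm2 n n2; rewrite ler_norml => /andP[s1 s2].
have := gs_Phi_bound gs t; rewrite st ler_norml => /andP[p1 _].
have pE : logp p (w n) = logp p (w n') + logp p t by rewrite wt (gs_Phi_cat gs).
have bd : b * (n - n')%:R <= b * (3 * q * n%:R) by rewrite ler_wpM2l.
have aL : `|alpha * (L (w n) - ln r)| <= `|alpha| * C1.
  rewrite normrM ler_wpM2l// ler_norml /C1; apply/andP; split; lra.
move: aL; rewrite mulrBr ler_norml => /andP[aL1 aL2].
have lr0 : ln r < 0 by lra.
have -> : alpha - lm / ln r = (alpha * ln r - lm) / ln r by field; rewrite lt_eqF.
rewrite normrM normfV (ltr0_norm lr0) ler_pdivrMr ?oppr_gt0//.
have qn : (3 * b + 1) * q * n%:R <= e * a / 4 * n%:R by rewrite ler_wpM2r.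
have tot : `|alpha * ln r - lm| <= (3 * b + 1) * q * n%:R + `|alpha| * C1.
  have -> : (3 * b + 1) * q * n%:R = b * (3 * q * n%:R) + q * n%:R by ring.
  move: bd s1 s2 p1 aL1 aL2 lo up; rewrite pE.
  move: (b * (n - n')%:R) (b * (3 * q * n%:R)) (q * n%:R) (alpha * L _) (alpha * ln r).
  move: (`|alpha| * C1) (logp p t) (logp p _) lm => *.
  by rewrite ler_norml; apply/andP; split; lra.
apply: (le_trans tot).
have an : a * n%:R / 2 <= - ln r.
  have := gs_L_ub gs (w n); rewrite size_mkseq mulNr [a * _]mulrC.
  by move: Ln1; rewrite /C1 in hm4; lra.
have ean : e * (a * n%:R / 2) <= e * (- ln r) by rewrite ler_pM2l.
have e1 : e * (a * n%:R / 2) = e * a / 4 * n%:R + n%:R * (e * a) / 4 by field.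
by move: qn ean hm3 n3; rewrite e1; lra.
Qed.

End OneCode.

End CodeLocalRatio.
(* Used for the lengths [m (k j)] of the blocks of a Moran set: every block is negligible with
   respect to the blocks that precede it, so the slope converges along all prefixes. *)
Lemma slow_index (m : nat -> nat) : exists k : nat -> nat,
  (forall n, exists J, forall j, (J <= j)%N -> (n <= k j)%N) /\
  (forall e, exists J, forall j, (J <= j)%N -> (m (k j) * e <= j)%N).
Proof.
pose k j := (\max_(i < j.+1 | (m i * i <= j)%N) i)%N.
have kj j : (m (k j) * k j <= j)%N.
  rewrite /k; elim/big_ind: _ => //; first by rewrite muln0.
  by move=> x y px py; rewrite /maxn; case: ifP.
have kinf n : exists J, forall j, (J <= j)%N -> (n <= k j)%N.
  exists (n + m n * n)%N => j nj.
  have nj' : (n < j.+1)%N by rewrite ltnS (leq_trans _ nj)// leq_addr.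
  apply: (@leq_bigmax_cond _ (fun i : 'I_j.+1 => (m i * i <= j)%N) val (Ordinal nj')).
  by rewrite (leq_trans _ nj)// leq_addl.
exists k; split=> // e; have [J hJ] := kinf e; exists J => j /hJ ek.
by apply: leq_trans (kj j); rewrite leq_mul2l ek orbT.
Qed.

(** * Blocks of the Moran set *)

Section Moran.
Variables (R : realType) (N : nat) (Phi L : seq 'I_N -> R) (a b c : R) (beta : R -> R).
Hypothesis gs : gibbs_system Phi L a b c beta.
Hypothesis N_gt0 : (0 < N)%N.
Variables (alpha t t' : R) (tau : seq 'I_N).
Hypothesis star : forall y, t' <= alpha * y + beta y.
Hypothesis tt' : t < t'.

Let weight (k : nat) w := if `|word_slope Phi L w - alpha| < k.+1%:R^-1 then expR (t * L w) else 0.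

(** Each block ends with [tau] and brings two concatenation errors. Dividing the weights by this
    constant pays for them in advance, so that [block_mass_le] has no loss per block. *)
Let Gmin := expR (t * (2 * c - L tau)).

Let lengths : exists m : nat -> nat, forall k, [/\ (k < m k)%N,
  forall w, size w = m k -> L w < 0 & Gmin <= wsum (m k) (weight k)].
Proof.
suff h k : exists m, [/\ (k < m)%N, forall w, size w = m -> L w < 0 & Gmin <= wsum m (weight k)].
  by have [m hm] := choice h; exists m.
have r0 : 0 < k.+1%:R^-1 :> R by rewrite invr_gt0 ltr0n.
have [rho [rho0 [n0 hn0]]] := core_lower gs star tt' r0.
have [n1 hn1] := L_neg_large gs; have [n2 hn2] := nat_large (t * (2 * c - L tau) / rho).
rewrite ltr_pdivrMr// in hn2; pose m := (k.+1 + n0 + n1 + n2)%N; exists m.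
have a0 := gs_a gs; split.
- by rewrite /m -!addnA leq_addr.
- move=> w wm; apply: (@le_lt_trans _ _ (- (a / 2) * (size w)%:R)).
    by apply: hn1; rewrite wm /m -addnA addnCA leq_addr.
  by rewrite mulNr oppr_lt0 mulr_gt0 ?divr_gt0// wm ltr0n.
have h : (n0 <= m)%N by rewrite /m -!addnA addnCA leq_addr.
apply: le_trans (hn0 m h); rewrite ler_expR [leRHS]mulrC; apply: le_trans (ltW hn2) _.
by rewrite ler_pM2r// ler_nat leq_addl.
Qed.

Lemma wsum_single (v0 : seq 'I_N) (q : R) :
  wsum (size v0) (fun v => if v == v0 then q else 0) = q.
Proof.
elim: v0 => [|i v0 IH] //=.
rewrite (bigD1 i)//= big1 ?addr0.
  by rewrite -[RHS]IH; apply: eq_wsum => v _; rewrite eqseq_cons eqxx.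
move=> j ji; rewrite -[RHS](wsum0 R N (size v0)); apply: eq_wsum => v _.
by rewrite eqseq_cons (negbTE ji).
Qed.

(** The weights [expR (t * L w)] of the words with slope near [alpha] are normalised; exponential
    growth of their sum makes the normaliser at least [Gmin]. The tolerance shrinks with [k j], and
    [slow_index] keeps the blocks short. *)
Lemma moran_blocks : exists (len : nat -> nat) (om : nat -> seq 'I_N -> R) (l k : nat -> nat),
  [/\ forall j, len j = (l j + size tau)%N /\ (k j < l j)%N,
      forall j v, 0 <= om j v,
      forall j, wsum (len j) (om j) = 1,
      forall j v, 0 < om j v -> exists w, [/\ v = w ++ tau, size w = l j,
        L w < 0, `|word_slope Phi L w - alpha| < (k j).+1%:R^-1 &
        om j v <= expR (t * L w) / Gmin] &
      (forall n, exists J, forall j, (J <= j)%N -> (n <= k j)%N) /\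
      (forall e, exists J, forall j, (J <= j)%N -> (l j * e <= j)%N)].
Proof.
have [m hm] := lengths; have [k [kinf kslow]] := slow_index m.
pose l j := m (k j); pose W j := wsum (l j) (weight (k j)).
pose om j v := if (size v == l j + size tau)%N && (drop (l j) v == tau) then weight (k j) (take (l j) v) / W j else 0.
have G0 : 0 < Gmin := expR_gt0 _.
have W0 j : 0 < W j by have [_ _] := hm (k j); apply: lt_le_trans.
have weight0 i w : 0 <= weight i w by rewrite /weight; case: ifP => // _; exact: expR_ge0.
have om0 j v : 0 <= om j v by rewrite /om; case: ifP => // _; rewrite divr_ge0// ltW.
exists (fun j => l j + size tau)%N, om, l, k; split=> //.
- by move=> j; split=> //; have [] := hm (k j).
- move=> j; rewrite wsum_cat -(divff (lt0r_neq0 (W0 j))) {2}/W -wsumZr.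
  apply: eq_wsum => w sw; rewrite -[RHS](wsum_single tau); apply: eq_wsum => v sv.
  by rewrite /om size_cat sw sv eqxx /= drop_size_cat// take_size_cat.
move=> j v; rewrite /om; case: ifP => [/andP[/eqP sv /eqP dv]|_]; last by rewrite ltxx.
rewrite /weight; case: ifP => [hw|_]; last by rewrite mul0r ltxx.
move=> _; exists (take (l j) v); have [jl neg WG] := hm (k j).
have {}sv : size (take (l j) v) = l j by rewrite size_takel// sv leq_addr.
split=> //; first by rewrite -dv cat_take_drop.
  exact: neg.
by rewrite ler_pM2l ?expR_gt0// lef_pV2 ?posrE.
Qed.

End Moran.

Section MoranCodes.
Variables (R : realType) (N : nat) (Phi L : seq 'I_N -> R) (a b c : R) (beta : R -> R).
Hypothesis gs : gibbs_system Phi L a b c beta.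
Variables (alpha t : R) (tau : seq 'I_N).
Let Gmin := expR (t * (2 * c - L tau)).
Variables (len : nat -> nat) (om : nat -> seq 'I_N -> R) (l k : nat -> nat).
Hypothesis lenE : forall j, len j = (l j + size tau)%N /\ (k j < l j)%N.
Hypothesis om_ge0 : forall j v, 0 <= om j v.
Hypothesis omP : forall j v, 0 < om j v -> exists w, [/\ v = w ++ tau, size w = l j,
  L w < 0, `|word_slope Phi L w - alpha| < (k j).+1%:R^-1 &
  om j v <= expR (t * L w) / Gmin].
Hypothesis k_large : forall n, exists J, forall j, (J <= j)%N -> (n <= k j)%N.
Hypothesis l_slow : forall e, exists J, forall j, (J <= j)%N -> (l j * e <= j)%N.

Local Notation pos := (pos len).
Let len_gt0 j : (0 < len j)%N.
Proof. by have [-> h] := lenE j; rewrite addn_gt0 (leq_ltn_trans _ h). Qed.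

Let dev w := Phi w - alpha * L w.
Let b1 := b + `|alpha| * b.
Let c1 := 2 * (`|alpha| * c).

Let b10 : 0 <= b1. Proof. by rewrite addr_ge0 ?mulr_ge0 ?(gs_b gs). Qed.
Let c10 : 0 <= c1. Proof. by rewrite !mulr_ge0 ?(gs_c gs). Qed.

Let dev_cat v w : `|dev (v ++ w) - dev v - dev w| <= c1.
Proof.
have -> : dev (v ++ w) - dev v - dev w = - (alpha * (L (v ++ w) - L v - L w)).
  by rewrite /dev (gs_Phi_cat gs); ring.
rewrite normrN normrM /c1; apply: (@le_trans _ _ (`|alpha| * c)).
  by rewrite ler_wpM2l// (gs_L_cat gs).
by rewrite ler_peMl ?ler1n// mulr_ge0 ?(gs_c gs).
Qed.

Let dev_bound w : `|dev w| <= b1 * (size w)%:R + c1.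
Proof.
apply: le_trans (ler_normB _ _) _; rewrite normrM /b1 mulrDl -addrA lerD ?(gs_Phi_bound gs)//.
apply: le_trans (ler_wpM2l (normr_ge0 _) (gs_L_abs gs w)) _.
rewrite mulrDr mulrA lerD2l /c1 ler_peMl ?ler1n// mulr_ge0 ?(gs_c gs)//.
Qed.

Lemma len_slow (e : R) : 0 < e -> exists B : R, 0 <= B /\
  forall j, (len j)%:R <= e * (pos j)%:R + B.
Proof.
move=> e0; have [E hE] := nat_large e^-1; have [J hJ] := l_slow E.
exists (size tau + pos J)%:R; split=> // j.
case: (ltnP j J) => jJ.
  apply: (@le_trans _ _ (pos J)%:R); last first.
    by rewrite natrD -[leLHS]add0r lerD ?mulr_ge0 ?(ltW e0)// lerDr.
  by rewrite ler_nat; apply: leq_trans (pos_homo len jJ); rewrite posS leq_addl.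
have [-> _] := lenE j; rewrite !natrD [leRHS]addrCA [leLHS]addrC lerD2l.
rewrite -[leLHS]addr0 lerD//; apply: (@le_trans _ _ (e * j%:R)); last first.
  by rewrite ler_pM2l// ler_nat leq_pos.
rewrite -ler_pdivrMl//; apply: (@le_trans _ _ (l j * E)%:R); last by rewrite ler_nat hJ.
by rewrite natrM mulrC ler_wpM2l// ltW.
Qed.

Lemma block_mass_le j V : 0 <= t -> size V = pos j ->
  block_mass len om j V <= expR (- (t * L [::])) * expR (t * L V).
Proof.
move=> t0; elim: j V => [|j IH] V sV.
  by move: sV; rewrite /pos big_ord0 => /size0nil ->; rewrite -expRD addNr expR0.
rewrite /=; set V1 := take _ V; set v := drop _ V.
have sV1 : size V1 = pos j by rewrite size_takel// sV posS leq_addr.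
have [->|o0] := eqVneq (om j v) 0; first by rewrite mulr0 mulr_ge0 ?expR_ge0.
have {}o0 : 0 < om j v by rewrite lt_neqAle eq_sym o0 om_ge0.
have [w [vE _ _ _ ho]] := omP o0.
apply: le_trans (ler_pM (block_mass_ge0 len om_ge0 j V1) (om_ge0 j v) (IH V1 sV1) ho) _.
rewrite /Gmin -expRN -!expRD ler_expR -[in leRHS](cat_take_drop (pos j) V) -/V1 -/v vE.
have := gs_L_cat gs V1 (w ++ tau); have := gs_L_cat gs w tau.
rewrite !ler_norml => /andP[h1 _] /andP[h2 _].
have h : L V1 + L w + L tau - 2 * c <= L (V1 ++ (w ++ tau)) by lra.
by have := ler_wpM2l t0 h; rewrite !(mulrDr, mulrN, mulrBr); lra.
Qed.

(** A word may end inside a block. The unfinished part changes [t * L] by about [t * b * len j] at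
    most, which is small against [pos j] and is absorbed by passing from [t] to [s]. *)
Lemma moran_mass_bound (s : R) : 0 < s < t -> exists2 D : R, 0 < D & forall j w,
  (pos j <= size w <= pos j.+1)%N -> block_mass len om j (take (pos j) w) <= D * expR (s * L w).
Proof.
move=> /andP[s0 st]; have t0 : 0 < t := lt_trans s0 st.
have [[a0 bb] cc] := (gs_a gs, gs_b gs, gs_c gs).
have tb : 0 < t * b + 1 by rewrite ltr_wpDl// mulr_ge0// ltW.
have q0 : 0 < (t - s) * a / (t * b + 1) by rewrite divr_gt0// mulr_gt0// subr_gt0.
have [B [B0 hB]] := len_slow q0.
exists (expR (- (t * L [::]) + (t * b + 1) * B + 2 * (t * c) + (t - s) * c)); first exact: expR_gt0.
move=> j w /andP[w1 w2]; set V := take (pos j) w; set x := drop (pos j) w.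
have sV : size V = pos j by rewrite size_takel.
apply: le_trans (block_mass_le (ltW t0) sV) _; rewrite -!expRD ler_expR.
have sx : (size x <= len j)%N by rewrite size_drop leq_subLR -posS.
have k1 : t * (L V + L x - c) <= t * L w.
  rewrite ler_pM2l//; have := gs_L_cat gs V x; rewrite cat_take_drop ler_norml => /andP[h _].
  by lra.
have k2 : t * (- b * (size x)%:R - c) <= t * L x by rewrite ler_pM2l// (gs_L_lb gs).
have k3 : (t - s) * L w <= (t - s) * (- a * (size w)%:R + c).
  by rewrite ler_pM2l ?subr_gt0// (gs_L_ub gs).
have k4 : t * b * (size x)%:R <= (t * b + 1) * (len j)%:R.
  apply: ler_pM => //; first by rewrite mulr_ge0// ltW.
    by rewrite lerDl.
  by rewrite ler_nat.
have k5 : (t * b + 1) * (len j)%:R <= (t - s) * a * (pos j)%:R + (t * b + 1) * B.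
  have := ler_wpM2l (ltW tb) (hB j); rewrite mulrDr.
  rewrite [X in _ <= X + _ -> _](_ : _ = (t - s) * a * (pos j)%:R)//; field.
  by rewrite gt_eqF.
have k6 : (t - s) * a * (pos j)%:R <= (t - s) * a * (size w)%:R.
  by rewrite ler_pM2l ?mulr_gt0 ?subr_gt0// ler_nat.
have e1 : t * (- b * (size x)%:R - c) = - (t * b * (size x)%:R) - t * c by ring.
have e2 : (t - s) * (- a * (size w)%:R + c) = - ((t - s) * a * (size w)%:R) + (t - s) * c by ring.
have e3 : (t - s) * L w = t * L w - s * L w by ring.
rewrite e1 in k2; rewrite e2 e3 in k3; rewrite !mulrDr mulrN in k1.
move: k1 k2 k3 k4 k5 k6.
move: (t * L V) (t * L x) (t * c) (t * L w) (t * b * _) (s * L w) ((t - s) * a * (size w)%:R).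
move: ((t - s) * c) ((t * b + 1) * (len j)%:R) ((t * b + 1) * B) ((t - s) * a * (pos j)%:R).
by move=> *; lra.
Qed.

Variable u : nat -> 'I_N.
Hypothesis hu : block_codes len om u.

Lemma code_block j : exists w, [/\ mkseq u (pos j.+1) = mkseq u (pos j) ++ (w ++ tau),
  size w = l j, L w < 0 & `|word_slope Phi L w - alpha| < (k j).+1%:R^-1].
Proof.
have := hu j.+1; rewrite /= take_mkseq; last by rewrite posS leq_addr.
move=> h; have o0 : 0 < om j (drop (pos j) (mkseq u (pos j.+1))).
  rewrite lt_neqAle om_ge0 andbT eq_sym; apply/eqP => o0.
  by move: h; rewrite o0 mulr0 ltxx.
have [w [wE sw Lw ws _]] := omP o0; exists w; split=> //.
have pp : (pos j <= pos j.+1)%N by rewrite posS leq_addr.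
by rewrite -wE -(take_mkseq u pp) cat_take_drop.
Qed.

(** Relative to its length, a block deviates by at most its slope tolerance times [b], and the
    additive constants, including the one for [tau], are negligible against [l j]. *)
Let dev_increment (e : R) : 0 < e -> exists J, forall j, (J <= j)%N ->
  `|dev (mkseq u (pos j.+1)) - dev (mkseq u (pos j))| <= e * (len j)%:R.
Proof.
move=> e0; have bb := gs_b gs; have cc := gs_c gs.
pose C := c + 2 * c1 + `|dev tau|.
have [n1 hn1] := nat_large (2 * b / e); have [n2 hn2] := nat_large (2 * C / e).
rewrite ltr_pdivrMr// in hn1; rewrite ltr_pdivrMr// in hn2.
have [J hJ] := k_large (n1 + n2)%N; exists J => j /hJ kj.
have [w [-> sw Lw ws]] := code_block j; have [lE kl] := lenE j.
have s1 := dev_cat (mkseq u (pos j)) (w ++ tau); have s2 := dev_cat w tau.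
have r0 : 0 < (k j).+1%:R :> R by rewrite ltr0n.
have r1 : (k j).+1%:R^-1 <= 1 :> R by rewrite invf_le1// ler1n.
have dw : `|dev w| <= (k j).+1%:R^-1 * (b * (l j)%:R) + c.
  have -> : dev w = (word_slope Phi L w - alpha) * L w.
    by rewrite mulrBl /word_slope divfK// lt_eqF.
  rewrite normrM; apply: le_trans (ler_pM (normr_ge0 _) (normr_ge0 _) (ltW ws) (gs_L_abs gs w)) _.
  by rewrite sw mulrDr lerD2l ler_piMl.
have kb : (k j).+1%:R^-1 * (b * (l j)%:R) <= e / 2 * (l j)%:R.
  rewrite mulrA ler_wpM2r// mulrC ler_pdivrMr//.
  have : n1%:R * e <= (k j).+1%:R * e.
    by rewrite ler_pM2r// ler_nat (leq_trans (leq_addr n2 _))// (leq_trans kj).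
  by move: hn1; move: (k j).+1%:R (n1%:R) => x y; lra.
have lc : C <= e / 2 * (l j)%:R.
  have : n2%:R * e <= (l j)%:R * e.
    by rewrite ler_pM2r// ler_nat (leq_trans (leq_addl n1 _))// (leq_trans kj)// ltnW.
  by move: hn2; move: (l j)%:R (n2%:R) => x y; lra.
have ll : e * (l j)%:R <= e * (len j)%:R by rewrite ler_pM2l// lE ler_nat leq_addr.
apply: le_trans ll; move: lc kb dw s1 s2; rewrite /C.
move: (dev (_ ++ (w ++ tau))) (dev (mkseq _ _)) (dev (w ++ tau)) (dev w) (dev tau) => p1 p2 p3 p4 p5.
move: (_ * (b * _)) => q1 h1 h2; have -> : e * (l j)%:R = e / 2 * (l j)%:R + e / 2 * (l j)%:R by field.
move: (e / 2 * _) h1 h2 => q2 h1 h2; have := ler_norm p5; have := ler_norm (- p5); rewrite normrN.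
rewrite !ler_norml => ? ? /andP[? ?] /andP[? ?] /andP[? ?].
by apply/andP; split; lra.
Qed.

Let dev_pos (e : R) : 0 < e -> exists B : R, 0 <= B /\
  forall j, `|dev (mkseq u (pos j))| <= e * (pos j)%:R + B.
Proof.
move=> e0; have [J hJ] := dev_increment e0.
exists (b1 * (pos J)%:R + c1); split; first by rewrite addr_ge0// mulr_ge0.
have base j : (j <= J)%N -> `|dev (mkseq u (pos j))| <= e * (pos j)%:R + (b1 * (pos J)%:R + c1).
  move=> jJ; apply: le_trans (dev_bound _) _; rewrite size_mkseq.
  rewrite -[leLHS]add0r lerD ?mulr_ge0 ?(ltW e0)// lerD2r ler_wpM2l// ler_nat; exact: pos_homo.
elim=> [|j IH]; first exact: base.
case: (leqP j.+1 J) => jJ; first exact: base.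
have := hJ j jJ; have := ler_normD (dev (mkseq u (pos j.+1)) - dev (mkseq u (pos j)))
  (dev (mkseq u (pos j))).
by rewrite subrK posS natrD mulrDr; move: IH; lra.
Qed.

Let affine_le (e B : R) : 0 < e -> exists n0, forall n, (n0 <= n)%N -> B <= e * n%:R.
Proof.
move=> e0; have [n0 hn0] := nat_large (B / e); exists n0 => n nn.
rewrite ltr_pdivrMr// in hn0; apply: le_trans (ltW hn0) _.
by rewrite mulrC ler_pM2l// ler_nat.
Qed.

Lemma code_slope (e : R) : 0 < e -> exists n0, forall n, (n0 <= n)%N ->
  `|Phi (mkseq u n) - alpha * L (mkseq u n)| <= e * n%:R.
Proof.
move=> e0; have e30 : 0 < e / 3 by rewrite divr_gt0.
have b2 : 0 < b1 + 1 by rewrite ltr_wpDl.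
have [B1 [B10 h1]] := dev_pos e30.
have [B2 [B20 h2]] := len_slow (divr_gt0 e30 b2).
have [n0 hn0] := affine_le (B1 + (b1 + 1) * B2 + 2 * c1) e30; exists n0 => n /hn0 nB.
have /andP[p1 p2] := block_indexP len_gt0 n; set j := block_index len n in p1 p2.
have s1 := h1 j; have := dev_cat (mkseq u (pos j)) (drop (pos j) (mkseq u n)).
rewrite -[in mkseq u (pos j) ++ _](take_mkseq u p1) cat_take_drop => s2.
have s3 := dev_bound (drop (pos j) (mkseq u n)); rewrite size_drop size_mkseq in s3.
have s4 : b1 * (n - pos j)%:R <= (b1 + 1) * (len j)%:R.
  apply: ler_pM => //; first by rewrite lerDl.
  by rewrite ler_nat leq_subLR -posS ltnW.
have s5 : (b1 + 1) * (len j)%:R <= e / 3 * (pos j)%:R + (b1 + 1) * B2.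
  have := ler_wpM2l (ltW b2) (h2 j); rewrite mulrDr.
  by rewrite [X in _ <= X + _ -> _](_ : _ = e / 3 * (pos j)%:R)//; field; rewrite gt_eqF.
have s6 : e / 3 * (pos j)%:R <= e / 3 * n%:R by rewrite ler_pM2l// ler_nat.
rewrite -/(dev _); move: s1 s2 s3; rewrite !ler_norml.
have -> : e * n%:R = e / 3 * n%:R + e / 3 * n%:R + e / 3 * n%:R by field.
move: (dev (mkseq u n)) (dev (mkseq _ _)) (dev _) nB s4 s5 s6 => q1 q2 q3.
move: (e / 3 * n%:R) (e / 3 * (pos j)%:R) (b1 * _) ((b1 + 1) * _) ((b1 + 1) * B2).
move=> z1 z2 z3 z4 z5 nB s4 s5 s6 /andP[? ?] /andP[? ?] /andP[? ?].
by apply/andP; split; lra.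
Qed.

(** The occurrence of [tau] is the one that ends the block after the current one; two consecutive
    blocks are short against [n]. *)
Lemma code_dense (e : R) : 0 < e -> exists n0, forall n, (n0 <= n)%N ->
  exists n', [/\ (n <= n')%N, n'%:R <= n%:R + e * n%:R &
    mkseq u (n' + size tau) = mkseq u n' ++ tau].
Proof.
move=> e0; pose q := Num.min 1 (e / 4).
have q0 : 0 < q by rewrite lt_min ltr01 divr_gt0.
have q1 : q <= 1 by rewrite ge_min lexx.
have qe : q <= e / 4 by rewrite ge_min lexx orbT.
have [B [B0 h]] := len_slow q0; have [n0 hn0] := affine_le (3 * B) q0.
exists n0 => n /hn0 nB; have /andP[p1 p2] := block_indexP len_gt0 n.
set j := block_index len n in p1 p2.
have [w [wE sw _ _]] := code_block j.+1; have [lE _] := lenE j.+1.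
pose n' := (pos j.+1 + l j.+1)%N; exists n'.
have nn' : (n' + size tau = pos j.+2)%N by rewrite /n' (posS len j.+1) lE addnA.
have en : mkseq u n' = mkseq u (pos j.+1) ++ w.
  have le' : (n' <= pos j.+2)%N by rewrite -nn' leq_addr.
  rewrite -(take_mkseq u le') wE catA -[RHS](take_size_cat tau (erefl _)); congr take.
  by rewrite size_cat size_mkseq sw.
split.
- by apply: (leq_trans (ltnW p2)); rewrite leq_addr.
- have k1 := h j; have k2 := h j.+1.
  have k3 : (l j.+1)%:R <= (len j.+1)%:R :> R by rewrite lE ler_nat leq_addr.
  have k4 : (pos j)%:R <= n%:R :> R by rewrite ler_nat.
  have k5 : q * (pos j)%:R <= q * n%:R by rewrite ler_pM2l.
  have k6 : q * (len j)%:R <= (len j)%:R by rewrite ler_piMl.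
  have k7 : q * n%:R <= e / 4 * n%:R by rewrite ler_wpM2r.
  rewrite /n' natrD; move: k2 k7; rewrite posS natrD mulrDr.
  have -> : e * n%:R = e / 4 * n%:R * 4 by field.
  move: (q * (pos j)%:R) (q * n%:R) (q * (len j)%:R) (e / 4 * n%:R) k1 nB k5 k6 => *.
  by lra.
by rewrite nn' wE en catA.
Qed.

End MoranCodes.

(** * Lower bound for the dimension *)

Section DimensionLower.
Variables (R : realType) (d N : nat) (K : set 'rV[R]_d) (S : 'I_N -> 'rV[R]_d -> 'rV[R]_d).
Variables (p : 'I_N -> R) (mu : probability (g_sigma_algebraType (@open 'rV[R]_d)) R).
Variables (L : seq 'I_N -> R) (a b c : R) (beta : R -> R) (x0 : 'rV[R]_d) (G : R).
Variable proj : (nat -> 'I_N) -> 'rV[R]_d.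
Hypothesis N_gt0 : (0 < N)%N.
Hypothesis gs : gibbs_system (logp p) L a b c beta.
Hypothesis Kx0 : K x0.
Hypothesis hp : forall i, 0 < p i.
Hypothesis G0 : 0 < G.
Hypothesis diamL : forall w x y, K x -> K y -> enorm (Scomp S w x - Scomp S w y) <= G * expR (L w).
Hypothesis mass_ge : forall A w, open A -> (forall y, K y -> A (Scomp S w y)) ->
  prodp p w <= mass mu A.
Hypothesis mass_le : forall B stop n, open B -> mass mu B <=
  \sum_(w <- wcut stop n [::] | `[< exists2 y, K y & B (Scomp S w y) >]) prodp p w.
Hypothesis countL : forall A kap : R, exists M : nat, forall (z : 'rV[R]_d) (r : R)
  (s : seq (seq 'I_N)), 0 < r -> uniq s ->
  (forall v w, v \in s -> w \in s -> prefix v w -> v = w) ->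
  (forall v, v \in s -> enorm (Scomp S v x0 - z) <= A * r /\ `|L v - ln r| <= kap) ->
  (size s <= M)%N.
Hypothesis hproj : projection S K proj.
Hypothesis projK : forall u, K (proj u).
Variables (tau : seq 'I_N) (c2 : R).
Hypothesis c20 : 0 < c2.
Hypothesis sep : forall g h x y, size g = size h -> g <> h -> K x -> K y ->
  c2 * expR (L g) <= enorm (Scomp S (g ++ tau) x - Scomp S h y).

Definition lim_set (alpha : R) : set 'rV[R]_d :=
  [set x | K x /\ local_ratio mu x r @[r --> 0^'+] --> alpha].

Lemma moran_set (alpha t t' : R) : (forall y, t' <= alpha * y + beta y) -> t < t' ->
  lim_set alpha !=set0 /\
  forall s : R, 0 < s < t -> hausdorff_measure s (lim_set alpha) <> 0%E.
Proof.
move=> star tt'.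
have [len [om [l [k [lenE om0 om1 omP [kl ls]]]]]] := moran_blocks gs tau star tt'.
have len0 j : (0 < len j)%N by have [-> h] := lenE j; rewrite addn_gt0 (leq_ltn_trans _ h).
have codes : proj @` block_codes len om `<=` lim_set alpha.
  move=> _ [u hu <-]; split; first exact: projK.
  apply: (local_ratio_cvg gs hp G0 diamL mass_ge mass_le hproj c20 sep) => e e0.
    exact: (code_slope gs lenE om0 omP kl ls hu e0).
  exact: (code_dense lenE om0 omP ls hu e0).
split.
  have [u hu] := block_codes_neq0 N_gt0 len0 om0 om1.
  by exists (proj u); apply: codes; exists u.
move=> s st; have [D D0 hD] := moran_mass_bound gs lenE om0 omP ls st.
have /andP[s0 _] := st.
exact: (hausdorff_block_codes N_gt0 gs Kx0 G0 diamL countL hproj len0 om0 om1 s0 D0 hD codes).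
Qed.

(** If the Legendre transform is not positive, only nonemptiness matters, since exponents are
    positive. Otherwise every smaller [s] lies below an exponent to which [moran_set] applies. *)
Lemma legendre_le_dim_lim_set (alpha : R) : (legendre beta alpha <= hausdorff_dim (lim_set alpha))%E.
Proof.
have lb y : (legendre beta alpha <= (alpha * y + beta y)%:E)%E.
  by apply: ereal_inf_lbound; exists y.
case E : (legendre beta alpha) => [t| |]; last by rewrite leNye.
  have star y : t <= alpha * y + beta y by rewrite -lee_fin -E.
  have t1 : t - 1 < t by lra.
  have [ne _] := moran_set star t1; apply: hausdorff_dim_ge => // s s0 st.
  have t2 : (s + t) / 2 < t by lra.
  by have [_ h] := moran_set star t2; apply: h; rewrite s0 /=; lra.
by have := lb 0; rewrite E leye_eq.
Qed.

End DimensionLower.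

Lemma cluster_cvg_sub (R : realType) (f : R -> R) (alpha : R) :
  f r @[r --> 0^'+] --> alpha -> cluster (f r @[r --> 0^'+]) `<=` [set alpha].
Proof.
move=> cv y cy; apply/eqP/negPn/negP => ya.
have e0 : 0 < `|y - alpha| / 2 by rewrite divr_gt0// normr_gt0 subr_eq0.
have h1 := cv _ (nbhsx_ballx alpha _ e0).
have [z [az yz]] := cy _ _ h1 (nbhsx_ballx y _ e0).
move: az yz; rewrite /ball /=.
have := ler_normD (y - z) (z - alpha); rewrite addrA subrK (distrC z).
by move=> *; lra.
Qed.
Theorem theorem6p1 (R : realType) (d N : nat) (gamma : R) (V X K : set 'rV[R]_d)
  (S : 'I_N -> 'rV[R]_d -> 'rV[R]_d) (p : 'I_N -> R)
  (mu : probability (g_sigma_algebraType (@open 'rV[R]_d)) R)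
  (proj : (nat -> 'I_N) -> 'rV[R]_d) (beta : R -> R)
  (hd : (0 < d)%N) (hgamma : 0 < gamma < 1)
  (hS : conformal_ifs gamma V X S)
  (hK : self_conformal_set X S K)
  (hK2 : (1 < N)%N -> exists x y, [/\ K x, K y & x <> y])
  (hp : forall i, 0 < p i) (hp1 : \sum_(i < N) p i = 1)
  (hmu : self_conformal_measure V S p mu)
  (hproj : projection S K proj)
  (hbeta : forall q : R,
     pressure (fun u => beta q * scaling S proj u + q * pot p u) = 0) :
  let zeta C (t : R) := zeta_dyncon S p K C (fun u => t * scaling S proj u) in
  let dim_acc (C : set R) :=
    hausdorff_dim [set x | K x /\ cluster (local_ratio mu x r @[r --> 0^'+]) `<=` C] in
  let dim_lim (alpha : R) :=
    hausdorff_dim [set x | K x /\ local_ratio mu x r @[r --> 0^'+] --> alpha] in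
  (forall C : set R, closed C ->
     [/\ exists! f : \bar R, crit_exponent zeta C f,
         C `&` closure (neg_deriv_range beta) !=set0 ->
           exists! f : R, sigma_rad (zeta (rball C r) f) @[r --> 0^'+] --> 1%E,
         forall f, crit_exponent zeta C f ->
           f = ereal_sup [set legendre beta alpha | alpha in C] &
         open_set_condition X S ->
           forall f, crit_exponent zeta C f -> f = dim_acc C])
  /\ (open_set_condition X S ->
        forall (alpha : R) f, crit_exponent zeta [set alpha] f -> f = dim_lim alpha)
  /\ (forall C : set R, closed C -> is_interval C ->
        interior C `&` neg_deriv_range beta !=set0 ->
        [/\ exists! F : R, sigma_rad (zeta C F) = 1%E,
            forall F : R, sigma_rad (zeta C F) = 1%E ->
              F%:E = ereal_sup [set legendre beta alpha | alpha in C] &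
            open_set_condition X S ->
              forall F : R, sigma_rad (zeta C F) = 1%E -> F%:E = dim_acc C]).
Proof.
move=> zeta dim_acc dim_lim.
have N0 : (0 < N)%N.
  rewrite lt0n; apply/negP => /eqP N0; move: hp1; rewrite big1.
    by move/eqP; rewrite eq_sym oner_eq0.
  by move=> [i hi]; exfalso; move: hi; rewrite N0.
have [x0 Kx0] : K !=set0 by case: hK.
pose L := logdiam K S x0.
have [a [b [c [gs zb]]]] :=
  conformal_gibbs_system hd hgamma hS hK N0 Kx0 hK2 hp hproj hbeta.
have zE C t n : zeta C t n = n%:R^-1 * wsum n (fun w => if `[< C (word_slope (logp p) L w) >]
    then sup_exp (fun u => t * scaling S proj u) w else 0).
  rewrite /zeta /zeta_dyncon; congr (_ * _).
  rewrite (tuple_wsum_cond n (fun w => `[< C (word_ratio S p K w) >])); apply: eq_wsum => w _.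
  by rewrite (word_ratio_slope S hd hgamma N0 x0 hK2 w hp1).
have zeb C t n : expR (- (c * `|t|)) * (n%:R^-1 * slope_sum (logp p) L C t n) <= zeta C t n
    <= expR (c * `|t|) * (n%:R^-1 * slope_sum (logp p) L C t n).
  by rewrite zE; exact: zb.
have critP C f : closed C -> crit_exponent zeta C f <-> f = sup_star beta C.
  by move=> Cc; exact: (crit_exponentP gs zeb f Cc).
(* A cycle of inequalities: the Legendre transform at [alpha] is at most [dim_lim alpha], for
   [alpha] in [C] this is at most [dim_acc C], and that is at most the supremum of the Legendre
   transform over [C]. *)
have dims : open_set_condition X S -> forall C, closed C ->
    sup_star beta C = dim_acc C /\ forall alpha, sup_star beta [set alpha] = dim_lim alpha.
  move=> osc.
  have [G [G0 [_ SG]]] := distortion_global hd hgamma hS hK N0.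
  have [D [D0 LD]] := logdiam_lr hd hgamma hS hK N0 Kx0 hK2.
  have KX := K_sub_X hK.
  have LD' w x : K x -> L w - D <= lr S w x <= L w + D.
    by move=> /KX /(LD w); rewrite -/(L w) ler_norml => /andP[? ?]; apply/andP; split; lra.
  (* The factor [expR D] allows [L] to replace the conformal factor in the geometric estimates. *)
  pose G' := G * expR D; have G'0 : 0 < G' by rewrite mulr_gt0 ?expR_gt0.
  have diamL w x y : K x -> K y -> enorm (Scomp S w x - Scomp S w y) <= G' * expR (L w).
    move=> Kx Ky; apply: le_trans (SG w x y (KX _ Kx) (KX _ Ky)) _.
    rewrite -mulrA ler_pM2l// -expRD ler_expR addrC.
    by have /andP[] := LD' w x Kx.
  have countL (A kap : R) : exists M : nat, forall (z : 'rV[R]_d) (r : R)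
      (s : seq (seq 'I_N)), 0 < r -> uniq s ->
      (forall v w, v \in s -> w \in s -> prefix v w -> v = w) ->
      (forall v, v \in s -> enorm (Scomp S v x0 - z) <= A * r /\ `|L v - ln r| <= kap) ->
      (size s <= M)%N.
    have [M hM] := osc_count hd hgamma hS hK N0 Kx0 osc A (kap + D).
    exists M => z r s r0 us anti near; apply: (hM z r) => // v /near[h1 h2]; split=> //.
    have /andP[? ?] := LD' v x0 Kx0; move: h2; rewrite !ler_norml => /andP[? ?].
    by apply/andP; split; lra.
  have [tau [c2 [c20 sep]]] := separation hd hgamma hS hK N0 Kx0 osc.
  have sepL g h x y : size g = size h -> g <> h -> K x -> K y ->
      c2 * expR (- D) * expR (L g) <= enorm (Scomp S (g ++ tau) x - Scomp S h y).
    move=> sgh gh Kx Ky; apply: le_trans (sep g h x y sgh gh Kx Ky).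
    rewrite -mulrA ler_pM2l// -expRD ler_expR addrC.
    by have /andP[] := LD' g x0 Kx0.
  have Scont w x := @Scomp_continuous _ _ _ _ _ _ _ hS w x.
  have KV : K `<=` V by move=> x /KX; exact: (cifs_sub hS).
  have [_ Kcompact _ _] := hK.
  have mass_ge := mass_ge_prodp (cifs_open hS) (Scomp_V hS) Scont
    (Scomp_contraction hd hgamma hS N0) KV Kcompact (Scomp_K hK) Kx0 hp hmu.
  have mass_le := mass_le_cut (cifs_open hS) (Scomp_V hS) Scont
    (Scomp_contraction hd hgamma hS N0) KV Kcompact (Scomp_K hK) Kx0 hp hmu.
  have cover x n : K x -> exists w y, [/\ size w = n, K y & x = Scomp S w y].
    exact: (K_cover hK).
  have lower alpha : (legendre beta alpha <= dim_lim alpha)%E.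
    exact: (legendre_le_dim_lim_set N0 gs Kx0 hp G'0 diamL mass_ge mass_le countL hproj
      (proj_K hproj) (mulr_gt0 c20 (expR_gt0 _)) sepL).
  have upper C : closed C -> (dim_acc C <= sup_star beta C)%E.
    move=> Cc; apply: (dim_acc_set_le gs _ (good_word_near gs Kx0 hp cover G'0 diamL mass_ge
      mass_le countL) Cc).
    by rewrite mulr_gt0 ?expR_gt0.
  have sub (C : set R) alpha : C alpha -> (dim_lim alpha <= dim_acc C)%E.
    move=> Ca; apply: hausdorff_dim_subset => x [Kx cv]; split=> //.
    by apply: subset_trans (cluster_cvg_sub cv) _ => _ ->.
  have supE alpha : sup_star beta [set alpha] = legendre beta alpha.
    by rewrite /sup_star image_set1 ereal_sup1.
  move=> C Cc; split=> [|alpha].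
    apply/eqP; rewrite eq_le upper// andbT; apply: ge_ereal_sup => _ [alpha Ca <-].
    exact: le_trans (lower alpha) (sub C alpha Ca).
  apply/eqP; rewrite eq_le supE lower /= -supE.
  apply: le_trans (sub [set alpha] alpha (erefl _)) (upper _ _).
  exact: (accessible_closed_set1 (hausdorff_accessible (@Rhausdorff R))).
split; [|split].
- move=> C Cc; split.
  + exists (sup_star beta C); split; first exact/critP.
    by move=> f /critP ->.
  + move=> /(sup_star_closure gs)[t tE]; exists t; split.
      by have := (critP C t%:E Cc).2 (esym tE).
    move=> f hf; have := (critP C f%:E Cc).1 hf.
    by rewrite tE => -[].
  + by move=> f /critP ->.
  + by move=> osc f /critP -> //; have [] := dims osc C Cc.
- move=> osc alpha f; have cl1 : closed [set alpha].
    exact: (accessible_closed_set1 (hausdorff_accessible (@Rhausdorff R))).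
  move=> /(critP _ _ cl1) ->.
  by have [_ ->] := dims osc setT closedT.
move=> C Cc Ci Cn.
have intP F : sigma_rad (zeta C F) = 1%E <-> F%:E = sup_star beta C.
  exact: (sigma_rad_interval gs zeb F Cc Ci Cn).
split.
- have [t tE] : exists t : R, sup_star beta C = t%:E.
    apply: (sup_star_closure gs); case: Cn => x [Cx rx]; exists x.
    by split; [exact: interior_subset|exact: subset_closure].
  exists t; split; first by apply/intP; rewrite tE.
  by move=> F /intP; rewrite tE => -[].
- by move=> F /intP.
by move=> osc F /intP ->; have [] := dims osc C Cc.
Qed.
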